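(* Let $f:\mathbb{R}^n\to\mathbb{R}$ be continuously differentiable and convex, and let $g=(g_1,\dots,g_m):\mathbb{R}^n\to\mathbb{R}^m$ with each $g_j$ convex with locally Lipschitz gradient. Suppose $f$ is $\mu$-strongly convex with $l$-Lipschitz gradient ($lI\succeq\nabla^2f(x)\succeq\mu I$ wherever $\nabla^2f(x)$ is defined) and the Jacobian $\partial_xg(x)\in\mathbb{R}^{m\times n}$ has full row rank with $\sigma I\succeq\partial_xg(x)[\partial_xg(x)]^T\succeq\kappa I$, where $\mu,l,\sigma,\kappa>0$. Let $\rho>0$ and $$\tilde L(u,y):=\min_{x\in\mathbb{R}^n}\left\{f(x)+y^Tg(x)+\frac{\rho}{2}\|x-u\|^2\right\},\qquad u\in\mathbb{R}^n,\ y\in\mathbb{R}^m_{\ge0},$$ with unique minimizer $\tilde x(u,y)$, and let $w_\star=(u_\star,y_\star)$ be its unique saddle point on $\mathbb{R}^n\times\mathbb{R}^m_{\ge0}$. Consider the proximal primal-dual dynamics $$\dot u=-(\rho u-\rho\tilde x(u,y)),\qquad \dot y=[g(\tilde x(u,y))]_y^+ .$$ For an initial point $w(0)=(u(0),y(0))\in\mathbb{R}^n\times\mathbb{R}^m_{\ge0}$, let $\zeta(w(0))$ and $\gamma(w(0))$ be constants such that $\|y\|\le\zeta(w(0))$ and, for $x=\tilde x(u,y)$, $\nabla^2g_j(x)\preceq\gamma(w(0))I$ for all $j=1,\dots,m$ (wherever $\nabla^2 g_j$ is defined), for every $(u,y)$ in the set $$\tilde D_0(w(0))=\{(u,y)\in\mathbb{R}^n\times\mathbb{R}^m_{\ge0}:\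 \|u-u_\star\|^2+\|y-y_\star\|^2\le\|u(0)-u_\star\|^2+\|y(0)-y_\star\|^2\}.$$ Then the dynamics are semi-globally exponentially stable: for every initial point $w(0)\in\mathbb{R}^n\times\mathbb{R}^m_{\ge0}$, with $w=(u,y)$, $$\|w(t)-w_\star\|\le\|w(0)-w_\star\|e^{-ct}$$ holds (for all $t\ge0$) with the initial-point-dependent rate $$c=\min\left\{\frac{\mu\rho}{\mu+\rho},\ \frac{\kappa}{l+\rho+m\,\zeta(w(0))\,\gamma(w(0))}\right\}>0 .$$
   Context: The dynamics are designed to solve $\min_xf(x)$ subject to $g(x)\le0$, with dual variable $y\in\mathbb{R}^m_{\ge0}$. For $y\in\mathbb{R}^m_{\ge0}$ and $s\in\mathbb{R}^m$, $[s]_y^+$ is defined componentwise by $([s]_y^+)_j=s_j$ if $y_j>0$ and $([s]_y^+)_j=\max\{s_j,0\}$ if $y_j=0$. Saddle point of $\tilde L$: $\tilde L(u_\star,y)\le\tilde L(u_\star,y_\star)\le\tilde L(u,y_\star)$ for all $u\in\mathbb{R}^n$, $y\in\mathbb{R}^m_{\ge0}$. Solutions are in the Carathéodory sense (absolutely continuous, satisfying the equations for almost every $t$, with $y(t)\ge0$). *)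

(* Defs.v *)
From mathcomp Require Import all_boot all_order all_algebra.
From mathcomp Require Import all_classical all_reals all_analysis.

Set Implicit Arguments.
Unset Strict Implicit.
Unset Printing Implicit Defensive.

Import Order.TTheory GRing.Theory Num.Theory.
Import numFieldNormedType.Exports.

Local Open Scope classical_set_scope.
Local Open Scope ring_scope.

(* R^n is 'rV[R]_n.  The library norm `|x| on matrices is the sup norm, hence
   the explicit Euclidean norm; topology and derivatives do not depend on this
   choice. *)

Definition dotv (R : realType) (n : nat) (u v : 'rV[R]_n) : R :=
  \sum_(i < n) u 0 i * v 0 i.

Definition enorm (R : realType) (n : nat) (u : 'rV[R]_n) : R :=
  Num.sqrt (dotv u u).

Definition enorm2 (R : realType) (n m : nat) (u : 'rV[R]_n) (y : 'rV[R]_m) : R :=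
  Num.sqrt (enorm u ^+ 2 + enorm y ^+ 2).

Definition nonneg (R : realType) (m : nat) (y : 'rV[R]_m) : Prop :=
  forall j, 0 <= y 0 j.

Definition grad (R : realType) (n : nat) (h : 'rV[R]_n -> R) (x : 'rV[R]_n) :
    'rV[R]_n :=
  \row_i 'D_(delta_mx 0 i) h x.

Definition hessian_defined (R : realType) (n : nat) (h : 'rV[R]_n -> R)
    (x : 'rV[R]_n) : Prop :=
  differentiable (grad h) x.

(* Meaningful only where hessian_defined holds. *)
Definition hessian (R : realType) (n : nat) (h : 'rV[R]_n -> R) (x : 'rV[R]_n) :
    'M[R]_n :=
  'J (grad h) x.

Definition coord_fun (R : realType) (n m : nat) (g : 'rV[R]_n -> 'rV[R]_m)
    (j : 'I_m) (x : 'rV[R]_n) : R :=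
  g x 0 j.

(* The m x n Jacobian, whose j-th row is the gradient of g_j; the library's
   'J g x acts on row vectors and is its transpose. *)
Definition jac (R : realType) (n m : nat) (g : 'rV[R]_n -> 'rV[R]_m)
    (x : 'rV[R]_n) : 'M[R]_(m, n) :=
  \matrix_(j < m) grad (coord_fun g j) x.

Definition loewner_le (R : realType) (k : nat) (A B : 'M[R]_k) : Prop :=
  forall v : 'rV[R]_k, 0 <= (v *m (B - A) *m v^T) 0 0.

Definition convex_on_space (R : realType) (n : nat) (h : 'rV[R]_n -> R) : Prop :=
  convex_function setT h.

Definition strongly_convex (R : realType) (n : nat) (mu : R)
    (h : 'rV[R]_n -> R) : Prop :=
  convex_on_space (fun x => h x - mu / 2 * enorm x ^+ 2).

Definition lipschitz_grad (R : realType) (n : nat) (l : R)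
    (h : 'rV[R]_n -> R) : Prop :=
  forall x z, enorm (grad h x - grad h z) <= l * enorm (x - z).

Definition locally_lipschitz_grad (R : realType) (n : nat)
    (h : 'rV[R]_n -> R) : Prop :=
  forall x, exists k r : R, 0 < r /\
    forall z z', enorm (z - x) < r -> enorm (z' - x) < r ->
      enorm (grad h z - grad h z') <= k * enorm (z - z').

Definition prox_lagrangian (R : realType) (n m : nat) (f : 'rV[R]_n -> R)
    (g : 'rV[R]_n -> 'rV[R]_m) (rho : R) (u : 'rV[R]_n) (y : 'rV[R]_m)
    (x : 'rV[R]_n) : R :=
  f x + dotv y (g x) + rho / 2 * enorm (x - u) ^+ 2.

Definition is_minimizer (R : realType) (n : nat) (phi : 'rV[R]_n -> R)
    (x : 'rV[R]_n) : Prop :=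
  forall z, phi x <= phi z.

(* Ltilde and xtilde are total functions of (u, y) but are only meaningful for
   y >= 0, where the infimum is attained at a unique point. *)
Definition Ltilde (R : realType) (n m : nat) (f : 'rV[R]_n -> R)
    (g : 'rV[R]_n -> 'rV[R]_m) (rho : R) (u : 'rV[R]_n) (y : 'rV[R]_m) : R :=
  inf (range (prox_lagrangian f g rho u y)).

Definition xtilde (R : realType) (n m : nat) (f : 'rV[R]_n -> R)
    (g : 'rV[R]_n -> 'rV[R]_m) (rho : R) (u : 'rV[R]_n) (y : 'rV[R]_m) :
    'rV[R]_n :=
  xget 0 [set x | is_minimizer (prox_lagrangian f g rho u y) x].

Definition saddle_point (R : realType) (n m : nat)
    (L : 'rV[R]_n -> 'rV[R]_m -> R) (us : 'rV[R]_n) (ys : 'rV[R]_m) : Prop :=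
  nonneg ys /\
  forall u y, nonneg y -> L us y <= L us ys /\ L us ys <= L u ys.

(* [s]_y^+, for y >= 0 *)
Definition pos_proj (R : realType) (m : nat) (y s : 'rV[R]_m) : 'rV[R]_m :=
  \row_j (if 0 < y 0 j then s 0 j else Num.max (s 0 j) 0).

(* Absolute continuity on [a, b]: the intervals [p i, q i] are non-overlapping,
   i.e. for any two of them one lies to the left of the other. *)
Definition abs_continuous (R : realType) (k : nat) (a b : R)
    (h : R -> 'rV[R]_k) : Prop :=
  forall e : R, 0 < e -> exists2 d : R, 0 < d &
    forall (N : nat) (p q : 'I_N -> R),
      (forall i, a <= p i /\ p i <= q i /\ q i <= b) ->
      (forall i j, i != j -> q i <= p j \/ q j <= p i) ->
      \sum_(i < N) (q i - p i) < d ->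
      \sum_(i < N) enorm (h (q i) - h (p i)) < e.

(* Caratheodory solutions on [0, +oo) of the proximal primal-dual dynamics; the
   values of u and y at negative times are irrelevant. *)
Definition ppd_solution (R : realType) (n m : nat) (f : 'rV[R]_n -> R)
    (g : 'rV[R]_n -> 'rV[R]_m) (rho : R) (u : R -> 'rV[R]_n)
    (y : R -> 'rV[R]_m) : Prop :=
  [/\ forall t, 0 <= t -> nonneg (y t),
      forall T, 0 < T -> abs_continuous 0 T u,
      forall T, 0 < T -> abs_continuous 0 T y &
      {ae @lebesgue_measure R, forall t : R, 0 < t ->
        is_derive t 1 u
          (- (rho *: u t - rho *: xtilde f g rho (u t) (y t))) /\
        is_derive t 1 y
          (pos_proj (y t) (g (xtilde f g rho (u t) (y t))))}].

Definition D0 (R : realType) (n m : nat) (us : 'rV[R]_n) (ys : 'rV[R]_m)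
    (u0 : 'rV[R]_n) (y0 : 'rV[R]_m) (u : 'rV[R]_n) (y : 'rV[R]_m) : Prop :=
  nonneg y /\
  enorm (u - us) ^+ 2 + enorm (y - ys) ^+ 2 <=
    enorm (u0 - us) ^+ 2 + enorm (y0 - ys) ^+ 2.

(* Main.v *)
From HB Require Import structures.
Require Import Defs.
From mathcomp Require Import all_boot all_order all_algebra.
From mathcomp Require Import ring lra.
From mathcomp Require Import all_classical all_reals all_analysis.
From mathcomp Require Import measurable_realfun.

(* Put T (u, y) = (rho (u - x), - g x) with x = xtilde u y.  The saddle point w*
   satisfies xtilde w* = u* and <y - y*, g u*> <= 0 for y >= 0, so along a solution
   the absolutely continuous function V = |w - w*|^2 has
   V' <= - 2 <T w - T w*, w - w*> almost everywhere.  As T is monotone, V does not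
   increase, which keeps the solution in D0; there T is strongly monotone towards
   w* with constant c, so exp (2 c t) V does not increase either.

   Strong monotonicity is obtained infinitesimally along the segment from w* to w,
   whose points other than w are interior to D0.  Near the image by xtilde of such
   a point, the gradient of the proximal Lagrangian is (mu + rho)-strongly monotone
   and Lambda-smooth with Lambda = l + rho + m zeta gamma, and the interpolation
   inequality for such gradients gives both rates.  The smoothness comes from the
   Hessian bound, which is only available where the Hessian exists: since
   u |-> xtilde u y is onto, the bound holds on a full neighbourhood, and
   Rademacher's theorem makes it integrable along almost every segment. *)

Set Implicit Arguments.
Unset Strict Implicit.
Unset Printing Implicit Defensive.

Import Order.TTheory GRing.Theory Num.Theory.
Import numFieldNormedType.Exports.

Local Open Scope classical_set_scope.
Local Open Scope ring_scope.

(** * Norms of row vectors *)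

(** The Hessian bound concerns the points [xtilde u y] with (u, y) in [D0], and this image need not
    be convex: the segment from [us] to [xtilde u y] may leave it, so the increment of the
    Lagrangian gradient between its ends cannot be estimated in one step. [D0] itself is convex,
    hence the segment is drawn there, and every estimate in x is local.

    Both rates come from one inequality on increments du, dy, dx. The term in du carries rho - rho^2
    / (mu + rho), which is mu rho / (mu + rho). The term in dy is the square of dy times the
    Jacobian, divided by Lambda, and the lower bound kappa on the Gram matrix turns it into kappa /
    Lambda. In Lambda, m zeta bounds the sum of the multipliers that weight the Hessians of the g_j.
    Linearizing g costs an error of order |dy| |dx|^2, cubic in the step along the segment while the
    main terms are quadratic, so it disappears in the limit. *)

Section rv_norm.
Context {R : realType} {n : nat}.
Implicit Types x : 'rV[R]_n.

Lemma rv_norm_leP x (e : R) : 0 <= e -> (forall i, `|x 0 i| <= e) <-> `|x| <= e.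
Proof.
move=> e0; rewrite [X in _ <-> is_true (X <= _)]/Num.Def.normr/= mx_normrE; split.
  move=> H; apply/bigmax_leP; split=> // -[i j] _ /=.
  by rewrite (ord1 i).
by move=> /bigmax_leP[_ H] i; exact: (H (0, i)).
Qed.

Lemma coord_le_norm x i : `|x 0 i| <= `|x|.
Proof. by move: i; apply/rv_norm_leP. Qed.

Lemma norm_delta_mx_le (i : 'I_n) : `|delta_mx 0 i : 'rV[R]_n| <= 1.
Proof.
by apply/rv_norm_leP => // j; rewrite mxE eqxx /=; case: eqP; rewrite ?normr1 ?normr0.
Qed.

End rv_norm.

Section dotv.
Context {R : realType} {n : nat}.
Implicit Types a b w x : 'rV[R]_n.

Lemma dotvDl (a b w : 'rV[R]_n) : dotv (a + b) w = dotv a w + dotv b w.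
Proof.
by rewrite /dotv -big_split/=; apply: eq_bigr => i _; rewrite mxE mulrDl.
Qed.

Lemma dotvDr (a b w : 'rV[R]_n) : dotv w (a + b) = dotv w a + dotv w b.
Proof.
by rewrite /dotv -big_split/=; apply: eq_bigr => i _; rewrite mxE mulrDr.
Qed.

Lemma dotvZl c (a w : 'rV[R]_n) : dotv (c *: a) w = c * dotv a w.
Proof.
by rewrite /dotv mulr_sumr; apply: eq_bigr => i _; rewrite mxE mulrA.
Qed.

Lemma dotvZr c (a w : 'rV[R]_n) : dotv w (c *: a) = c * dotv w a.
Proof.
by rewrite /dotv mulr_sumr; apply: eq_bigr => i _; rewrite mxE mulrCA.
Qed.

Lemma dotvNl (a w : 'rV[R]_n) : dotv (- a) w = - dotv a w.
Proof. by rewrite -scaleN1r dotvZl mulN1r. Qed.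

Lemma dotvC (a w : 'rV[R]_n) : dotv a w = dotv w a.
Proof. by apply: eq_bigr => i _; rewrite mulrC. Qed.

Lemma dotv_delta (a : 'rV[R]_n) i : dotv a (delta_mx 0 i) = a 0 i.
Proof.
rewrite /dotv (bigD1 i)//= big1 ?addr0 => [|j ji].
  by rewrite mxE !eqxx mulr1.
by rewrite mxE (negbTE ji) andbF mulr0.
Qed.

Lemma dotv_norm_le (a w : 'rV[R]_n) : `|dotv a w| <= n%:R * `|a| * `|w|.
Proof.
apply: le_trans (ler_norm_sum _ _ _) _.
apply: (@le_trans _ _ (\sum_(i < n) `|a| * `|w|)).
  by apply: ler_sum => i _; rewrite normrM ler_pM// coord_le_norm.
by rewrite sumr_const card_ord -[leLHS]mulr_natl mulrA.
Qed.

Lemma dotvNr (a w : 'rV[R]_n) : dotv a (- w) = - dotv a w.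
Proof. by rewrite dotvC dotvNl dotvC. Qed.

Lemma dotvBl (a b w : 'rV[R]_n) : dotv (a - b) w = dotv a w - dotv b w.
Proof. by rewrite dotvDl dotvNl. Qed.

Lemma dotvBr (a b w : 'rV[R]_n) : dotv w (a - b) = dotv w a - dotv w b.
Proof. by rewrite dotvDr dotvNr. Qed.

Lemma dotv0l (w : 'rV[R]_n) : dotv 0 w = 0.
Proof. by rewrite -[0](scale0r w) dotvZl mul0r. Qed.

Lemma dotv0r (w : 'rV[R]_n) : dotv w 0 = 0.
Proof. by rewrite dotvC dotv0l. Qed.

Lemma dotv_ge0 a : 0 <= dotv a a.
Proof. by apply: sumr_ge0 => i _; rewrite -expr2 sqr_ge0. Qed.

Lemma coord_sqr_le_dotv a i : a 0 i ^+ 2 <= dotv a a.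
Proof.
rewrite /dotv (bigD1 i)//= expr2 lerDl; apply: sumr_ge0 => j _.
by rewrite -expr2 sqr_ge0.
Qed.

Lemma dotv_eq0 a : dotv a a = 0 -> a = 0.
Proof.
move=> a0; apply/rowP => i; rewrite mxE; apply/eqP; rewrite -sqrf_eq0.
by rewrite eq_le sqr_ge0 andbT -a0 coord_sqr_le_dotv.
Qed.

Lemma enorm_ge0 a : 0 <= enorm a.
Proof. exact: sqrtr_ge0. Qed.

Lemma enorm_sqr a : enorm a ^+ 2 = dotv a a.
Proof. by rewrite sqr_sqrtr// dotv_ge0. Qed.

Lemma norm_le_enorm a : `|a| <= enorm a.
Proof.
apply/(rv_norm_leP _ (enorm_ge0 a)) => i.
rewrite -(ler_pXn2r (_ : 0 < 2)%N) ?nnegrE ?enorm_ge0// real_normK ?num_real//.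
by rewrite enorm_sqr coord_sqr_le_dotv.
Qed.

Lemma dotv_le_norm a : dotv a a <= n%:R * `|a| ^+ 2.
Proof.
by apply: le_trans (ler_norm _) _; rewrite expr2 mulrA; exact: dotv_norm_le.
Qed.

Lemma enorm_le_norm a : enorm a <= n%:R * `|a|.
Proof.
rewrite -(ler_pXn2r (_ : 0 < 2)%N) ?nnegrE ?enorm_ge0 ?mulr_ge0//.
rewrite enorm_sqr; apply: le_trans (dotv_le_norm a) _.
rewrite exprMn ler_wpM2r ?sqr_ge0// expr2 -natrM ler_nat.
by case: (n) => // m; rewrite leq_pmulr.
Qed.

(** The component of [a] orthogonal to [b] has a nonnegative square. *)
Lemma dotv_cauchy_schwarz_sqr a b : dotv a b ^+ 2 <= dotv a a * dotv b b.
Proof.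
have [b0|b0] := eqVneq (dotv b b) 0.
  by rewrite (dotv_eq0 b0) !dotv0r expr0n/= mulr0.
have bp : 0 < dotv b b by rewrite lt_neqAle eq_sym b0 dotv_ge0.
have := dotv_ge0 (a - (dotv a b / dotv b b) *: b).
rewrite dotvBl !dotvBr !dotvZl !dotvZr (dotvC b a).
set x := dotv a b; set y := dotv b b in b0 bp *; set z := dotv a a.
have -> : z - x / y * x - (x / y * x - x / y * (x / y * y)) = z - x ^+ 2 / y.
  by field.
by rewrite subr_ge0 ler_pdivrMr.
Qed.

Lemma dotv_le_enorm a b : dotv a b <= enorm a * enorm b.
Proof.
rewrite (le_trans (ler_norm _))// -(ler_pXn2r (_ : 0 < 2)%N) ?nnegrE ?mulr_ge0 ?enorm_ge0//.
by rewrite real_normK ?num_real// exprMn !enorm_sqr dotv_cauchy_schwarz_sqr.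
Qed.

Lemma dotv_abs_le_enorm a b : `|dotv a b| <= enorm a * enorm b.
Proof.
rewrite ler_norml dotv_le_enorm andbT lerNl -dotvNl.
apply: le_trans (dotv_le_enorm _ _) _.
by rewrite {1}/enorm dotvNl dotvNr opprK.
Qed.

Lemma enormN a : enorm (- a) = enorm a.
Proof. by rewrite /enorm dotvNl dotvNr opprK. Qed.

Lemma enormZ c a : enorm (c *: a) = `|c| * enorm a.
Proof. by rewrite /enorm dotvZl dotvZr mulrA -expr2 sqrtrM ?sqr_ge0// sqrtr_sqr. Qed.

Lemma enorm0 : enorm (0 : 'rV[R]_n) = 0.
Proof. by rewrite /enorm dotv0l sqrtr0. Qed.

Lemma enorm_triangle a b : enorm (a + b) <= enorm a + enorm b.
Proof.
rewrite -(ler_pXn2r (_ : 0 < 2)%N) ?nnegrE ?addr_ge0 ?enorm_ge0//.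
rewrite sqrrD !enorm_sqr dotvDl !dotvDr (dotvC b a).
by have := dotv_le_enorm a b; lra.
Qed.

Lemma enorm_eq0 a : enorm a = 0 -> a = 0.
Proof. by move=> a0; apply: dotv_eq0; rewrite -enorm_sqr a0 expr0n. Qed.

End dotv.

(** * Almost everywhere differentiability on the line *)

Lemma lipschitz_continuous (R : realType) (V W : normedModType R) (k : V -> W) (L : R) :
  (forall x y, `|k x - k y| <= L * `|x - y|) -> continuous k.
Proof.
move=> kL x; apply/cvgrPdist_le => e e0.
have M0 : 0 < `|L| + 1 by rewrite ltr_wpDl.
have d0 : 0 < e / (`|L| + 1) by rewrite divr_gt0.
apply/nbhs_ballP; exists (e / (`|L| + 1)) => // y.
rewrite -ball_normE /= => /ltW xy; apply: le_trans (kL x y) _.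
apply: (@le_trans _ _ ((`|L| + 1) * `|x - y|)).
  by apply: ler_wpM2r => //; rewrite (le_trans (ler_norm _))// lerDl.
by rewrite mulrC -ler_pdivlMr.
Qed.

Section lebesgue_derivation.
Context {R : realType}.
Implicit Types (k : R -> R) (L : R).

Section dominated.
Variables (F G : cumulative R R).
Hypothesis FG : forall x, F x + G x = x.
Local Notation leb := (@lebesgue_measure R).
Local Notation lsm := (@lebesgue_stieltjes_measure R).

Lemma lsm_itvoc (H : cumulative R R) (a b : R) : a <= b ->
  lsm H `]a, b]%classic = (H b - H a)%:E.
Proof.
move=> ab; rewrite /lebesgue_stieltjes_measure /measure_extension.
by rewrite measurable_mu_extE/= ?wlength_itv_bnd//; exact: is_ocitv.
Qed.

(** As F + G is the identity, both sides agree on half-open intervals, which determine Lebesgue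
    measure. *)
Let addE (X : set (measurableTypeR R)) : measurable X ->
  leb X = (lsm F X + lsm G X)%E.
Proof.
move=> mX; rewrite -[RHS]measure_addE; apply: lebesgue_measure_unique => // Y.
move=> /ocitvP[->|[[a b]/= ab ->]]; first by rewrite !measure0.
rewrite [RHS]measure_addE lebesgue_measure_itv/= lte_fin ab.
rewrite -[RHS]/(lsm F `]a, b]%classic + lsm G `]a, b]%classic)%E.
rewrite (lsm_itvoc F (ltW ab)) (lsm_itvoc G (ltW ab)).
rewrite -!EFinD/=; congr (_%:E).
by rewrite -[in LHS](FG b) -[in LHS](FG a) opprD addrACA.
Qed.

Lemma lsm_le (X : set (measurableTypeR R)) : measurable X ->
  (lsm F X <= leb X)%E.
Proof. by move=> mX; rewrite addE// leeDl. Qed.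

(* The Stieltjes measure of F is dominated by Lebesgue measure, so F is an
   integral of its Radon-Nikodym density. *)
Lemma cumulative_ae_derivable (a b : R) :
  {ae leb, forall x, a < x -> x < b -> derivable F x 1}.
Proof.
have [ba|ab] := leP b a.
  apply: aeW => x ax xb; move: (lt_trans ax xb); by rewrite ltNge ba.
have mD : measurable (`]a, b]%classic : set (measurableTypeR R)).
  exact: measurable_itv.
have Doo : (lsm F `]a, b]%classic < +oo)%E by rewrite lsm_itvoc ?(ltW ab)// ltry.
have dom : mfrestr mD Doo `<< leb.
  apply/null_content_dominatesP => A mA A0.
  apply/eqP; rewrite eq_le measure_ge0 andbT /= /mfrestr /mrestr -A0.
  apply: le_trans (lsm_le _) _; first exact: measurableI.
  by apply: le_measure; rewrite ?inE//; exact: measurableI.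
have [f [f0 ffin fint fE]] := radon_nikodym_sigma_finite dom.
pose g x := fine (f x).
have fg : EFin \o g = f by apply/funext => x /=; rewrite fineK.
have gint : leb.-integrable setT (EFin \o g) by rewrite fg.
(* This primitive of the density is derivable almost everywhere by Lebesgue's differentiation
   theorem, and equals F - F a on ]a, b[. *)
set H := fun x => \int[leb]_(t in [set` Interval (BRight a) (BRight x)]) g t.
have intf y : leb.-integrable [set` Interval (BRight a) (BRight y)] (EFin \o g).
  by apply: integrableS gint => //; exact: measurable_itv.
have := FTC1 intf (open_integrable_locally openT gint).
apply: filterS; first exact: (ae_filter_ringOfSetsType leb).
move=> x /= + ax xb => /(_ _)[]; first by rewrite lte_fin.
move=> dH _.
have : derivable (H + cst (F a)) x 1.
  exact: (derivableD dH (derivable_cst _ _ _)).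
apply: near_eq_derivable.
near=> y.
have ay : a < y by near: y; exact: lt_nbhsr.
have yb : y < b by near: y; exact: lt_nbhsl.
rewrite fctE /H /Rintegral -[(fun _ => (g _)%:E)]/(EFin \o g) fg.
have -> : (\int[leb]_(t in `]a, y]) f t)%E = lsm F `]a, y]%classic.
  rewrite -fE; last exact: measurable_itv.
  rewrite /mfrestr /mrestr /=; congr lebesgue_stieltjes_measure.
  by apply: setIidl; apply: subset_itvl; rewrite bnd_simp ltW.
by rewrite lsm_itvoc ?(ltW ay)//= subrK.
Unshelve. all: by end_near. Qed.

End dominated.

Section contraction.
Variable k : R -> R.
Hypothesis kL : forall x y, `|k x - k y| <= 2^-1 * `|x - y|.

(* x / 2 + k x and x / 2 - k x are nondecreasing and their sum is x. *)
Let F s x := x / 2 + s * k x.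

Let ndF s : `|s| <= 1 -> {homo F s : x y / x <= y}.
Proof.
move=> s1 x y xy; rewrite /F -subr_ge0.
have : `|s * (k y - k x)| <= 2^-1 * (y - x).
  rewrite normrM -[leRHS]mul1r ler_pM// (le_trans (kL _ _))//.
  by rewrite ger0_norm ?subr_ge0.
rewrite ler_norml => /andP[+ _]; lra.
Qed.

Let cF s : continuous (F s).
Proof.
move=> x; apply: cvgD; first by apply: cvgMr_tmp; exact: cvg_id.
by apply: cvgMl_tmp; exact: lipschitz_continuous kL x.
Qed.

Let Fp := F 1.
Let Fm := F (-1).
Let ndFp : {homo Fp : x y / x <= y}.
Proof. by apply: ndF; rewrite normr1. Qed.
Let ndFm : {homo Fm : x y / x <= y}.
Proof. by apply: ndF; rewrite normrN1. Qed.
HB.instance Definition _ := isCumulative.Build R _ R Fp ndFp (right_continuousW (@cF 1)).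
HB.instance Definition _ := isCumulative.Build R _ R Fm ndFm (right_continuousW (@cF (-1))).

Lemma contraction_ae_derivable :
  {ae @lebesgue_measure R, forall x, derivable k x 1}.
Proof.
have FG x : Fp x + Fm x = x.
  by rewrite /Fp /Fm /F; field.
(* The density argument works on bounded intervals; the intervals ]-n, n[ exhaust the line. *)
have : {ae @lebesgue_measure R, forall x, forall n : nat,
    - n%:R < x -> x < n%:R -> derivable Fp x 1}.
  by apply: ae_foralln => n; exact: (cumulative_ae_derivable FG).
apply: filterS; first exact: (ae_filter_ringOfSetsType (@lebesgue_measure R)).
move=> x /(_ (Num.bound `|x|)) H.
have := archi_boundP (normr_ge0 x); rewrite ltr_norml => /andP[xl xr].
have {xl xr}H := H xl xr.
have d2 : derivable (2^-1 \*: (id : R -> R)) x 1.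
  have h := @derivableZ _ _ _ _ 2^-1 _ _ (@derivable_id R R x 1); exact: h.
have : derivable (Fp - 2^-1 \*: (id : R -> R)) x 1.
  have h := derivableB H d2; exact: h.
congr (derivable _ x 1); apply/funext => y.
by rewrite /Fp /F !fctE/= /GRing.scale/= mul1r mulrC addrAC subrr add0r.
Qed.

End contraction.

(** Dividing by 2 (|L| + 1) reduces to Lipschitz constant 1/2. *)
Lemma lipschitz_ae_derivable k L :
  (forall x y, `|k x - k y| <= L * `|x - y|) ->
  {ae @lebesgue_measure R, forall x, derivable k x 1}.
Proof.
move=> kL; pose M : R := `|L| + 1; have M0 : 0 < M by rewrite ltr_wpDl.
pose k' (x : R) : R := (2 * M)^-1 * k x.
have kL' x y : `|k' x - k' y| <= 2^-1 * `|x - y|.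
  rewrite -mulrBr normrM gtr0_norm ?invr_gt0 ?mulr_gt0// invfM -mulrA.
  rewrite ler_wpM2l ?invr_ge0// mulrC ler_pdivrMr// mulrC (le_trans (kL _ _))//.
  by rewrite ler_wpM2r// (le_trans (ler_norm _))// lerDl.
have := contraction_ae_derivable kL'.
apply: filterS; first exact: (ae_filter_ringOfSetsType (@lebesgue_measure R)).
move=> x h; have := @derivableZ _ _ _ _ (2 * M) _ _ h.
congr (derivable _ x 1); apply/funext => y.
by rewrite /k' /= /GRing.scale/= mulrA divff ?mul1r// mulf_neq0// gt_eqF.
Qed.

End lebesgue_derivation.

(** * Monotonicity of absolutely continuous functions *)

(** At the supremum c of the points where P holds, the hypothesis carries P from a point just left
    of c to c and beyond it, so c cannot be less than b. *)
Lemma real_induction (R : realType) (a b : R) (P : R -> Prop) :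
  a <= b -> P a ->
  (forall x, a <= x -> x <= b -> exists2 d, 0 < d &
     forall s t, a <= s -> t <= b -> x - d <= s -> s <= x -> x <= t ->
       t <= x + d -> P s -> P t) ->
  P b.
Proof.
move=> ab Pa H; pose S := [set t | [/\ a <= t, t <= b & P t]].
have Sa : S a by [].
have hS : has_sup S by split; [exists a|exists b => t []].
pose c := sup S.
have ac : a <= c by apply: ub_le_sup => //; case: hS.
have cb : c <= b by apply: ge_sup; [exists a|move=> t []].
have [d d0 Hd] := H c ac cb.
have [s [as_ sb Ps] cs] := sup_adherent d0 hS.
have sc : s <= c by apply: ub_le_sup => //; case: hS.
have ltcd : c <= c + d by rewrite lerDl ltW.
have Hs t : c <= t -> t <= c + d -> t <= b -> P t.
  by move=> ct tcd tb; apply: (Hd s) => //; exact: ltW.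
have [bcd|cdb] := leP b (c + d); first exact: Hs.
have : S (c + d).
  split; [exact: le_trans ltcd|exact: ltW|].
  by apply: Hs => //; exact: ltW.
move=> /(ub_le_sup hS.2); rewrite -/c => le.
by move: d0; rewrite ltNge; move: le; rewrite gerDl => ->.
Qed.

Definition ac_real (R : realType) (a b : R) (h : R -> R) : Prop :=
  forall e : R, 0 < e -> exists2 d : R, 0 < d &
    forall (N : nat) (p q : 'I_N -> R),
      (forall i, a <= p i /\ p i <= q i /\ q i <= b) ->
      (forall i j, i != j -> q i <= p j \/ q j <= p i) ->
      \sum_(i < N) (q i - p i) < d ->
      \sum_(i < N) `|h (q i) - h (p i)| < e.

(** An upper form of nonpositive derivative, over intervals that contain x instead of intervals
    ending at x: this is the shape of the step in [real_induction]. *)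
Definition straddle_le0 (R : realType) (h : R -> R) (x : R) : Prop :=
  forall e, 0 < e -> exists2 d, 0 < d & forall s t,
    x - d <= s -> s <= x -> x <= t -> t <= x + d -> h t - h s <= e * (t - s).

(* The exceptional null set is covered by an open set U of small measure.  Real
   induction bounds the growth of h by e per unit length outside U, plus the
   increments over disjoint subintervals of U, small by absolute continuity. *)
Lemma ac_ae_nonincreasing (R : realType) (a b : R) (h : R -> R) :
  a <= b -> ac_real a b h ->
  {ae @lebesgue_measure R, forall x, a < x -> x < b -> straddle_le0 h x} ->
  h b <= h a.
Proof.
move=> ab ach aeh; apply/ler_addgt0Pr => e' e'0.
(* Growth outside U costs e (b - a), the increments inside U cost e; together this is e'. *)
pose e := e' / (b - a + 1).
have ba0 : 0 < b - a + 1 by rewrite ltr_wpDl// subr_ge0.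
have e0 : 0 < e by rewrite divr_gt0.
have [d d0 Hd] := ach e e0.
have [A [mA A0 NA]] := aeh.
(* The end points join the null set, since [straddle_le0] is not assumed there. *)
pose D : set (measurableTypeR R) := A `|` [set a] `|` [set b].
have mD : measurable D.
  by apply: measurableU => //; apply: measurableU.
have D0 : lebesgue_measure D = 0%E.
  have m1 (x : R) : measurable ([set x] : set (measurableTypeR R)).
    exact: measurable_set1.
  have z1 (x : R) : lebesgue_measure [set x] = 0%E := lebesgue_measure_set1 x.
  have mAa : measurable (A `|` [set a] : set (measurableTypeR R)).
    exact: measurableU.
  rewrite /D (measureU0 mAa (m1 b) (z1 b)).
  rewrite (measureU0 mA (m1 a) (z1 a)); exact: A0.
have Doo : (lebesgue_measure D < +oo)%E by rewrite D0 ltry.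
have [U [oU DU UD]] := lebesgue_regularity_outer mD Doo d0.
have mU : measurable (U : set (measurableTypeR R)) by exact: measurable_realfun.open_measurable.
have Ud : (lebesgue_measure U < d%:E)%E.
  have -> : U = (U `\` D) `|` D by rewrite setUC setDUK.
  rewrite (measureU0 (mu := lebesgue_measure) (measurableD mU mD) mD D0); exact: UD.
(* The list records the intervals spent inside U up to time t. Their total length is charged to the
   measure of U, hence stays below d. *)
pose P t := exists s : seq (R * R),
  [/\ all (fun x => [&& a <= x.1, x.1 <= x.2 & x.2 <= t]) s,
      pairwise (fun x y => x.2 <= y.1) s,
      h t - h a <= e * (t - a) + \sum_(x <- s) `|h x.2 - h x.1| &
      ((\sum_(x <- s) (x.2 - x.1))%:E <= lebesgue_measure (U `&` `]-oo, t]))%E].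
have : P b.
  apply: (real_induction ab).
    by exists [::]; split; rewrite ?big_nil// !subrr mulr0 addr0.
  move=> x ax xb.
  have mUt t : measurable (U `&` `]-oo, t] : set (measurableTypeR R)).
    by apply: measurableI => //; exact: measurable_itv.
  have [Ux|Ux] := pselect (U x).
    have /nbhs_ballP[r r0 rU] : nbhs x U by exact: open_nbhs_nbhs.
    exists (r / 2); first by rewrite divr_gt0.
    move=> s t as_ tb xs sx xt tx [l [l1 l2 l3 l4]].
    have st : s <= t by exact: le_trans xt.
    exists (rcons l (s, t)); split.
    - rewrite all_rcons /= as_ st lexx /=; apply: sub_all l1 => -[p q] /=.
      by move=> /and3P[-> -> /le_trans->].
    - rewrite pairwise_rcons l2 andbT; apply: sub_all l1 => -[p q] /=.
      by move=> /and3P[].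
    - rewrite big_rcons/=; move: (ler_norm (h t - h s)) l3.
      have : e * (s - a) <= e * (t - a) by rewrite ler_wpM2l ?(ltW e0)// lerD2r.
      set X := \sum_(_ <- _) _; lra.
    - rewrite big_rcons/= EFinD addeC.
      have -> : U `&` `]-oo, t] = (U `&` `]-oo, s]) `|` `]s, t].
        apply/seteqP; split => y /=; rewrite !in_itv/=.
          move=> [Uy yt]; have [ys|sy] := leP y s; first by left.
          by right; rewrite yt.
        move=> [[Uy ys]|/andP[sy yt]]; first by split => //; exact: le_trans st.
        split => //; apply: rU; rewrite /ball/= ltr_norml; apply/andP; split; lra.
      have mst : measurable (`]s, t]%classic : set (measurableTypeR R)).
        exact: measurable_itv.
      have lst : lebesgue_measure (`]s, t]%classic : set (measurableTypeR R)) = (t - s)%:E.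
        rewrite lebesgue_measure_itv/= lte_fin.
        move: st; rewrite le_eqVlt => /predU1P[->|->]; last by rewrite EFinB.
        by rewrite ltxx subrr.
      have -> : lebesgue_measure (U `&` `]-oo, s] `|` `]s, t]) =
          (lebesgue_measure (U `&` `]-oo, s]) + (t - s)%:E)%E.
        rewrite -lst; apply: (measureU lebesgue_measure (mUt s) mst).
        apply/seteqP; split => y //=; rewrite !in_itv/= => -[[_ ys] /andP[]].
        by rewrite ltNge ys.
      by rewrite addeC leeD.
  have xD : ~ D x by move/DU.
  have {}ax : a < x.
    rewrite lt_neqAle ax andbT; apply/eqP => xa; apply: xD.
    by left; right; rewrite xa.
  have {}xb : x < b.
    by rewrite lt_neqAle xb andbT; apply/eqP => xa; apply: xD; right.
  have sx : straddle_le0 h x.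
    apply: contrapT => nsx; apply: xD; left; left; apply: NA => /=.
    by move=> /(_ ax xb).
  have [r r0 Hr] := sx e e0.
  exists r => // s t as_ tb xs sx' xt tx [l [l1 l2 l3 l4]].
  have st : s <= t by exact: le_trans xt.
  exists l; split => //.
  - by apply: sub_all l1 => -[p q] /= /and3P[-> -> /le_trans->].
  - move: (Hr s t xs sx' xt tx) l3; set X := \sum_(_ <- _) _.
    by rewrite !mulrBr; lra.
  - apply: le_trans l4 _; apply: le_measure; rewrite ?inE//.
    move=> y /=; rewrite !in_itv/= => -[Uy ys]; split => //.
    exact: le_trans st.
move=> [l [l1 l2 l3 l4]].
suff X : \sum_(x <- l) `|h x.2 - h x.1| < e.
  have : e * (b - a) + e = e' by rewrite -[X in _ + X]mulr1 -mulrDr /e divfK// gt_eqF.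
  move: X l3; set X := \sum_(_ <- _) _; lra.
rewrite (big_nth (0, 0)) big_mkord.
have Hl (i : 'I_(size l)) := allP l1 _ (mem_nth (0,0) (ltn_ord i)).
apply: (Hd (size l) (fun i => (nth (0, 0) l i).1) (fun i => (nth (0, 0) l i).2)).
- by move=> i; have /and3P[] := Hl i.
- move=> i j ij.
  have /(pairwiseP (0, 0)) pw := l2.
  have [ij'|ji] := ltnP i j; first by left; apply: pw => //; rewrite inE.
  by right; apply: pw; rewrite ?inE// ltn_neqAle ji andbT eq_sym.
- rewrite -lte_fin; apply: le_lt_trans Ud.
  rewrite -(big_mkord xpredT (fun i => (nth (0, 0) l i).2 - (nth (0, 0) l i).1)).
  rewrite -(big_nth (0, 0) xpredT (fun x : R * R => x.2 - x.1)).
  apply: le_trans l4 _; apply: le_measure; rewrite ?inE//.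
  by apply: measurableI => //; exact: measurable_itv.
Qed.

Lemma derivable_approx (R : realType) (V W : normedModType R) (f : V -> W) (x v : V) :
  derivable f x v -> forall e, 0 < e -> exists2 d, 0 < d &
    forall t : R, `|t| <= d -> `|f (x + t *: v) - f x - t *: 'D_v f x| <= e * `|t|.
Proof.
move=> df e e0; have /cvgrPdist_le /(_ e e0) := df.
rewrite /dnbhs /within/= => /nbhs_ballP[d d0 Hd].
exists (d / 2); first by rewrite divr_gt0.
move=> t td; have [->|t0] := eqVneq t 0.
  by rewrite !scale0r addr0 subrr subr0 !normr0 mulr0.
have := Hd t; rewrite /ball/= sub0r normrN => /(_ _ t0) H.
have tne : `|t| != 0 by rewrite normr_eq0.
have {H} : `|'D_v f x - t^-1 *: (f (t *: v + x) - f x)| <= e.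
  by apply: H; apply: le_lt_trans td _; rewrite ltr_pdivrMr// ltr_pMr// ltr1n.
rewrite -(ler_pM2r (_ : 0 < `|t|)) ?normr_gt0// => H.
apply: le_trans H; rewrite -[X in _ * X]ger0_norm// normr_id mulrC -normrZ.
by rewrite scalerBr scalerA divff// scale1r distrC addrC [x + _]addrC addrC.
Qed.

(** * Rademacher's theorem *)

Definition borel {T : topologicalType} : set (set T) := <<s [set U | open U] >>.

Section borel.
Context {T : topologicalType}.

Lemma borel_open (A : set T) : open A -> borel A.
Proof. exact: sub_sigma_algebra. Qed.

Lemma borelC (A : set T) : borel A -> borel (~` A).
Proof. by move=> bA; rewrite -setTD; exact: sigma_algebraCD. Qed.

Lemma borel_bigcup (F : (set T)^nat) : (forall i, borel (F i)) ->
  borel (\bigcup_i F i).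
Proof. exact: sigma_algebra_bigcup. Qed.

Lemma borel_closed (A : set T) : closed A -> borel A.
Proof.
by move=> /closed_openC oA; rewrite -(setCK A); apply: borelC; exact: borel_open.
Qed.

Lemma borel0 : borel (set0 : set T).
Proof. exact: sigma_algebra0. Qed.

Lemma borel_bigcap (F : (set T)^nat) : (forall i, borel (F i)) ->
  borel (\bigcap_i F i).
Proof.
move=> bF; rewrite -(setCK (\bigcap_i F i)) setC_bigcap; apply: borelC.
by apply: borel_bigcup => i; exact: borelC.
Qed.

Lemma borel_bigcup_count (I : countType) (F : I -> set T) :
  (forall i, borel (F i)) -> borel (\bigcup_i F i).
Proof.
move=> bF; pose G k := if unpickle k is Some i then F i else set0.
rewrite (_ : \bigcup_i F i = \bigcup_k G k).
  by apply: borel_bigcup => k; rewrite /G; case: unpickle => // *; exact: borel0.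
apply/seteqP; split => x [i _ Fx].
  by exists (pickle i) => //; rewrite /G pickleK.
by move: Fx; rewrite /G; case: unpickle => // j Fx; exists j.
Qed.

(** The sets with measurable preimage form a sigma-algebra. *)
Lemma borel_preimage_measurable d (S : measurableType d) (v : S -> T) :
  (forall U, open U -> measurable (v @^-1` U)) ->
  forall A, borel A -> measurable (v @^-1` A).
Proof.
move=> vo A; apply: (smallest_sub (X := [set B | measurable (v @^-1` B)])).
  split; rewrite /= ?preimage_set0//.
  - by move=> B mB; rewrite setTD preimage_setC; exact: measurableC.
  - by move=> F mF; rewrite preimage_bigcup; exact: bigcup_measurable.
by move=> U /vo.
Qed.

Lemma borel_preimage (S : topologicalType) (v : S -> T) :
  continuous v -> forall A, borel A -> borel (v @^-1` A).
Proof.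
move=> cv A; apply: (smallest_sub (X := [set B | borel (v @^-1` B)])).
  split; rewrite /= ?preimage_set0//; first exact: sigma_algebra0.
  - move=> B mB; rewrite setTD preimage_setC -setTD; exact: sigma_algebraCD.
  - by move=> F mF; rewrite preimage_bigcup; exact: sigma_algebra_bigcup.
move=> U oU; apply: sub_sigma_algebra; exact: open_comp.
Qed.

End borel.

Lemma borel_measurable_real (R : realType) (A : set R) :
  borel A -> measurable (A : set (measurableTypeR R)).
Proof.
move=> bA.
apply: (@borel_preimage_measurable R _ (measurableTypeR R) (fun x : R => x)) => // U oU.
exact: measurable_realfun.open_measurable.
Qed.

(** * Products of sigma-finite measures *)

Section product_sigma_finite.
Context d1 d2 (T1 : measurableType d1) (T2 : measurableType d2) (R : realType).
Variable m1 : {sigma_finite_measure set T1 -> \bar R}.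
Variable m2 : {sigma_finite_measure set T2 -> \bar R}.

(* An alias: on the library's product the canonical sigma-finite structure is
   the one of products of subprobabilities. *)
Definition prodm : set (T1 * T2) -> \bar R := (m1 \x m2)%E.

HB.instance Definition _ := Measure.on prodm.

Let prodm_sigma_finite : sigma_finite setT prodm.
Proof.
have /sigma_finiteP[F [FT Fnd Ffin]] := sigma_finiteT m1.
have /sigma_finiteP[G [GT Gnd Gfin]] := sigma_finiteT m2.
exists (fun k => F k `*` G k) => [|k].
  apply/esym; rewrite -subTset => -[x y] _.
  have [i _ Fix] : (\bigcup_k F k) x by rewrite -FT.
  have [j _ Gjy] : (\bigcup_k G k) y by rewrite -GT.
  (* Both exhaustions are nondecreasing, so one index serves both factors. *)
  exists (i + j)%N => //; split => /=.
    by move: x Fix; apply/subsetPset/Fnd/leq_addr.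
  by move: y Gjy; apply/subsetPset/Gnd/leq_addl.
have [mF oF] := Ffin k; have [mG oG] := Gfin k.
split; first exact: measurableX.
by rewrite /prodm product_measure1E// lte_mul_pinfty// ge0_fin_numE.
Qed.

HB.instance Definition _ :=
  Measure_isSigmaFinite.Build _ _ _ prodm prodm_sigma_finite.

End product_sigma_finite.

(** * Null sets of row vectors, by induction on the dimension *)

Section null_parametrization.
Context {R : realType}.
Local Notation leb := (@lebesgue_measure R).

Definition line_section n (A : set 'rV[R]_n) (x : 'rV[R]_n) (i : 'I_n) : set R :=
  [set s | A (x + s *: delta_mx 0 i)].

Lemma line_continuous n (x v : 'rV[R]_n) : continuous (fun s : R => x + s *: v).
Proof.
move=> s; apply: cvgD; first exact: cvg_cst.
by apply: cvgZr_tmp; exact: cvg_id.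
Qed.

Lemma borel_line_section n (A : set 'rV[R]_n) x i : borel A ->
  measurable (line_section A x i : set (measurableTypeR R)).
Proof.
move=> bA; apply: borel_measurable_real.
exact: (borel_preimage (@line_continuous _ x (delta_mx 0 i)) bA).
Qed.

(* A substitute for Lebesgue measure on 'rV[R]_n: the sets A with
   mu (v @^-1` A) = 0 play the role of null sets, and only Fubini's theorem along
   coordinate lines is retained. *)
Record null_param n d (T : measurableType d)
    (mu : {sigma_finite_measure set T -> \bar R}) (v : T -> 'rV[R]_n) : Prop :=
  NullParam {
    np_open : forall U, open U -> measurable (v @^-1` U);
    np_null : forall A i, borel A ->
      (forall x, leb (line_section A x i) = 0%E) -> mu (v @^-1` A) = 0%E;
    np_dense : forall N, measurable N -> mu N = 0%E ->
      forall c r, 0 < r -> exists2 t, `|v t - c| < r & ~ N t;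
    np_section : forall A i, borel A -> mu (v @^-1` A) = 0%E ->
      forall c r, 0 < r -> exists2 x, `|x - c| < r & leb (line_section A x i) = 0%E }.

Definition cons_row n (s : R) (w : 'rV[R]_n) : 'rV[R]_(1 + n) := row_mx s%:M w.

Lemma cons_row_norm n s (w : 'rV[R]_n) r : `|s| <= r -> `|w| <= r -> `|cons_row s w| <= r.
Proof.
move=> sr wr; have r0 : 0 <= r by exact: le_trans sr.
apply/(rv_norm_leP _ r0) => i.
case: (split_ordP i) => j ->; first by rewrite /cons_row row_mxEl (ord1 j) !mxE eqxx mulr1n.
rewrite /cons_row row_mxEr.
exact: le_trans (coord_le_norm _ _) wr.
Qed.

Lemma cons_rowB n s t (w z : 'rV[R]_n) : cons_row s w - cons_row t z = cons_row (s - t) (w - z).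
Proof. by rewrite /cons_row opp_row_mx add_row_mx raddfB. Qed.

Lemma cons_row_surj n (x : 'rV[R]_(1 + n)) : exists s w, x = cons_row s w.
Proof.
exists (lsubmx x 0 0), (rsubmx x); rewrite /cons_row -[LHS]hsubmxK; congr row_mx.
exact: mx11_scalar.
Qed.

Lemma cons_row_shift0 n s (w : 'rV[R]_n) t :
  cons_row s w + t *: delta_mx 0 (lshift n 0) = cons_row (s + t) w.
Proof.
apply/rowP => i; rewrite /cons_row mxE.
case: (split_ordP i) => j ->; rewrite ?row_mxEl ?row_mxEr !mxE.
  by rewrite !(ord1 j) !eqxx !mulr1n mulr1.
by rewrite eq_rlshift andbF mulr0 addr0.
Qed.

Lemma cons_row_shiftS n s (w : 'rV[R]_n) t i :
  cons_row s w + t *: delta_mx 0 (rshift 1 i) = cons_row s (w + t *: delta_mx 0 i).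
Proof.
apply/rowP => k; rewrite /cons_row mxE.
case: (split_ordP k) => j ->; rewrite ?row_mxEl ?row_mxEr !mxE.
  by rewrite eq_lrshift andbF mulr0 addr0.
by rewrite (inj_eq (@rshift_inj _ _)).
Qed.

Lemma cons_row_continuous n s : continuous (@cons_row n s).
Proof.
apply: (@lipschitz_continuous _ _ _ _ 1) => w z; rewrite mul1r cons_rowB subrr.
by apply: cons_row_norm; rewrite ?normr0.
Qed.

(** The space is a single point, so a Dirac mass serves: its null sets omit [tt], and the clauses on
    coordinate lines are vacuous. *)
Lemma null_param0 : exists d (T : measurableType d)
  (mu : {sigma_finite_measure set T -> \bar R}) (v : T -> 'rV[R]_0), null_param mu v.
Proof.
exists _, unit, [the {sigma_finite_measure set unit -> \bar R} of dirac tt], (fun=> 0).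
split => // [A []//|N _ N0 c r r0|A []//].
exists tt; first by rewrite [X in `|X|](_ : _ = 0) ?normr0//; apply/rowP => -[].
move=> Nt; have : dirac tt N = 0%E :> \bar R := N0.
by rewrite diracE mem_set// => -[] /eqP; rewrite oner_eq0.
Qed.

Lemma integral_eq0_ae d (T : measurableType d) (mu : {measure set T -> \bar R})
    (F : T -> \bar R) : measurable_fun setT F -> (forall x, 0 <= F x)%E ->
  (\int[mu]_x F x = 0)%E -> {ae mu, forall x, F x = 0%E}.
Proof.
move=> mF F0 IF.
have := ae_eq_integral_abs mu measurableT mF.
under eq_integral do rewrite gee0_abs//.
by move=> [/(_ IF) + _]; apply: filterS => x /(_ I).
Qed.

(** The image of Lebesgue measure under the translation agrees with it on half-open intervals, hence
    everywhere. *)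
Lemma lebesgue_null_shift (A : set R) (c : R) :
  measurable (A : set (measurableTypeR R)) -> leb A = 0%E ->
  leb ((fun s => s + c) @^-1` A) = 0%E.
Proof.
move=> mA A0.
have mf : measurable_fun (setT : set (measurableTypeR R))
    ((fun s => s + c) : measurableTypeR R -> measurableTypeR R).
  by apply: measurable_funD => //; exact: measurable_cst.
rewrite -[RHS]A0; apply/esym.
pose f : measurableTypeR R -> measurableTypeR R := fun s => s + c.
rewrite -[RHS]/(pushforward leb f A).
apply: (lebesgue_measure_unique (mu := pushforward leb f)) => // X.
move=> /ocitvP[->|[[a b]/= ab ->]]; first by rewrite !measure0.
rewrite /pushforward (_ : _ @^-1` _ = `]a - c, b - c]%classic).
  rewrite !lebesgue_measure_itv/= !lte_fin ltrD2r ab -!EFinB; congr (_%:E).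
  by rewrite opprB addrA subrK.
by apply/seteqP; split => s /=; rewrite !in_itv/= ltrBlDr lerBrDr.
Qed.

(** Otherwise a ball, of positive measure, would lie in a null set. *)
Lemma ae_dense (P : R -> Prop) : {ae leb, forall s, P s} ->
  forall c r : R, 0 < r -> exists2 s, `|s - c| < r & P s.
Proof.
move=> [N [mN N0 PN]] c r r0; apply: contrapT => nex.
have : (leb (ball c r) <= leb N)%E.
  apply: le_measure; rewrite ?inE//; first exact: measurable_ball.
  move=> s /= cs; apply: PN => /= Ps; apply: nex; exists s => //.
  by rewrite distrC.
rewrite N0 lebesgue_measure_ball ?(ltW r0)// lee_fin leNgt => /negP; apply.
by rewrite mulrn_wgt0.
Qed.

Section step.
Variables (n : nat) (d : measure_display) (T : measurableType d).
Variables (mu : {sigma_finite_measure set T -> \bar R}) (v : T -> 'rV[R]_n).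
Hypothesis H : null_param mu v.
Local Notation TT := (measurableTypeR R * T)%type.
Let w (p : TT) : 'rV[R]_(1 + n) := cons_row p.1 (v p.2).

(** The preimage is a countable union of rectangles over rational intervals ]a, b[. The interior in
    [V] makes the second side the preimage of an open set, to which [np_open] applies. *)
Let w_open U : open U -> measurable (w @^-1` U).
Proof.
move=> oU.
pose V (ab : rat * rat) : set 'rV[R]_n :=
  [set z | forall s, ratr ab.1 < s -> s < ratr ab.2 -> U (cons_row s z)]°.
rewrite (_ : w @^-1` U = \bigcup_(ab : rat * rat)
    (`](ratr ab.1), (ratr ab.2)[%classic `*` (v @^-1` V ab))); last first.
  apply/seteqP; split => [[s t] /= Ust|[s t] [[a b] _ /= [+ Vt]]]; last first.
    rewrite in_itv/= => /andP[sa sb].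
    by have /(_ s sa sb) := interior_subset Vt.
  have /nbhs_ballP[r r0 rU] : nbhs (cons_row s (v t)) U by exact: open_nbhs_nbhs.
  have r2 : 0 < r / 2 by rewrite divr_gt0.
  have sl : s - r / 2 < s by rewrite ltrBlDr ltrDl.
  have sr : s < s + r / 2 by rewrite ltrDl.
  have [a] := rat_in_itvoo sl; rewrite in_itv/= => /andP[a1 a2].
  have [b] := rat_in_itvoo sr; rewrite in_itv/= => /andP[b1 b2].
  exists (a, b) => //; split; first by rewrite /= in_itv/= a2.
  apply/nbhs_ballP; exists (r / 2) => /=; first by rewrite divr_gt0.
  move=> z; rewrite -ball_normE /= => /ltW vz s' as' s'b.
  apply: rU; rewrite -ball_normE /= cons_rowB.
  apply: (@le_lt_trans _ _ (r / 2)); last by rewrite ltr_pdivrMr// ltr_pMr// ltr1n.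
  apply: cons_row_norm => //; rewrite ler_norml; apply/andP; split; lra.
apply: countable_bigcupT_measurable => [|ab]; first exact: countableP.
apply: measurableX; first exact: measurable_itv.
by apply: (np_open H); exact: open_interior.
Qed.

Let xsec A s : xsection (w @^-1` A) s = v @^-1` (cons_row s @^-1` A).
Proof. by apply/seteqP; split => t; rewrite /xsection/= inE. Qed.

Let ysec A t : ysection (w @^-1` A) t = line_section A (cons_row 0 (v t)) (lshift n 0).
Proof.
by apply/seteqP; split => s; rewrite /ysection/line_section/= inE cons_row_shift0 add0r.
Qed.

Let xsec_ae (N : set TT) : measurable N -> prodm leb mu N = 0%E ->
  {ae leb, forall s, mu (xsection N s) = 0%E}.
Proof.
move=> mN N0; apply: (integral_eq0_ae (F := mu \o xsection N)) => //.
exact: measurable_fun_xsection.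
Qed.

(** Tonelli: [prodm] is by definition an integral over the first factor, while lines in the first
    direction call for the other order. *)
Let mu1E (A : set TT) : measurable A ->
  prodm leb mu A = (\int[mu]_t leb (ysection A t))%E.
Proof.
move=> mA; rewrite /prodm /product_measure1.
have := indic_fubini_tonelli leb mu mA.
by rewrite indic_fubini_tonelli_FE// indic_fubini_tonelli_GE.
Qed.

(** In the first direction the fibres carry Lebesgue measure; in the others, the slice at fixed s is
    handled in dimension n. Nearby good points are found one factor at a time. *)
Lemma null_paramS : null_param (prodm leb mu) w.
Proof.
have mw A : borel A -> measurable (w @^-1` A).
  exact: borel_preimage_measurable w_open A.
split => [|A i bA A0|N mN N0 c r r0|A i bA A0 c r r0]; first exact: w_open.
- case: (split_ordP i) A0 => j -> A0.
    rewrite [LHS]mu1E; last exact: mw.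
    apply: integral0_eq => t _; rewrite ysec.
    by have := A0 (cons_row 0 (v t)); rewrite (ord1 j).
  apply: integral0_eq => s _ /=; rewrite xsec.
  apply: (np_null H (i := j)).
    exact: (borel_preimage (@cons_row_continuous n s) bA).
  move=> x; rewrite -[RHS](A0 (cons_row s x)); congr (leb _).
  by apply/seteqP; split => t; rewrite /line_section/= cons_row_shiftS.
- have [c0 [c' ->]] := cons_row_surj c.
  have r2 : 0 < r / 2 by rewrite divr_gt0.
  have rr : r / 2 < r by rewrite ltr_pdivrMr// ltr_pMr// ltr1n.
  have [s sc Ns] := ae_dense (xsec_ae mN N0) c0 r2.
  have [t tc Nt] := np_dense H (measurable_xsection s mN) Ns c' r2.
  exists (s, t); last by move=> Nst; apply: Nt; rewrite /xsection/= inE.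
  by rewrite /w/= cons_rowB; apply: le_lt_trans rr; apply: cons_row_norm; exact: ltW.
- have [c0 [c' ->]] := cons_row_surj c.
  have r2 : 0 < r / 2 by rewrite divr_gt0.
  have rr : r / 2 < r by rewrite ltr_pdivrMr// ltr_pMr// ltr1n.
  case: (split_ordP i) => j ->.
    rewrite (ord1 j).
    move: A0; rewrite [LHS]mu1E; last exact: mw.
    move=> /(integral_eq0_ae (F := leb \o ysection (w @^-1` A))) [].
    + by apply: measurable_fun_ysection; exact: mw.
    + by move=> t /=; exact: measure_ge0.
    move=> N [mN N0 NA].
    have [t tc Nt] := np_dense H mN N0 c' r2.
    exists (cons_row c0 (v t)).
      rewrite cons_rowB subrr; apply: le_lt_trans rr; apply: cons_row_norm; last exact: ltW.
      by rewrite normr0 ltW.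
    have : leb (ysection (w @^-1` A) t) = 0%E.
      by apply: contrapT => h; apply: Nt; exact: NA.
    rewrite ysec => h.
    (* The null section was found with first coordinate 0 at the base point; the one based at c0 is
       its translate. *)
    have := lebesgue_null_shift c0 (borel_line_section _ _ bA) h.
    congr (leb _ = _); apply/seteqP; split => s;
      by rewrite /line_section/= !cons_row_shift0 add0r addrC.
  have [s sc As] := ae_dense (xsec_ae (mw _ bA) A0) c0 r2.
  move: As; rewrite xsec => As.
  have bjA := borel_preimage (@cons_row_continuous n s) bA.
  have [x xc x0] := np_section H j bjA As c' r2.
  exists (cons_row s x).
    by rewrite cons_rowB; apply: le_lt_trans rr; apply: cons_row_norm; exact: ltW.
  rewrite -[RHS]x0; congr (leb _).
  by apply/seteqP; split => t; rewrite /line_section/= cons_row_shiftS.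
Qed.
End step.

Lemma null_param_exists n : exists d (T : measurableType d)
  (mu : {sigma_finite_measure set T -> \bar R}) (v : T -> 'rV[R]_n), null_param mu v.
Proof.
elim: n => [|n [d [T [mu [v H]]]]]; first exact: null_param0.
by do 4 eexists; exact: (null_paramS H).
Qed.

End null_parametrization.

Lemma closed_forall_le (R : realType) (T : topologicalType) (I : Type)
    (P : I -> Prop) (F : I -> T -> R) (c : I -> R) :
  (forall i, P i -> continuous (F i)) ->
  closed [set x | forall i, P i -> F i x <= c i].
Proof.
move=> cF; rewrite (_ : [set _ | _] =
    \bigcap_(i in [set i | P i]) (F i @^-1` [set y | y <= c i])).
  apply: closed_bigI => i Pi; apply: preimage_closed; last exact: closed_le.
  by move=> x _; exact: cF.
by apply/seteqP; split.
Qed.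

Lemma increment_continuous (R : realType) (V : normedModType R) (k : V -> R)
  (u : V) (c : R) : continuous k -> continuous (fun x => `|k (x + u) - k x - c|).
Proof.
move=> ck x; apply: (@cvg_norm _ _ _ _ _ (fun x => k (x + u) - k x - c)).
apply: (@cvgB _ _ _ _ _ (fun x => k (x + u) - k x) (cst c)).
  apply: (@cvgB _ _ _ _ _ (fun x => k (x + u)) k); last exact: ck.
  apply: (@cvg_comp _ _ _ (fun x => x + u) k); last exact: ck.
  by apply: cvgD; [exact: cvg_id|exact: cvg_cst].
exact: cvg_cst.
Qed.

(** * Distance to a set *)

Section distance.
Context {R : realType} {V : normedModType R}.
Implicit Types (A : set V) (x y z : V).

(** For empty [A] the default value of [inf] makes the distance 0, so [dist_set_lipschitz] holds for
    every [A]. *)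
Definition dist_set A x : R := inf [set `|x - z| | z in A].

Lemma dist_set_has_inf A x z : A z -> has_inf [set `|x - z| | z in A].
Proof.
move=> Az; split; first by exists `|x - z|, z.
by exists 0 => _ [y _ <-].
Qed.

Lemma dist_set_ge0 A x : 0 <= dist_set A x.
Proof.
have [[z Az]|A0] := pselect (A !=set0).
  by apply: lb_le_inf => //; [exact: (dist_set_has_inf x Az).1|move=> _ [y _ <-]].
have -> : A = set0 by apply/seteqP; split => // z Az; apply: A0; exists z.
by rewrite /dist_set image_set0 inf0.
Qed.

Lemma dist_set_le A x z : A z -> dist_set A x <= `|x - z|.
Proof.
move=> Az; apply: ge_inf; last by exists z.
by exists 0 => _ [y _ <-].
Qed.

Lemma dist_set_lt A x c : A !=set0 -> dist_set A x < c ->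
  exists2 z, A z & `|x - z| < c.
Proof.
move=> [z0 Az0] /inf_lt[]; first by exists `|x - z0|, z0.
by move=> _ [z Az <-] ?; exists z.
Qed.

Lemma dist_set_lipschitz A x y : `|dist_set A x - dist_set A y| <= 1 * `|x - y|.
Proof.
rewrite mul1r.
have [[z0 Az0]|A0] := pselect (A !=set0); last first.
  have A00 : A = set0 by apply/seteqP; split => // z Az; apply: A0; exists z.
  by rewrite /dist_set A00 !image_set0 subrr normr0.
suff H u v : dist_set A u <= `|u - v| + dist_set A v.
  by rewrite ler_distlC lerBlDr addrC H/= addrC distrC H.
apply/ler_addgt0Pr => e e0.
have : dist_set A v < dist_set A v + e by rewrite ltrDl.
move=> /(dist_set_lt (ex_intro _ z0 Az0))[z Az vz].
apply: le_trans (dist_set_le _ Az) _; rewrite -addrA.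
apply: le_trans (ler_distD v _ _) _; rewrite lerD2l; exact: ltW.
Qed.

End distance.

(** * Lipschitz functions are linearly approximable off a null set *)

Section rademacher.
Context {R : realType} {n : nat} {d : measure_display} {T : measurableType d}.
Variables (mu : {sigma_finite_measure set T -> \bar R}) (v : T -> 'rV[R]_n).
Hypothesis H : null_param mu v.
Local Notation leb := (@lebesgue_measure R).
Implicit Types (k : 'rV[R]_n -> R) (x w : 'rV[R]_n).

(** N need not be Borel: a null Borel hull is what [np_section] is applied to. *)
Definition param_null (N : set 'rV[R]_n) : Prop :=
  exists A, [/\ borel A, mu (v @^-1` A) = 0%E & N `<=` A].

Lemma param_nullS N M : N `<=` M -> param_null M -> param_null N.
Proof.
move=> NM [A [bA A0 MA]]; exists A; split => //; exact: subset_trans MA.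
Qed.

Lemma param_null_bigcup (N : (set 'rV[R]_n)^nat) :
  (forall i, param_null (N i)) -> param_null (\bigcup_i N i).
Proof.
move=> /choice[A HA]; exists (\bigcup_i A i); split.
- by apply: borel_bigcup => i; case: (HA i).
- have m i : measurable (v @^-1` A i).
    by case: (HA i) => bA _ _; exact: borel_preimage_measurable (np_open H) _ bA.
  rewrite preimage_bigcup; apply/eqP; rewrite eq_le measure_ge0 andbT.
  have : mu.-negligible (\bigcup_i v @^-1` A i).
    apply: negligible_bigcup => i; exists (v @^-1` A i).
    by case: (HA i) => bA A0 _; split.
  move=> [B [mB B0 AB]].
  have mU : measurable (\bigcup_i v @^-1` A i) by exact: bigcupT_measurable.
  by rewrite -B0; apply: le_measure; rewrite ?inE.
- by move=> x [i _ Nx]; exists i => //; case: (HA i) => _ _; apply.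
Qed.

Lemma param_null0 : param_null set0.
Proof.
by exists set0; split => //; [exact: borel0|rewrite preimage_set0 measure0].
Qed.

Lemma param_null_bigcup_count (I : countType) (N : I -> set 'rV[R]_n) :
  (forall i, param_null (N i)) -> param_null (\bigcup_i N i).
Proof.
move=> HN.
apply: (@param_nullS _ (\bigcup_k if unpickle k is Some i then N i else set0)).
  move=> x [i _ Nx]; exists (pickle i) => //; rewrite pickleK //.
by apply: param_null_bigcup => j; case: unpickle => // *; exact: param_null0.
Qed.

Lemma param_nullU N M : param_null N -> param_null M -> param_null (N `|` M).
Proof.
move=> nN nM; rewrite -bigcup2E.
by apply: param_null_bigcup => -[|[|i]] //=; exact: param_null0.
Qed.

(** The slope may depend on e. Slopes for small e are close to each other, so this still amounts to
    derivability along the line, but rational slopes suffice to describe it. *)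
Definition line_approx k (i : 'I_n) x : Prop :=
  forall e, 0 < e -> exists q, exists2 d, 0 < d & forall t : R, `|t| <= d ->
    `|k (x + t *: delta_mx 0 i) - k x - t * q| <= e * `|t|.

(** With rational slopes and tolerances 1 / (a + 1), the good points contain the Borel set [G]. Its
    complement meets every line in direction i in a null set, by the one-dimensional theorem. *)
Lemma null_line_approx k L i : (forall x y, `|k x - k y| <= L * `|x - y|) ->
  param_null [set x | ~ line_approx k i x].
Proof.
move=> kL; have ck := lipschitz_continuous kL.
pose C q a b := [set x | forall t, `|t| <= b.+1%:R^-1 ->
  `|k (x + t *: delta_mx 0 i) - k x - t * q| <= a.+1%:R^-1 * `|t|].
have cC q a b : closed (C q a b).
  apply: (closed_forall_le (F := fun t x =>
    `|k (x + t *: delta_mx 0 i) - k x - t * q|)) => t _.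
  exact: increment_continuous.
pose G : set 'rV[R]_n := \bigcap_a \bigcup_(qb : rat * nat) C (ratr qb.1) a qb.2.
have bG : borel G.
  apply: borel_bigcap => a; apply: borel_bigcup_count => qb.
  exact: borel_closed.
have GP x : G x -> line_approx k i x.
  move=> Gx e e0.
  have [a _ ae] := near_infty_natSinv_lt (PosNum e0).
  have [[q b] _ /= Cx] := Gx a I.
  exists (ratr q), b.+1%:R^-1; first by rewrite invr_gt0.
  move=> t tb; apply: le_trans (Cx t tb) _; apply: ler_wpM2r => //.
  by apply: ltW; exact: (ae a (leqnn a)).
exists (~` G); split; [exact: borelC| |by move=> x nx Gx; apply: nx; exact: GP].
apply: (np_null H (i := i)); first exact: borelC.
move=> x; apply/eqP; rewrite eq_le measure_ge0 andbT.
pose phi s := k (x + s *: delta_mx 0 i).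
have phiL s t : `|phi s - phi t| <= `|L| * `|s - t|.
  apply: le_trans (kL _ _) _; rewrite opprD addrACA subrr add0r -scalerBl normrZ.
  apply: (@le_trans _ _ (`|L| * (`|s - t| * `|delta_mx 0 i : 'rV[R]_n|))).
    by apply: ler_wpM2r; [rewrite mulr_ge0|exact: ler_norm].
  by apply: ler_wpM2l => //; rewrite -[leRHS]mulr1 ler_wpM2l// norm_delta_mx_le.
have [N [mN N0 HN]] := lipschitz_ae_derivable phiL.
rewrite -N0; apply: le_measure; rewrite ?inE//.
  by apply: borel_line_section; exact: borelC.
move=> s nGs; apply: HN => /= dphi; apply: nGs => a _.
have a0 : 0 < (a.+1%:R^-1 : R) / 2 by rewrite divr_gt0.
have [dl dl0 Hd] := derivable_approx dphi a0.
have [b _ bd] := near_infty_natSinv_lt (PosNum dl0).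
have lt1 : 'D_1 phi s - a.+1%:R^-1 / 2 < 'D_1 phi s by rewrite ltrBlDr ltrDl.
(* A rational slope just below the derivative: half of the tolerance pays for it, the other half for
   derivability. *)
have [q] := rat_in_itvoo lt1; rewrite in_itv/= => /andP[q1 q2].
exists (q, b) => //= t tb.
have /Hd : `|t| <= dl by apply: le_trans tb (ltW (bd b (leqnn b))).
rewrite /phi scaler1 scalerDl addrA.
move=> h; rewrite (_ : _ - t * ratr q = (k (x + s *: delta_mx 0 i + t *: delta_mx 0 i) -
  k (x + s *: delta_mx 0 i) - t *: 'D_1 phi s) + t * ('D_1 phi s - ratr q)); last first.
  by rewrite /GRing.scale/= mulrBr addrA subrK.
apply: le_trans (ler_normD _ _) _.
rewrite [a.+1%:R^-1]splitr mulrDl; apply: lerD => //.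
rewrite normrM mulrC ler_wpM2r// ger0_norm ?subr_ge0 ?(ltW q2)//.
by rewrite lerBlDr -lerBlDl (ltW q1).
Qed.

(** Only the coordinates of index less than i may move, so i = n is full differentiability. Again q
    depends on e, which allows rational q. *)
Definition lin_approx k (i : nat) x : Prop :=
  forall e, 0 < e -> exists q : 'rV[R]_n, exists2 d, 0 < d & forall w,
    (forall j : 'I_n, (i <= j)%N -> w 0 j = 0) -> `|w| <= d ->
    `|k (x + w) - k x - dotv q w| <= e * `|w|.

Lemma rat_approx (q : 'rV[R]_n) (e : R) : 0 < e ->
  exists q' : 'rV[rat]_n, `|map_mx ratr q' - q| <= e.
Proof.
move=> e0.
have /choice[f Hf] : forall i, exists r : rat, `|ratr r - q 0 i| <= e.
  move=> i; have lt1 : q 0 i - e < q 0 i by rewrite ltrBlDr ltrDl.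
  have [r] := rat_in_itvoo lt1; rewrite in_itv/= => /andP[r1 r2].
  exists r; rewrite distrC ger0_norm ?subr_ge0 ?(ltW r2)//.
  by rewrite lerBlDr -lerBlDl ltW.
exists (\row_i f i); apply/(rv_norm_leP _ (ltW e0)) => i.
by rewrite !mxE.
Qed.

(* dist_set A has a minimum at x, so its derivative there vanishes. *)
Lemma line_approx_dist (A : set 'rV[R]_n) i x : A x ->
  line_approx (dist_set A) i x -> forall e, 0 < e ->
  exists2 d, 0 < d & forall t : R, `|t| <= d ->
    exists2 z, A z & `|x + t *: delta_mx 0 i - z| <= e * `|t|.
Proof.
move=> Ax Dx e e0; have e4 : 0 < e / 4 by rewrite divr_gt0.
have [q [dl dl0 Hd]] := Dx _ e4.
exists dl => // t td; have [->|t0] := eqVneq t 0.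
  by exists x => //; rewrite scale0r addr0 subrr !normr0 mulr0.
have dx0 : dist_set A x = 0.
  have := dist_set_le x Ax; rewrite subrr normr0 => h.
  by apply/eqP; rewrite eq_le h dist_set_ge0.
have t_gt0 : 0 < `|t| by rewrite normr_gt0.
have : dist_set A (x + t *: delta_mx 0 i) < e * `|t|.
  move: (Hd t td) (Hd (- t)); rewrite normrN dx0 !subr0 => + /(_ td).
  rewrite !ler_norml !mulNr opprK => /andP[_ h1] /andP[_ h2].
  have := dist_set_ge0 A (x + (- t) *: delta_mx 0 i).
  have : 0 < e * `|t| by rewrite mulr_gt0.
  move: h1 h2; rewrite mulrAC.
  set D1 := dist_set A _; set D2 := dist_set A _; lra.
move=> /dist_set_lt[]; first by exists x.
by move=> z Az /ltW ?; exists z.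
Qed.

(* Induction on the number i of coordinates along which w may move.  On the closed
   sets A qab the approximation is uniform; where the distance to A qab is
   differentiable along the next coordinate, x + t e_i is o(t)-close to A qab, and
   the approximation at that nearby point is transported to x. *)
Lemma null_lin_approx k L i : (forall x y, `|k x - k y| <= L * `|x - y|) ->
  (i <= n)%N -> param_null [set x | ~ lin_approx k i x].
Proof.
move=> kL; have ck := lipschitz_continuous kL.
elim: i => [_|i IH ltin].
  apply: param_nullS param_null0 => x /= nx; apply: nx => e e0.
  exists 0, 1 => // w w0 _.
  have -> : w = 0 by apply/rowP => j; rewrite w0// mxE.
  rewrite addr0 subrr sub0r normrN normr0 mulr0.
  by rewrite /dotv big1 ?normr0// => j _; rewrite mxE mul0r.
have {IH} nIH := IH (ltnW ltin).
pose io := Ordinal ltin.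
pose A (qab : 'rV[rat]_n * nat * nat) := [set x | forall w,
  (forall j : 'I_n, (i <= j)%N -> w 0 j = 0) /\ `|w| <= qab.2.+1%:R^-1 ->
  `|k (x + w) - k x - dotv (map_mx ratr qab.1.1) w| <= qab.1.2.+1%:R^-1 * `|w|].
have cA qab : closed (A qab).
  apply: (closed_forall_le (F := fun w x => `|k (x + w) - k x -
     dotv (map_mx ratr qab.1.1) w|)) => w _.
  exact: increment_continuous.
have ndA qab := null_line_approx io (dist_set_lipschitz (A qab)).
have := param_nullU (param_nullU nIH (null_line_approx io kL))
  (param_null_bigcup_count ndA).
apply: param_nullS => x /= ngoal; apply: contrapT => nx; apply: ngoal.
have {nx} [[xIH xk] xA] : (lin_approx k i x /\ line_approx k io x) /\
    forall qab, line_approx (dist_set (A qab)) io x.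
  split; [split|] => [||qab]; apply: contrapT => h; apply: nx.
  - by left; left.
  - by left; right.
  - by right; exists qab.
(* Two passages between x + t e_i and the nearby point z cost 3 |L| eta each; the approximations at
   z and along e_i cost eta each. *)
move=> e e0; pose C := 6 * `|L| + 2.
have C0 : 0 < C by rewrite ltr_wpDl// mulr_ge0.
have eC : 0 < e / C by rewrite divr_gt0.
have [a _ /(_ a (leqnn a)) /= aeC] := near_infty_natSinv_lt (PosNum eC).
set eta : R := a.+1%:R^-1 in aeC.
have eta0 : 0 < eta by rewrite invr_gt0.
have eta2 : 0 < eta / 2 by rewrite divr_gt0.
have [q0 [d0 d00 Hq0]] := xIH _ eta2.
(* Dividing by n + 1 absorbs the factor n of [dotv_norm_le]: making q0 rational costs eta / 2. *)
have n0 : 0 < eta / 2 / n.+1%:R by rewrite divr_gt0.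
have [q qq0] := rat_approx q0 n0.
have [b _ /(_ b (leqnn b)) /= bd0] := near_infty_natSinv_lt (PosNum d00).
have Ax : A (q, a, b) x.
  move=> w [w0 wb] /=.
  have -> : k (x + w) - k x - dotv (map_mx ratr q) w =
      (k (x + w) - k x - dotv q0 w) - dotv (map_mx ratr q - q0) w.
    by rewrite dotvDl dotvNl; lra.
  apply: le_trans (ler_normB _ _) _; rewrite -/eta [eta]splitr mulrDl.
  apply: lerD; first by apply: Hq0 => //; exact: le_trans wb (ltW bd0).
  apply: le_trans (dotv_norm_le _ _) _; apply: ler_wpM2r => //.
  apply: (@le_trans _ _ (n%:R * (eta / 2 / n.+1%:R))); first exact: ler_wpM2l.
  rewrite mulrCA ler_piMr ?(ltW eta2)// ler_pdivrMr// mul1r ler_nat; exact: leqnSn.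
have [d1 d10 Hd1] := line_approx_dist Ax (xA (q, a, b)) (mulr_gt0 (ltr0Sn _ 2) eta0).
have [r [d2 d20 Hd2]] := xk _ eta0.
(* This is q with its coordinate [io] replaced by the slope r. *)
exists (map_mx ratr q + (r - map_mx ratr q 0 io) *: delta_mx 0 io).
exists (Num.min (Num.min d1 d2) b.+1%:R^-1).
  by rewrite !lt_min d10 d20 invr_gt0 /=.
move=> w' w'0; rewrite !le_min => /andP[/andP[wd1 wd2] wb].
pose t := w' 0 io; pose w := w' - t *: delta_mx 0 io.
have w'E : w' = t *: delta_mx 0 io + w by rewrite addrC subrK.
have tw' : `|t| <= `|w'| by exact: coord_le_norm.
have wE j : w 0 j = if j == io then 0 else w' 0 j.
  rewrite !mxE eqxx /=; case: eqP => [->|_]; first by rewrite mulr1 subrr.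
  by rewrite mulr0 subr0.
clearbody w.
have ww' : `|w| <= `|w'|.
  apply/rv_norm_leP => // j; rewrite wE; case: ifP => _.
    by rewrite normr0.
  exact: coord_le_norm.
have w0 (j : 'I_n) : (i <= j)%N -> w 0 j = 0.
  rewrite wE leq_eqVlt => /predU1P[ij|ij].
    by rewrite ifT//; apply/eqP/val_inj.
  by case: ifP => // _; exact: w'0.
have [z Az zt] := Hd1 t (le_trans tw' wd1).
have Hz := Az w (conj w0 (le_trans ww' wb)).
have Ht := Hd2 t (le_trans tw' wd2).
have qE : dotv (map_mx ratr q + (r - map_mx ratr q 0 io) *: delta_mx 0 io) w' =
    dotv (map_mx ratr q) w + t * r.
  rewrite [in LHS]w'E !dotvDr !dotvDl !dotvZl !dotvZr !dotv_delta.
  have -> : dotv (delta_mx 0 io) w = 0.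
    by rewrite dotvC dotv_delta wE eqxx.
  have -> : (delta_mx 0 io : 'rV[R]_n) 0 io = 1 by rewrite mxE !eqxx.
  ring.
rewrite qE.
pose xt := x + t *: delta_mx 0 io.
have h1 : `|k (xt + w) - k (z + w)| <= `|L| * (3 * eta * `|t|).
  apply: le_trans (kL _ _) _.
  apply: le_trans (ler_wpM2r _ (ler_norm L)) _ => //; apply: ler_wpM2l => //.
  by rewrite opprD addrACA subrr addr0.
have h2 : `|k z - k xt| <= `|L| * (3 * eta * `|t|).
  apply: le_trans (kL _ _) _.
  apply: le_trans (ler_wpM2r _ (ler_norm L)) _ => //; apply: ler_wpM2l => //.
  by rewrite distrC.
have -> : k (x + w') - k x - (dotv (map_mx ratr q) w + t * r) =
    (k (xt + w) - k (z + w)) + (k (z + w) - k z - dotv (map_mx ratr q) w) +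
    (k z - k xt) + (k xt - k x - t * r).
  by rewrite [in LHS]w'E addrA -/xt; lra.
apply: le_trans (ler_normD _ _) _; apply: le_trans (lerD (ler_normD _ _) Ht) _.
apply: le_trans (lerD (lerD (le_trans (ler_normD _ _) (lerD h1 Hz)) h2) (lexx _)) _.
apply: (@le_trans _ _ (eta * C * `|w'|)); last first.
  by apply: ler_wpM2r => //; rewrite -ler_pdivlMr// ltW.
rewrite /= -/eta.
have i1 : eta * `|w| <= eta * `|w'| by rewrite ler_wpM2l// ltW.
have i2 : eta * `|t| <= eta * `|w'| by rewrite ler_wpM2l// ltW.
have i3 : `|L| * (3 * eta * `|t|) <= 3 * (`|L| * (eta * `|w'|)).
  by rewrite -[3 * eta * _]mulrA mulrCA ler_wpM2l// ler_wpM2l.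
have -> : eta * C * `|w'| = 6 * (`|L| * (eta * `|w'|)) + 2 * (eta * `|w'|).
  by rewrite /C; ring.
lra.
Qed.

End rademacher.

(** * Fréchet differentiability *)

Section frechet.
Context {R : realType} {V W : normedModType R}.

Lemma differentiable_eps (f : V -> W) (df : {linear V -> W}) (x : V) :
  continuous df ->
  (forall e, 0 < e -> exists2 d, 0 < d & forall w, `|w| <= d ->
    `|f (x + w) - f x - df w| <= e * `|w|) ->
  differentiable f x.
Proof.
move=> cdf H.
have fE : f = (fun y => f x + df (y - x)) +o_ (nbhs x) (fun y => y - x).
  apply/eqaddoP => e e0; have [d d0 Hd] := H e e0.
  apply/nbhs_ballP; exists d => // y; rewrite -ball_normE /= => xy.
  have := Hd (y - x); rewrite [x + _]addrC subrK distrC => /(_ (ltW xy)).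
  by rewrite !fctE opprD addrA.
apply/diffP; apply: (@getPex _ (fun (df : {linear V -> W}) => continuous df /\
  forall y, f y = f (lim (nbhs x)) + df (y - lim (nbhs x))
                  +o_(y \near x) (y - lim (nbhs x)))).
by exists df; split => // y; rewrite lim_id// {1}fE.
Qed.

Lemma differentiable_approx (f : V -> W) (x : V) : differentiable f x ->
  forall e, 0 < e -> exists2 d, 0 < d & forall w, `|w| <= d ->
    `|f (x + w) - f x - 'd f x w| <= e * `|w|.
Proof.
move=> /diff_locally /eqaddoP fx e e0.
have /nbhs_ballP[d d0 Hd] := fx e e0.
exists (d / 2) => [|w wd]; first by rewrite divr_gt0.
have : ball 0 d w.
  rewrite -ball_normE /= sub0r normrN (le_lt_trans wd)//.
  by rewrite ltr_pdivrMr// ltr_pMr// ltr1n.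
by move=> /Hd /=; rewrite !fctE /= opprD addrA [w + x]addrC.
Qed.

End frechet.

(** The dependence of q on e is removed: the sup of [S i] is the lower right Dini derivative along
    e_i, and every admissible q is within its tolerance of this vector. *)
Lemma lin_approx_frechet (R : realType) n (k : 'rV[R]_n -> R) x : lin_approx k n x ->
  exists p : 'rV[R]_n, forall e, 0 < e -> exists2 d, 0 < d & forall w,
    `|w| <= d -> `|k (x + w) - k x - dotv p w| <= e * `|w|.
Proof.
move=> kx.
pose S i := [set c : R | exists2 d, 0 < d & forall t, 0 < t -> t <= d ->
  c * t <= k (x + t *: delta_mx 0 i) - k x].
pose p : 'rV[R]_n := \row_i sup (S i).
exists p => e e0.
pose e' := e / n.+1%:R; have e'0 : 0 < e' by rewrite divr_gt0.
have [q [d d0 Hd]] := kx e' e'0.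
exists d => // w wd.
have far j : (n <= @nat_of_ord n j)%N -> false by rewrite leqNgt ltn_ord.
have Hd' w' : `|w'| <= d -> `|k (x + w') - k x - dotv q w'| <= e' * `|w'|.
  by move=> ?; apply: Hd => // j /far.
have pq : `|p - q| <= e'.
  apply/(rv_norm_leP _ (ltW e'0)) => i; rewrite !mxE.
  have line t : 0 < t -> t <= d ->
      `|k (x + t *: delta_mx 0 i) - k x - q 0 i * t| <= e' * t.
    move=> t0 td; have tdn : `|t *: delta_mx 0 i : 'rV[R]_n| <= t.
      rewrite normrZ gtr0_norm// -[leRHS]mulr1 ler_wpM2l ?norm_delta_mx_le//.
      exact: ltW.
    have := Hd' _ (le_trans tdn td).
    rewrite dotvZr dotv_delta mulrC => /le_trans; apply.
    by rewrite ler_wpM2l// ltW.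
  have Sq : S i (q 0 i - e').
    exists d => // t t0 td; have := line t t0 td.
    by rewrite ler_norml => /andP[+ _]; rewrite mulrBl; lra.
  have uS : ubound (S i) (q 0 i + e').
    move=> c [d' d'0 Hc]; pose t := Num.min d d'.
    have t0 : 0 < t by rewrite lt_min d0.
    have td : t <= d by rewrite ge_min lexx.
    have td' : t <= d' by rewrite ge_min lexx orbT.
    have := line t t0 td; rewrite ler_norml => /andP[_ h].
    have hc := Hc t t0 td'; rewrite -(ler_pM2r t0) mulrDl; lra.
  have hS : has_sup (S i) by split; [exists (q 0 i - e')|exists (q 0 i + e')].
  rewrite ler_norml; apply/andP; split.
    have := ub_le_sup hS.2 Sq; lra.
  by have := ge_sup hS.1 uS; lra.
have -> : k (x + w) - k x - dotv p w =
    (k (x + w) - k x - dotv q w) - dotv (p - q) w by rewrite dotvBl; ring.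
apply: le_trans (ler_normB _ _) _.
apply: le_trans (lerD (Hd' w wd) (dotv_norm_le _ _)) _.
rewrite -mulrDl ler_wpM2r//.
apply: (@le_trans _ _ (e' + n%:R * e')); first by rewrite lerD2l ler_wpM2l.
by rewrite -[X in X + _]mul1r -mulrDl addrC natr1 mulrC /e' divfK.
Qed.

(** The expansions of h t and h s at x have errors e (t - x) and e (x - s), which add up to e (t -
    s). *)
Lemma straddle_approx (R : realType) (h : R -> R) (x D : R) : D <= 0 ->
  (forall e, 0 < e -> exists2 d, 0 < d & forall t : R, `|t| <= d ->
    `|h (x + t) - h x - t * D| <= e * `|t|) ->
  straddle_le0 h x.
Proof.
move=> D0 H e e0; have [d d0 Hd] := H e e0; exists d => // s t xs sx xt tx.
have h1 : `|t - x| <= d by rewrite ger0_norm ?subr_ge0// lerBlDl.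
have h2 : `|s - x| <= d by rewrite ler0_norm ?subr_le0//; lra.
have := Hd _ h1; have := Hd _ h2.
rewrite [x + _]addrC subrK [x + _]addrC subrK.
rewrite (ger0_norm (_ : 0 <= t - x)) ?subr_ge0//.
rewrite (ler0_norm (_ : s - x <= 0)) ?subr_le0//.
rewrite !ler_norml => /andP[a1 _] /andP[_ a2].
have : (t - s) * D <= 0 by rewrite mulr_ge0_le0// subr_ge0 (le_trans sx).
lra.
Qed.

Lemma lipschitz_ac (R : realType) (a b L : R) (h : R -> R) :
  (forall s t, a <= s -> s <= t -> t <= b -> `|h t - h s| <= L * (t - s)) ->
  ac_real a b h.
Proof.
move=> hL e e0; have M0 : 0 < `|L| + 1 by rewrite ltr_wpDl.
exists (e / (`|L| + 1)) => [|N p q H1 _]; first by rewrite divr_gt0.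
rewrite ltr_pdivlMr// => H; apply: le_lt_trans H.
rewrite mulr_suml; apply: ler_sum => i _; have [ap [pq qb]] := H1 i.
apply: le_trans (hL _ _ ap pq qb) _; rewrite mulrC ler_wpM2l ?subr_ge0//.
by rewrite (le_trans (ler_norm _))// lerDl.
Qed.

(** * One-sided Lipschitz bounds from almost everywhere derivatives *)

Lemma mulmx_norm_le (R : realType) m n (x : 'rV[R]_m) (A : 'M[R]_(m, n)) :
  `|x *m A| <= m%:R * `|A| * `|x|.
Proof.
have A0 : 0 <= m%:R * `|A| * `|x| by rewrite !mulr_ge0.
apply/(rv_norm_leP _ A0) => j; rewrite mxE.
apply: le_trans (ler_norm_sum _ _ _) _.
apply: (@le_trans _ _ (\sum_(i < m) `|A| * `|x|)); last first.
  by rewrite sumr_const card_ord -[leLHS]mulr_natl mulrA.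
apply: ler_sum => i _; rewrite normrM mulrC ler_pM//; last exact: coord_le_norm.
rewrite [leRHS]/Num.Def.normr/= mx_normrE.
by apply/bigmax_geP; right; exists (i, j).
Qed.

Lemma mulmxr_continuous (R : realType) m n (A : 'M[R]_(m, n)) :
  continuous (mulmxr A : 'rV[R]_m -> 'rV[R]_n).
Proof.
apply: (@lipschitz_continuous _ _ _ _ (m%:R * `|A|)) => x y /=.
by rewrite -mulmxBl mulmx_norm_le.
Qed.

Lemma clampr_lipschitz (R : realType) (a b s t : R) :
  `|Num.max a (Num.min b s) - Num.max a (Num.min b t)| <= `|s - t|.
Proof.
wlog st : s t / s <= t.
  by move=> H; have [/H//|/ltW/H] := leP s t; rewrite distrC [leRHS]distrC.
have c1 : Num.max a (Num.min b s) <= Num.max a (Num.min b t).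
  by rewrite le_max2// le_min2.
rewrite ler0_norm ?subr_le0// ler0_norm ?subr_le0// !opprB !maxEle !minEle.
clear c1; case: (leP b s) => ?; case: (leP b t) => ?;
  do ?[case: (leP a _) => ?]; lra.
Qed.

Section clamp.
Context {R : realType} {n : nat}.
Variables (x0 : 'rV[R]_n) (r : R).

(** For r >= 0, the retraction onto the closed sup-norm ball about x0. Composition with it makes a
    map that is Lipschitz on the ball globally Lipschitz, as [null_lin_approx] requires. *)
Definition clamp (z : 'rV[R]_n) : 'rV[R]_n :=
  \row_j Num.max (x0 0 j - r) (Num.min (x0 0 j + r) (z 0 j)).

Lemma clamp_lipschitz z z' : `|clamp z - clamp z'| <= `|z - z'|.
Proof.
apply/rv_norm_leP => // j; rewrite !mxE.
apply: le_trans (coord_le_norm (z - z') j); rewrite !mxE.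
exact: clampr_lipschitz.
Qed.

Lemma clamp_id z : `|z - x0| <= r -> clamp z = z.
Proof.
move=> zr; have r0 : 0 <= r by exact: le_trans zr.
apply/rowP => j; rewrite mxE.
have := (rv_norm_leP _ r0).2 zr j; rewrite !mxE ler_norml => /andP[h1 h2].
by rewrite min_r ?max_r//; lra.
Qed.

Lemma clamp_ball z : 0 <= r -> `|clamp z - x0| <= r.
Proof.
move=> r0; apply/(rv_norm_leP _ r0) => j; rewrite !mxE.
set M := Num.max _ _.
have h1 : x0 0 j - r <= M by rewrite le_max lexx.
have h2 : M <= x0 0 j + r by rewrite ge_max ge_min lexx andbT; lra.
by rewrite ler_norml; apply/andP; split; lra.
Qed.

End clamp.

(** A change of basis makes any direction a coordinate direction, the only kind [np_section] speaks
    of. Row i of the identity is replaced by v, where v has a nonzero i-th entry. *)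
Lemma row_completion (R : realType) n (v : 'rV[R]_n) (v0 : v != 0) :
  exists (i : 'I_n) (B : 'M[R]_n), B \in unitmx /\ delta_mx 0 i *m B = v.
Proof.
have [i vi] : exists i, v 0 i != 0.
  apply: contrapT => h; move/eqP: v0; apply; apply/rowP => i; rewrite mxE.
  by apply/eqP; apply: contraT => vi; case: h; exists i.
pose B : 'M[R]_n := \matrix_(j, k) if j == i then v 0 k else (j == k)%:R.
have Bi : row i B = v by apply/rowP => k; rewrite !mxE eqxx.
have Bj j : j != i -> row j B = delta_mx 0 j.
  by move=> /negbTE ji; apply/rowP => k; rewrite !mxE ji eq_sym.
exists i, B; split; last by rewrite -rowE.
rewrite -row_full_unit -sub1mx; apply/row_subP => j; rewrite row1.
have eB k : k != i -> ((delta_mx 0 k : 'rV[R]_n) <= B)%MS by move=> /Bj <-; exact: row_sub.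
have [->|/eB//] := eqVneq j i.
rewrite -(eqmx_scale _ vi).
have -> : v 0 i *: delta_mx 0 i = v - \sum_(k | k != i) v 0 k *: delta_mx 0 k.
  by rewrite [X in X - _]row_sum_delta (bigD1 i)//= addrK.
rewrite addmx_sub//; first by rewrite -Bi row_sub.
rewrite eqmx_opp; apply: summx_sub => k ki; apply: scalemx_sub; exact: eB.
Qed.

Lemma continuous_onesided (R : realType) (a b L : R) : 0 <= L ->
  (forall e, 0 < e -> a <= b + L * e) -> a <= b.
Proof.
move=> L0 H; apply/ler_addgt0Pr => e e0.
have M0 : 0 < L + 1 by rewrite ltr_wpDl.
apply: le_trans (H (e / (L + 1)) (divr_gt0 e0 M0)) _.
by rewrite lerD2l mulrA ler_pdivrMr// mulrC ler_wpM2l ?(ltW e0)// lerDl.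
Qed.

Lemma finite_radius (R : realType) (n : nat) (V : normedModType R)
    (P : 'I_n -> V -> Prop) :
  (forall j, exists2 d : R, 0 < d & forall w, `|w| <= d -> P j w) ->
  exists2 d : R, 0 < d & forall w, `|w| <= d -> forall j, P j w.
Proof.
move=> H.
have /choice[f Hf] : forall j, exists d : R, 0 < d /\ forall w, `|w| <= d -> P j w.
  by move=> j; have [d d0 Hd] := H j; exists d.
exists (\big[Num.min/1]_(j < n) f j).
  by apply: lt_bigmin => // j _; case: (Hf j).
move=> w wd j; apply: (Hf j).2; apply: le_trans wd _.
exact: bigmin_le.
Qed.

(* Rademacher's theorem and Fubini give a segment close to [x, z] almost all of
   whose points are points of differentiability. *)
Lemma onesided_lipschitz (R : realType) n (G : 'rV[R]_n -> 'rV[R]_n)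
    (x0 : 'rV[R]_n) (r L gamma : R) :
  0 <= L ->
  (forall z z', `|z - x0| < r -> `|z' - x0| < r -> `|G z - G z'| <= L * `|z - z'|) ->
  (forall z, `|z - x0| < r -> differentiable G z ->
     forall v, dotv ('d G z v) v <= gamma * dotv v v) ->
  forall x z, `|x - x0| < r -> `|z - x0| < r ->
    dotv (G z - G x) (z - x) <= gamma * dotv (z - x) (z - x).
Proof.
move=> L0 GL Gd x z xr zr; have [/eqP v0|] := eqVneq (z - x) 0.
  by rewrite (eqP v0) !dotv0r mulr0.
set v := z - x => v0; have [i [B [uB Bv]]] := row_completion v0.
(* x and z lie within r'' of x0; clamping at r', between r'' and r, leaves room to move the
   segment. *)
pose r'' := Num.max `|x - x0| `|z - x0|.
have r''r : r'' < r by rewrite gt_max xr.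
pose r' := (r'' + r) / 2.
have r'1 : r'' < r' by rewrite /r'; lra.
have r'2 : r' < r by rewrite /r'; lra.
have r''0 : 0 <= r'' by rewrite le_max normr_ge0.
have r'0 : 0 <= r' by exact: le_trans (ltW r'1).
(* G in the coordinates of the basis B, clamped. *)
pose K c := G (clamp x0 r' (c *m B)).
have KL c c' : `|K c - K c'| <= L * (n%:R * `|B|) * `|c - c'|.
  apply: le_trans (GL _ _ _ _) _; rewrite ?(le_lt_trans (clamp_ball _ _ _))//.
  rewrite -mulrA ler_wpM2l//; apply: le_trans (clamp_lipschitz _ _ _ _) _.
  by rewrite -mulmxBl mulmx_norm_le.
pose k j c := K c 0 j.
have kL j c c' : `|k j c - k j c'| <= L * (n%:R * `|B|) * `|c - c'|.
  apply: le_trans (KL c c'); apply: le_trans (coord_le_norm _ j).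
  by rewrite !mxE.
have [d [T [mu [V HV]]]] := @null_param_exists R n.
have [A [bA A0 NA]] : param_null mu V (\bigcup_(j : 'I_n) [set c | ~ lin_approx (k j) n c]).
  by apply: (param_null_bigcup_count HV) => j; exact: (null_lin_approx HV (kL j)).
have dB e : 0 < e -> exists2 x', `|x' - x| <= e &
    {ae @lebesgue_measure R, forall s : R, `|x' + s *: v - x0| < r' ->
       differentiable G (x' + s *: v)}.
  move=> e0; pose M := n%:R * `|B| + 1.
  have M0 : 0 < M by rewrite ltr_wpDl// mulr_ge0.
  have [c ce cA] := np_section HV i bA A0 (x *m invmx B) (divr_gt0 e0 M0).
  exists (c *m B).
    have -> : c *m B - x = (c - x *m invmx B) *m B by rewrite mulmxBl mulmxKV.
    apply: le_trans (mulmx_norm_le _ _) _.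
    apply: (@le_trans _ _ (M * (e / M))); last by rewrite mulrC divfK// gt_eqF.
    by rewrite ler_pM// ?mulr_ge0// ?(ltW ce)// /M lerDl.
  exists (line_section A c i); split => //; first exact: borel_line_section.
  move=> s /= nP; apply: contrapT => nA; apply: nP => yr'.
  pose cs := c + s *: delta_mx 0 i.
  have yE : c *m B + s *: v = cs *m B by rewrite mulmxDl -scalemxAl Bv.
  rewrite yE in yr' *.
  have /choice[p Hp] : forall j, exists p : 'rV[R]_n, forall e, 0 < e ->
      exists2 d, 0 < d & forall w, `|w| <= d ->
      `|k j (cs + w) - k j cs - dotv p w| <= e * `|w|.
    move=> j; apply: lin_approx_frechet; apply: contrapT => nk.
    by apply: nA; apply: NA; exists j.
  pose P : 'M[R]_n := \matrix_(a, j) p j 0 a.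
  apply: (differentiable_eps (df := mulmxr (invmx B *m P))).
    exact: mulmxr_continuous.
  move=> eta eta0; pose M2 := n%:R * `|invmx B| + 1.
  have M20 : 0 < M2 by rewrite ltr_wpDl// mulr_ge0.
  have [dl dl0 Hdl] := finite_radius (fun j => Hp j _ (divr_gt0 eta0 M20)).
  have yr0 : 0 < r' - `|cs *m B - x0| by rewrite subr_gt0.
  exists (Num.min (dl / M2) (r' - `|cs *m B - x0|)).
    by rewrite lt_min divr_gt0.
  move=> w; rewrite le_min => /andP[w1 w2].
  have wB : `|w *m invmx B| <= M2 * `|w|.
    by apply: le_trans (mulmx_norm_le _ _) _; rewrite ler_wpM2r// lerDl.
  have Gw : G (cs *m B + w) = K (cs + w *m invmx B).
    rewrite /K (mulmxDl cs) mulmxKV// clamp_id// addrAC.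
    by apply: le_trans (ler_normD _ _) _; rewrite -lerBrDl.
  have G0 : G (cs *m B) = K cs by rewrite /K clamp_id// ltW.
  rewrite Gw G0 /=; apply/rv_norm_leP => [|j]; first by rewrite mulr_ge0// ltW.
  have -> : (K (cs + w *m invmx B) - K cs - w *m (invmx B *m P)) 0 j =
      k j (cs + w *m invmx B) - k j cs - dotv (p j) (w *m invmx B).
    rewrite mulmxA !mxE /k /dotv; congr (_ - _).
    by apply: eq_bigr => a _; rewrite !mxE mulrC.
  have wdl : `|w *m invmx B| <= dl.
    by apply: le_trans wB _; rewrite mulrC -ler_pdivlMr.
  apply: le_trans (Hdl _ wdl j) _.
  apply: le_trans (ler_wpM2l _ wB) _; first by rewrite ltW// divr_gt0.
  by rewrite mulrA divfK// gt_eqF.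
(* Moving either end of the segment by at most e changes <G, v> by at most n L |v| e. *)
pose C := 2 * (n%:R * L * `|v|).
have C0 : 0 <= C by rewrite !mulr_ge0.
apply: (continuous_onesided C0) => e e0.
pose e1 := Num.min e ((r' - r'') / 2).
have e10 : 0 < e1 by rewrite lt_min e0 divr_gt0// subr_gt0.
have e1e : e1 <= e by rewrite ge_min lexx.
have e1r : e1 <= (r' - r'') / 2 by rewrite ge_min lexx orbT.
have [x' xx' aex'] := dB _ e10.
have seg s : 0 <= s -> s <= 1 -> `|x' + s *: v - x0| < r'.
  move=> s0 s1.
  have -> : x' + s *: v - x0 = (x' - x) + ((1 - s) *: (x - x0) + s *: (z - x0)).
    by apply/rowP => j; rewrite !mxE; ring.
  apply: le_lt_trans (ler_normD _ _) _.
  have : `|(1 - s) *: (x - x0) + s *: (z - x0)| <= r''.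
    apply: le_trans (ler_normD _ _) _; rewrite !normrZ.
    rewrite (ger0_norm s0) ger0_norm ?subr_ge0//.
    apply: (@le_trans _ _ ((1 - s) * r'' + s * r'')); last by rewrite -mulrDl subrK mul1r.
    by apply: lerD; apply: ler_wpM2l; rewrite ?subr_ge0// le_max lexx ?orbT.
  lra.
(* Where G is differentiable the derivative is <dG v, v> - gamma |v|^2, at most 0. Comparing s = 1
   with s = 0 gives the claim on the shifted segment. *)
pose psi s := dotv (G (x' + s *: v)) v - s * (gamma * dotv v v).
have segr s : 0 <= s -> s <= 1 -> `|x' + s *: v - x0| < r.
  by move=> s0 s1; apply: lt_trans (seg s s0 s1) _.
have psiac : ac_real 0 1 psi.
  apply: (@lipschitz_ac _ _ _ (n%:R * (L * `|v|) * `|v| + `|gamma * dotv v v|)).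
  move=> s t s0 st t1.
  have s1 := le_trans st t1; have t0 := le_trans s0 st.
  have -> : psi t - psi s = dotv (G (x' + t *: v) - G (x' + s *: v)) v -
      (t - s) * (gamma * dotv v v) by rewrite /psi dotvBl; ring.
  apply: le_trans (ler_normB _ _) _; rewrite [leRHS]mulrDl; apply: lerD; last first.
    by rewrite normrM ger0_norm ?subr_ge0// mulrC.
  apply: le_trans (dotv_norm_le _ _) _.
  rewrite [leRHS]mulrAC ler_wpM2r// -[leRHS]mulrA ler_wpM2l//.
  apply: le_trans (GL _ _ (segr _ t0 t1) (segr _ s0 s1)) _.
  rewrite -mulrA ler_wpM2l// opprD addrACA subrr add0r -scalerBl normrZ.
  by rewrite ger0_norm ?subr_ge0// mulrC.
have psi10 : psi 1 <= psi 0.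
  apply: (ac_ae_nonincreasing ler01 psiac).
  move: aex'; apply: filterS; first exact: (ae_filter_ringOfSetsType (@lebesgue_measure R)).
  move=> s + s0 s1 => /(_ (seg s (ltW s0) (ltW s1))) dG.
  pose y := x' + s *: v.
  apply: (@straddle_approx _ _ _ (dotv ('d G y v) v - gamma * dotv v v)).
    by rewrite subr_le0; apply: Gd => //; exact: segr (ltW s0) (ltW s1).
  move=> eta eta0; pose N := n%:R * `|v| * `|v| + 1.
  have N0 : 0 < N by rewrite ltr_wpDl// !mulr_ge0.
  have [dl dl0 Hdl] := differentiable_approx dG (divr_gt0 eta0 N0).
  exists (dl / (`|v| + 1)); first by rewrite divr_gt0// ltr_wpDl.
  move=> t; rewrite ler_pdivlMr ?ltr_wpDl// => tdl.
  have tv : `|t *: v| <= dl.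
    by rewrite normrZ (le_trans _ tdl)// ler_wpM2l// lerDl.
  have := Hdl _ tv; rewrite linearZ => h.
  have -> : psi (s + t) - psi s - t * (dotv ('d G y v) v - gamma * dotv v v) =
      dotv (G (y + t *: v) - G y - t *: 'd G y v) v.
    by rewrite /psi /y scalerDl addrA !dotvBl dotvZl; ring.
  apply: le_trans (dotv_norm_le _ _) _.
  apply: (@le_trans _ _ (n%:R * (eta / N * `|t *: v|) * `|v|)).
    by rewrite ler_wpM2r// ler_wpM2l.
  rewrite normrZ (_ : _ * `|v| = eta / N * (n%:R * `|v| * `|v|) * `|t|); last by ring.
  rewrite ler_wpM2r// mulrAC ler_pdivrMr// ler_wpM2l ?(ltW eta0)// lerDl//.
move: psi10; rewrite /psi !(mul1r, mul0r, scale1r, scale0r, subr0, addr0) => psi10.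
have x'r : `|x' - x0| < r by have := segr 0 (lexx 0) ler01; rewrite scale0r addr0.
have x'vr : `|x' + v - x0| < r by have := segr 1 ler01 (lexx 1); rewrite scale1r.
have hh a b : `|a - x0| < r -> `|b - x0| < r -> `|a - b| <= e1 ->
    dotv (G a - G b) v <= n%:R * L * `|v| * e.
  move=> ar br ab; apply: le_trans (ler_norm _) _.
  apply: le_trans (dotv_norm_le _ _) _.
  rewrite [leRHS]mulrAC ler_wpM2r// -mulrA ler_wpM2l//.
  apply: le_trans (GL _ _ ar br) _; rewrite ler_wpM2l//; exact: le_trans e1e.
have h1 : dotv (G z - G (x' + v)) v <= n%:R * L * `|v| * e.
  apply: hh => //; rewrite (_ : z - (x' + v) = x - x'); first by rewrite distrC.
  by rewrite /v; apply/rowP => j; rewrite !mxE; ring.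
have h2 := hh _ _ x'r xr xx'.
have -> : G z - G x = (G z - G (x' + v)) + (G x' - G x) + (G (x' + v) - G x').
  by apply/rowP => j; rewrite !mxE; ring.
have h3 : dotv (G (x' + v) - G x') v <= gamma * dotv v v.
  by rewrite (dotvBl (G (x' + v))); move: psi10; lra.
have E a b c : dotv (a + b + c) v = dotv a v + dotv b v + dotv c v.
  by rewrite (dotvDl (a + b)) (dotvDl a).
rewrite -/v E /C; move: h1 h2 h3.
set a := dotv _ _; set b := dotv _ _; set c := dotv _ _; set q := gamma * _.
set s := n%:R * _ * _. lra.
Qed.

(** * Gradients of strongly convex functions *)

Lemma eps_continuous (R : realType) (V W : normedModType R) (f : V -> W) :
  (forall x e, 0 < e -> exists2 d : R, 0 < d &
    forall z, `|z - x| < d -> `|f z - f x| <= e) -> continuous f.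
Proof.
move=> H x; apply/cvgrPdist_le => e e0; have [d d0 Hd] := H x e e0.
apply/nbhs_ballP; exists d => // z; rewrite -ball_normE /= distrC => zx.
by rewrite distrC; exact: Hd.
Qed.

Section frechet_gradient.
Context {R : realType} {n : nat}.
Implicit Types (h : 'rV[R]_n -> R) (x p w : 'rV[R]_n).

Definition is_fgrad h x p : Prop := forall e, 0 < e -> exists2 d, 0 < d &
  forall w, `|w| <= d -> `|h (x + w) - h x - dotv p w| <= e * `|w|.

Lemma diff_grad h x v : differentiable h x -> 'd h x v = dotv (grad h x) v.
Proof.
move=> dh; rewrite [v in LHS]row_sum_delta linear_sum; apply: eq_bigr => i _.
by rewrite linearZ /= mxE deriveE// mulrC.
Qed.

Lemma grad_is_fgrad h x : differentiable h x -> is_fgrad h x (grad h x).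
Proof.
move=> dh e e0; have [d d0 Hd] := differentiable_approx dh e0.
by exists d => // w wd; rewrite -diff_grad//; exact: Hd.
Qed.

Lemma is_fgradD h k x p q : is_fgrad h x p -> is_fgrad k x q ->
  is_fgrad (fun z => h z + k z) x (p + q).
Proof.
move=> Hh Hk e e0; have e2 : 0 < e / 2 by rewrite divr_gt0.
have [d d0 Hd] := Hh _ e2; have [d' d'0 Hd'] := Hk _ e2.
exists (Num.min d d'); first by rewrite lt_min d0.
move=> w; rewrite le_min => /andP[wd wd'].
rewrite dotvDl (_ : _ - _ = (h (x + w) - h x - dotv p w) +
  (k (x + w) - k x - dotv q w)); last by ring.
apply: le_trans (ler_normD _ _) _; rewrite [e in leRHS]splitr mulrDl.
by apply: lerD; [exact: Hd|exact: Hd'].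
Qed.

Lemma is_fgradZ c h x p : is_fgrad h x p -> is_fgrad (fun z => c * h z) x (c *: p).
Proof.
move=> Hh e e0; have c0 : 0 < `|c| + 1 by rewrite ltr_wpDl.
have [d d0 Hd] := Hh _ (divr_gt0 e0 c0).
exists d => // w wd; rewrite dotvZl -!mulrBr normrM.
apply: le_trans (ler_wpM2l _ (Hd w wd)) _ => //.
rewrite mulrA ler_wpM2r// mulrA ler_pdivrMr// mulrC ler_wpM2l ?(ltW e0)//.
by rewrite lerDl.
Qed.

Lemma is_fgrad_sum m (h : 'I_m -> 'rV[R]_n -> R) x (p : 'I_m -> 'rV[R]_n) :
  (forall j, is_fgrad (h j) x (p j)) ->
  is_fgrad (fun z => \sum_j h j z) x (\sum_j p j).
Proof.
elim: m h p => [|m IH] h p H.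
  move=> e e0; exists 1 => // w _; rewrite !big_ord0 dotv0l !subr0 normr0.
  by rewrite mulr_ge0// ltW.
under [X in is_fgrad X]eq_fun do rewrite big_ord_recl.
rewrite big_ord_recl.
exact: (is_fgradD (H ord0) (IH _ _ (fun j => H (lift ord0 j)))).
Qed.

Lemma dotv_sqr_expand (a w : 'rV[R]_n) :
  dotv (a + w) (a + w) = dotv a a + 2 * dotv a w + dotv w w.
Proof. by rewrite dotvDl !dotvDr (dotvC w a); ring. Qed.

Lemma is_fgrad_quad c u x :
  is_fgrad (fun z => c / 2 * enorm (z - u) ^+ 2) x (c *: (x - u)).
Proof.
move=> e e0; pose M := `|c| * n%:R + 1.
have M0 : 0 < M by rewrite ltr_wpDl// mulr_ge0.
exists (e / M); first by rewrite divr_gt0.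
move=> w wd; rewrite !enorm_sqr (addrAC x) (dotv_sqr_expand (x - u)) dotvZl.
rewrite [X in `|X| <= _](_ : _ = c / 2 * dotv w w); last by field.
rewrite normrM; apply: (@le_trans _ _ (`|c| * (n%:R * `|w| ^+ 2))).
  apply: ler_pM => //.
    by rewrite normrM ler_piMr// ger0_norm// invf_le1// ler1n.
  by rewrite ger0_norm ?dotv_ge0// dotv_le_norm.
rewrite expr2 !mulrA ler_wpM2r//; apply: (@le_trans _ _ (M * `|w|)).
  by rewrite ler_wpM2r// lerDl.
by rewrite mulrC -ler_pdivlMr.
Qed.

(** A small step along -p would otherwise decrease h. *)
Lemma is_fgrad_min h x p : is_fgrad h x p -> (forall z, h x <= h z) -> p = 0.
Proof.
move=> Hp Hm; apply: dotv_eq0; apply/eqP; rewrite eq_le dotv_ge0 andbT.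
apply: (@continuous_onesided _ _ _ `|p|) => // e e0; rewrite add0r.
have [d d0 Hd] := Hp e e0.
have p1 : 0 < `|p| + 1 by rewrite ltr_wpDl.
pose t := d / (`|p| + 1); have t0 : 0 < t by rewrite divr_gt0.
have nt : `|- t *: p| <= d.
  rewrite normrZ normrN gtr0_norm// /t mulrAC ler_pdivrMr// ler_wpM2l ?(ltW d0)//.
  by rewrite lerDl.
have := Hd _ nt; rewrite ler_norml => /andP[_].
rewrite dotvZr normrZ normrN (gtr0_norm t0) => h1.
have h2 := Hm (x + - t *: p).
rewrite -(ler_pM2l t0); lra.
Qed.

Lemma is_fgrad_continuous h : (forall x, exists p, is_fgrad h x p) -> continuous h.
Proof.
move=> H; apply: eps_continuous => x e e0; have [p Hp] := H x.
have [d d0 Hd] := Hp 1 ltr01.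
pose M := n%:R * `|p| + 1; have M0 : 0 < M by rewrite ltr_wpDl// mulr_ge0.
exists (Num.min d (e / M)) => [|z]; first by rewrite lt_min d0 divr_gt0.
rewrite lt_min => /andP[/ltW zd /ltW ze].
have := Hd (z - x) zd; rewrite [x + _]addrC subrK mul1r => h1.
rewrite (_ : h z - h x = (h z - h x - dotv p (z - x)) + dotv p (z - x)); last by ring.
apply: le_trans (ler_normD _ _) _.
apply: le_trans (lerD h1 (dotv_norm_le _ _)) _.
rewrite -[X in X + _]mul1r -mulrDl addrC -/M mulrC -ler_pdivlMr//.
Qed.

Lemma is_fgrad_line h x v s p : is_fgrad h (x + s *: v) p ->
  forall e, 0 < e -> exists2 d, 0 < d & forall t : R, `|t| <= d ->
    `|h (x + (s + t) *: v) - h (x + s *: v) - t * dotv p v| <= e * `|t|.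
Proof.
move=> Hp e e0; have v1 : 0 < `|v| + 1 by rewrite ltr_wpDl.
have [d d0 Hd] := Hp _ (divr_gt0 e0 v1).
exists (d / (`|v| + 1)); first by rewrite divr_gt0.
move=> t; rewrite ler_pdivlMr// => td.
have tv : `|t *: v| <= d by rewrite normrZ (le_trans _ td)// ler_wpM2l// lerDl.
have := Hd _ tv; rewrite dotvZr scalerDl addrA => /le_trans; apply.
rewrite normrZ mulrA [leLHS]mulrAC ler_wpM2r// mulrAC ler_pdivrMr//.
by rewrite ler_wpM2l ?(ltW e0)// lerDl.
Qed.

(** With no exceptional set, real induction applies directly and no absolute continuity enters. *)
Lemma straddle_nonincreasing (a b : R) (h : R -> R) : a <= b ->
  (forall s : R, a <= s -> s <= b -> straddle_le0 h s) -> h b <= h a.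
Proof.
move=> ab H; have ba : 0 <= b - a by rewrite subr_ge0.
apply: (continuous_onesided ba) => e e0.
have : h b <= h a + (b - a) * e; last by [].
apply: (real_induction (P := fun t => h t <= h a + (t - a) * e) ab).
  by rewrite subrr mul0r addr0.
move=> x ax xb; have [d d0 Hd] := H x ax xb e e0.
exists d => // s t _ _ xs sx xt tx hs.
have := Hd s t xs sx xt tx; lra.
Qed.

(** The function s |-> h (x + s v) - s <N x, v> - c s^2 / 2 has nonpositive derivative on [0, 1].
    Only this one segment matters, which keeps the lemma usable locally. *)
Lemma descent h (N : 'rV[R]_n -> 'rV[R]_n) (x v : 'rV[R]_n) (c : R) :
  (forall z, is_fgrad h z (N z)) ->
  (forall s, 0 <= s -> s <= 1 -> dotv (N (x + s *: v) - N x) v <= c * s) ->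
  h (x + v) <= h x + dotv (N x) v + c / 2.
Proof.
move=> hN H.
pose th s := h (x + s *: v) - s * dotv (N x) v - c / 2 * s ^+ 2.
have : th 1 <= th 0.
  apply: straddle_nonincreasing => // s s0 s1.
  apply: (@straddle_approx _ _ _ (dotv (N (x + s *: v) - N x) v - c * s)).
    by rewrite subr_le0; exact: H.
  move=> e e0; have e2 : 0 < e / 2 by rewrite divr_gt0.
  have [d d0 Hd] := is_fgrad_line (hN (x + s *: v)) e2.
  have c1 : 0 < `|c| + 1 by rewrite ltr_wpDl.
  exists (Num.min d (e / (`|c| + 1))); first by rewrite lt_min d0 divr_gt0.
  move=> t; rewrite le_min => /andP[td]; rewrite ler_pdivlMr// => te.
  rewrite (_ : _ - _ = (h (x + (s + t) *: v) - h (x + s *: v) -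
    t * dotv (N (x + s *: v)) v) - c / 2 * t ^+ 2); last first.
    by rewrite /th dotvBl; field.
  apply: le_trans (ler_normB _ _) _; rewrite [e in leRHS]splitr mulrDl.
  apply: lerD; first exact: Hd.
  rewrite expr2 !normrM mulrA ler_wpM2r// mulrAC.
  rewrite (ger0_norm (_ : 0 <= 2^-1))// ler_wpM2r// mulrC.
  by apply: le_trans te; rewrite ler_wpM2l// lerDl.
by rewrite /th scale1r scale0r addr0 expr1n expr0n/=; lra.
Qed.

(** Strong convexity of modulus m in chord form. The modulus may be negative: adding a quadratic of
    modulus -mu subtracts curvature. *)
Definition mconvex (m : R) h : Prop := forall x z t, 0 <= t -> t <= 1 ->
  h (x + t *: (z - x)) <=
    h x + t * (h z - h x) - m / 2 * (t * (1 - t)) * dotv (z - x) (z - x).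

Lemma mconvexD m m' h k : mconvex m h -> mconvex m' k ->
  mconvex (m + m') (fun z => h z + k z).
Proof.
by move=> Hh Hk x z t t0 t1; have := Hh x z t t0 t1; have := Hk x z t t0 t1; lra.
Qed.

Lemma mconvexZ c h : 0 <= c -> mconvex 0 h -> mconvex 0 (fun z => c * h z).
Proof.
move=> c0 Hh x z t t0 t1; have := Hh x z t t0 t1.
rewrite !mul0r !subr0 => /(ler_wpM2l c0); lra.
Qed.

Lemma mconvex_sum m (h : 'I_m -> 'rV[R]_n -> R) :
  (forall j, mconvex 0 (h j)) -> mconvex 0 (fun z => \sum_j h j z).
Proof.
move=> H x z t t0 t1; rewrite !mul0r subr0.
rewrite -sumrB mulr_sumr -big_split/=; apply: ler_sum => j _.
by have := H j x z t t0 t1; rewrite !mul0r subr0.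
Qed.

Lemma mconvex_quad c u : mconvex c (fun z => c / 2 * enorm (z - u) ^+ 2).
Proof.
move=> x z t t0 t1; rewrite !enorm_sqr.
rewrite (_ : z - u = (x - u) + (z - x)); last first.
  by apply/rowP => j; rewrite !mxE; ring.
rewrite (addrAC x) !(dotv_sqr_expand (x - u)) !dotvZr !dotvZl.
by set a := dotv _ _; set b := dotv _ _; set d := dotv _ _; lra.
Qed.

Lemma convex_on_space_mconvex h : convex_on_space h -> mconvex 0 h.
Proof.
move=> H x z t t0 t1; rewrite !mul0r subr0.
have E : t *: z + (1 - t) *: x = x + t *: (z - x).
  by apply/rowP => j; rewrite !mxE; ring.
have := H (Itv01 t0 t1) z x; rewrite !inE => /(_ Logic.I Logic.I).
rewrite /conv/= /conv/= /unstable.onem E /GRing.scale/= => /le_trans; apply; lra.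
Qed.

Lemma strongly_convex_mconvex m h : strongly_convex m h -> mconvex m h.
Proof.
move=> /convex_on_space_mconvex H.
have := mconvexD H (mconvex_quad m 0); rewrite add0r.
have -> // : (fun z => h z - m / 2 * enorm z ^+ 2 + m / 2 * enorm (z - 0) ^+ 2) = h.
by apply/funext => z; rewrite subr0 subrK.
Qed.

(** Divide the chord inequality by a small t. The first-order error contributes |v| e and the term
    in t^2 contributes |m| |v|^2 e, since t <= e. *)
Lemma mconvex_fgrad m h x p z : mconvex m h -> is_fgrad h x p ->
  h x + dotv p (z - x) + m / 2 * dotv (z - x) (z - x) <= h z.
Proof.
move=> Hh Hp.
set v := z - x; set q := dotv v v.
have v1 : 0 <= `|v| + `|m| * q by rewrite addr_ge0// mulr_ge0// dotv_ge0.
apply: (continuous_onesided v1) => e e0.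
have px : is_fgrad h (x + 0 *: v) p by rewrite scale0r addr0.
have [d d0 Hd] := Hp e e0.
have vp : 0 < `|v| + 1 by rewrite ltr_wpDl.
pose t := Num.min (Num.min 1 e) (d / (`|v| + 1)).
have t0 : 0 < t by rewrite !lt_min ltr01 e0 divr_gt0.
have t1 : t <= 1 by rewrite !ge_min lexx.
have te : t <= e by rewrite !ge_min lexx orbT.
have tv : `|t *: v| <= d.
  have : t <= d / (`|v| + 1) by rewrite ge_min lexx orbT.
  rewrite ler_pdivlMr// normrZ gtr0_norm// => h0; apply: le_trans h0.
  by rewrite ler_wpM2l ?(ltW t0)// lerDl.
have := Hd _ tv; rewrite ler_norml dotvZr normrZ gtr0_norm// => /andP[h1 _].
have h2 := Hh x z t (ltW t0) t1.
rewrite -/v -/q in h2.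
have h3 : m * t * q <= `|m| * q * e.
  rewrite mulrAC; apply: (@le_trans _ _ (`|m| * q * t)).
    by rewrite ler_wpM2r ?(ltW t0)// ler_wpM2r ?dotv_ge0// ler_norm.
  by rewrite ler_wpM2l// mulr_ge0// dotv_ge0.
have h4 : 0 <= `|m| * q * e by rewrite !mulr_ge0// ?dotv_ge0// ltW.
rewrite -(ler_pM2l t0).
have h5 : t * (m * t * q) <= t * (`|m| * q * e) by rewrite ler_wpM2l// ltW.
have h6 : 0 <= t * (`|m| * q * e) by rewrite mulr_ge0// ltW.
lra.
Qed.

Lemma mconvex_monotone m h x z p q : mconvex m h -> is_fgrad h x p ->
  is_fgrad h z q -> m * dotv (z - x) (z - x) <= dotv (q - p) (z - x).
Proof.
move=> Hh Hp Hq.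
have h1 := mconvex_fgrad z Hh Hp; have h2 := mconvex_fgrad x Hh Hq.
move: h1 h2; rewrite -[x - z]opprB (dotvBl q).
move: (z - x) => v; rewrite !dotvNr dotvNl opprK.
by set a := dotv q v; set b := dotv p v; set c := dotv v v; lra.
Qed.

End frechet_gradient.

(** * The proximal map and the saddle point *)

Section prox.
Context {R : realType} {n m : nat}.
Variables (f : 'rV[R]_n -> R) (g : 'rV[R]_n -> 'rV[R]_m) (mu rho : R).
Hypotheses (mu0 : 0 < mu) (rho0 : 0 < rho).
Hypothesis df : forall x, differentiable f x.
Hypothesis dg : forall j x, differentiable (coord_fun g j) x.
Hypothesis cf : mconvex mu f.
Hypothesis cg : forall j, mconvex 0 (coord_fun g j).
Implicit Types (x z u : 'rV[R]_n) (y : 'rV[R]_m).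

Definition lagrangian y x : R := f x + dotv y (g x).

Definition lgrad y x : 'rV[R]_n := grad f x + y *m jac g x.

Lemma mul_jac y x : y *m jac g x = \sum_j y 0 j *: grad (coord_fun g j) x.
Proof. by rewrite mulmx_sum_row; apply: eq_bigr => j _; rewrite rowK. Qed.

Lemma dotv_mul_jac y x v :
  dotv (y *m jac g x) v = \sum_j y 0 j * dotv (grad (coord_fun g j) x) v.
Proof.
rewrite mul_jac.
have E : forall k (a : 'I_k -> 'rV[R]_n), dotv (\sum_j a j) v = \sum_j dotv (a j) v.
  elim=> [|k IH] a; first by rewrite !big_ord0 dotv0l.
  by rewrite !big_ord_recl dotvDl IH.
by rewrite E; apply: eq_bigr => j _; rewrite dotvZl.
Qed.

Lemma lagrangian_fgrad y x : is_fgrad (lagrangian y) x (lgrad y x).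
Proof.
apply: is_fgradD; first exact: grad_is_fgrad.
rewrite mul_jac; apply: (is_fgrad_sum (h := fun j z => y 0 j * coord_fun g j z)).
by move=> j; apply: is_fgradZ; exact: grad_is_fgrad.
Qed.

Lemma lagrangian_mconvex y : nonneg y -> mconvex mu (lagrangian y).
Proof.
move=> y0; rewrite -[mu]addr0; apply: mconvexD => //.
apply: (mconvex_sum (h := fun j z => y 0 j * coord_fun g j z)) => j.
by apply: mconvexZ.
Qed.

Lemma prox_fgrad u y x :
  is_fgrad (prox_lagrangian f g rho u y) x (lgrad y x + rho *: (x - u)).
Proof. by apply: is_fgradD; [exact: lagrangian_fgrad|exact: is_fgrad_quad]. Qed.

Lemma prox_mconvex u y : nonneg y -> mconvex (mu + rho) (prox_lagrangian f g rho u y).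
Proof.
by move=> y0; apply: mconvexD; [exact: lagrangian_mconvex|exact: mconvex_quad].
Qed.

(** Strong convexity bounds F below by a quadratic with value F u at u, so F >= F u outside a ball;
    compactness gives a minimum inside. *)
Lemma prox_minimizer u y : nonneg y ->
  exists x, is_minimizer (prox_lagrangian f g rho u y) x.
Proof.
move=> y0; set F := prox_lagrangian f g rho u y.
have F_cont : continuous F by apply: is_fgrad_continuous => x; eexists; exact: prox_fgrad.
have al0 : 0 < mu + rho by rewrite addr_gt0.
pose p := lgrad y u + rho *: (u - u).
have Flb z : F u + dotv p (z - u) + (mu + rho) / 2 * dotv (z - u) (z - u) <= F z.
  exact: mconvex_fgrad (prox_mconvex u y0) (prox_fgrad u y u).
(* Beyond this distance from u the quadratic term of [Flb] dominates the linear one. *)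
pose r := 2 * enorm p / (mu + rho).
have r0 : 0 <= r by rewrite divr_ge0 ?mulr_ge0 ?enorm_ge0// ltW.
pose K := [set z : 'rV[R]_n | `|z - u| <= r].
have Ku : K u by rewrite /K/= subrr normr0.
have bK : bounded_set K.
  exists (`|u| + r); split; first exact: num_real.
  move=> M ltM z Kz /=; apply: le_trans (ltW ltM).
  by rewrite -(subrK u z) addrC (le_trans (ler_normD _ _))// lerD2l.
have cK : closed K.
  have -> : K = (fun z => `|z - u|) @^-1` [set t | t <= r] by [].
  apply: preimage_closed; last exact: closed_le.
  move=> z _; apply: (@lipschitz_continuous _ _ _ _ 1) => a b.
  rewrite mul1r; apply: le_trans (ler_dist_dist _ _) _.
  by rewrite opprB addrA subrK.
have [] := @EVT_min_rV _ _ F K _ (bounded_closed_compact bK cK) _.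
- by exists u.
- exact: continuous_subspaceT.
move=> x; rewrite inE => Kx Hx; exists x => z.
have [zr|rz] := leP `|z - u| r; first by apply: Hx; rewrite inE.
apply: le_trans (Hx u _) _; first by rewrite inE.
apply: le_trans (Flb z).
rewrite -addrA lerDl.
have e1 : r < enorm (z - u) by apply: lt_le_trans (norm_le_enorm _).
have e2 := dotv_abs_le_enorm p (z - u).
rewrite -enorm_sqr; move: e2; rewrite ler_norml => /andP[e2 _].
have e3 : enorm p * enorm (z - u) <= (mu + rho) / 2 * enorm (z - u) ^+ 2.
  rewrite expr2 mulrA ler_wpM2r ?enorm_ge0//.
  by move: e1; rewrite /r ltr_pdivrMr// => e1; lra.
lra.
Qed.

Local Notation xt := (xtilde f g rho).

Lemma xtilde_min u y : nonneg y -> is_minimizer (prox_lagrangian f g rho u y) (xt u y).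
Proof.
move=> y0; have [x Hx] := prox_minimizer u y0.
exact: (xgetPex 0 (ex_intro _ x Hx)).
Qed.

Lemma xtildeP u y : nonneg y -> lgrad y (xt u y) = rho *: (u - xt u y).
Proof.
move=> y0; have /is_fgrad_min := prox_fgrad u y (xt u y).
move=> /(_ (xtilde_min u y0)) /eqP; rewrite addr_eq0 => /eqP ->.
by rewrite -scalerN opprB.
Qed.

Lemma lgrad_monotone y x z : nonneg y ->
  mu * dotv (z - x) (z - x) <= dotv (lgrad y z - lgrad y x) (z - x).
Proof.
move=> y0; apply: mconvex_monotone (lagrangian_mconvex y0) _ _;
  exact: lagrangian_fgrad.
Qed.

(** Two stationary points differ by w with mu |w|^2 <= - rho |w|^2. *)
Lemma xtilde_unique u y z : nonneg y -> lgrad y z = rho *: (u - z) -> xt u y = z.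
Proof.
move=> y0 Hz; apply/eqP; rewrite -subr_eq0; apply/eqP/dotv_eq0.
have := lgrad_monotone z (xt u y) y0; rewrite Hz xtildeP// -scalerBr.
have -> : u - xt u y - (u - z) = - (xt u y - z).
  by apply/rowP => j; rewrite !mxE; ring.
move: (xt u y - z) => w; rewrite dotvZl dotvNl => h.
have w0 := dotv_ge0 w; have h1 := mulr_ge0 (ltW mu0) w0.
apply/eqP; rewrite eq_le w0 andbT -(pmulr_rle0 _ rho0); lra.
Qed.

Lemma Ltilde_le u y z : nonneg y -> Ltilde f g rho u y <= prox_lagrangian f g rho u y z.
Proof.
move=> y0; apply: ge_inf; last by exists z.
by exists (prox_lagrangian f g rho u y (xt u y)) => _ [w _ <-]; exact: xtilde_min.
Qed.

Lemma LtildeE u y : nonneg y ->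
  Ltilde f g rho u y = prox_lagrangian f g rho u y (xt u y).
Proof.
move=> y0; apply/eqP; rewrite eq_le Ltilde_le//=.
apply: lb_le_inf; first by exists (prox_lagrangian f g rho u y u), u.
by move=> _ [w _ <-]; exact: xtilde_min.
Qed.

(** Moving the centre from [us] to x = [xtilde us ys] removes the quadratic term at x, while the
    saddle property forbids [Ltilde] to decrease. *)
Lemma saddle_fixed us ys : saddle_point (Ltilde f g rho) us ys -> xt us ys = us.
Proof.
move=> [ys0 H]; pose x := xt us ys.
have [_ h1] := H x ys ys0.
have h2 : Ltilde f g rho x ys <= lagrangian ys x.
  have := Ltilde_le x x ys0.
  by rewrite /prox_lagrangian subrr enorm0 expr0n/= mulr0 addr0.
have h3 : Ltilde f g rho us ys = lagrangian ys x + rho / 2 * enorm (x - us) ^+ 2.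
  by rewrite LtildeE.
apply/eqP; rewrite -subr_eq0 -/x; apply/eqP/dotv_eq0; rewrite -enorm_sqr.
have h4 : 0 <= enorm (x - us) ^+ 2 by rewrite sqr_ge0.
apply/eqP; rewrite eq_le h4 andbT -(pmulr_rle0 _ rho0); lra.
Qed.

(** The difference of two stationarity equations. The change of multiplier is charged to the
    Jacobian at the new point, so that the gradients on the left share the same y and are comparable
    by monotonicity. *)
Lemma xtilde_diff u u' y y' : nonneg y -> nonneg y' ->
  (lgrad y (xt u' y') - lgrad y (xt u y)) + rho *: (xt u' y' - xt u y) =
  rho *: (u' - u) - (y' - y) *m jac g (xt u' y').
Proof.
move=> y0 y'0; have h1 := xtildeP u y0; have := xtildeP u' y'0.
have -> : lgrad y' (xt u' y') =
    lgrad y (xt u' y') + (y' - y) *m jac g (xt u' y').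
  by rewrite /lgrad mulmxBl -addrA (addrCA (y *m _)) subrr addr0.
move=> /eqP; rewrite eq_sym -subr_eq => /eqP <-; rewrite h1.
move: (xt u' y') (xt u y) (_ *m _) => x' x w.
by apply/rowP => j; rewrite !mxE; ring.
Qed.

Section bounded_jacobian.
Variables (sigma kappa : R).
Hypothesis sigma0 : 0 < sigma.
Hypothesis jsigma : forall x, loewner_le (jac g x *m (jac g x)^T) sigma%:M.
Hypothesis jkappa : forall x, loewner_le kappa%:M (jac g x *m (jac g x)^T).

Lemma dotvE k (a b : 'rV[R]_k) : dotv a b = (a *m b^T) 0 0.
Proof. by rewrite mxE; apply: eq_bigr => i _; rewrite mxE. Qed.

Lemma loewner_scalar_le k (c : R) (A : 'M[R]_k) v : loewner_le A c%:M ->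
  dotv (v *m A) v <= c * dotv v v.
Proof.
move=> /(_ v); rewrite mulmxBr mulmxBl mul_mx_scalar -scalemxAl !mxE.
by rewrite subr_ge0 !dotvE !mxE.
Qed.

Lemma loewner_scalar_ge k (c : R) (A : 'M[R]_k) v : loewner_le c%:M A ->
  c * dotv v v <= dotv (v *m A) v.
Proof.
move=> /(_ v); rewrite mulmxBr mulmxBl mul_mx_scalar -scalemxAl !mxE.
by rewrite subr_ge0 !dotvE !mxE.
Qed.

Lemma dotv_gram k l (J : 'M[R]_(k, l)) v : dotv (v *m (J *m J^T)) v = dotv (v *m J) (v *m J).
Proof. by rewrite !dotvE trmx_mul !mulmxA. Qed.

Lemma jac_le x v : dotv (v *m jac g x) (v *m jac g x) <= sigma * dotv v v.
Proof. by rewrite -dotv_gram; exact: loewner_scalar_le. Qed.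

Lemma jac_ge x v : kappa * dotv v v <= dotv (v *m jac g x) (v *m jac g x).
Proof. by rewrite -dotv_gram; exact: loewner_scalar_ge. Qed.

Let s := Num.sqrt sigma.
Let s_ge0 : 0 <= s. Proof. exact: sqrtr_ge0. Qed.

Lemma enorm_jac x v : enorm (v *m jac g x) <= s * enorm v.
Proof. by rewrite -sqrtrM ?(ltW sigma0)// ler_wsqrtr// jac_le. Qed.

(** The gradient of g_j is a row of the Jacobian, of norm at most sqrt sigma; the gradient
    inequality at either point then bounds the increment. *)
Lemma coord_fun_lipschitz j x z :
  `|coord_fun g j z - coord_fun g j x| <= s * enorm (z - x).
Proof.
have gb w : enorm (grad (coord_fun g j) w) <= s.
  have := enorm_jac w (delta_mx 0 j); rewrite -rowE rowK => /le_trans; apply.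
  rewrite /enorm dotv_delta mxE !eqxx sqrtr1 mulr1; exact: lexx.
have half a b : coord_fun g j a - coord_fun g j b <= s * enorm (b - a).
  have := mconvex_fgrad b (cg j) (grad_is_fgrad (dg j a)).
  rewrite !mul0r addr0 => h.
  have := dotv_abs_le_enorm (grad (coord_fun g j) a) (b - a).
  rewrite ler_norml => /andP[h2 _].
  have : enorm (grad (coord_fun g j) a) * enorm (b - a) <= s * enorm (b - a).
    by rewrite ler_wpM2r ?enorm_ge0.
  lra.
rewrite ler_norml; apply/andP; split; last by rewrite -enormN opprB half.
by have := half x z; lra.
Qed.

Lemma g_lipschitz x z : enorm (g z - g x) <= m%:R * s * enorm (z - x).
Proof.
apply: le_trans (enorm_le_norm _) _; rewrite -mulrA ler_wpM2l//.
have h : 0 <= s * enorm (z - x) by rewrite mulr_ge0 ?enorm_ge0.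
apply/(rv_norm_leP _ h) => j; rewrite !mxE; exact: coord_fun_lipschitz.
Qed.

(** Pair [xtilde_diff] with dx: its left side is at least (mu + rho) |dx|^2. *)
Lemma xtilde_lipschitz u u' y y' : nonneg y -> nonneg y' ->
  enorm (xt u' y' - xt u y) <=
    (rho * enorm (u' - u) + s * enorm (y' - y)) / (mu + rho).
Proof.
move=> y0 y'0; have al0 : 0 < mu + rho by rewrite addr_gt0.
rewrite ler_pdivlMr//.
set dx := xt u' y' - xt u y.
have := lgrad_monotone (xt u y) (xt u' y') y0; rewrite -/dx => h1.
have := xtilde_diff u u' y0 y'0; rewrite -/dx.
set Q := rho *: _ - _ => hQ.
have h2 : (mu + rho) * dotv dx dx <= dotv Q dx.
  by rewrite -hQ dotvDl dotvZl; lra.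
have hQn : enorm Q <= rho * enorm (u' - u) + s * enorm (y' - y).
  apply: le_trans (enorm_triangle _ _) _; rewrite enormN enormZ gtr0_norm//.
  by rewrite lerD2l enorm_jac.
apply: le_trans hQn.
have h3 := le_trans h2 (dotv_le_enorm Q dx); rewrite -enorm_sqr expr2 in h3.
have [e0|e0] := eqVneq (enorm dx) 0; first by rewrite e0 mul0r enorm_ge0.
have ep : 0 < enorm dx by rewrite lt_neqAle eq_sym e0 enorm_ge0.
by rewrite -(ler_pM2r ep) [enorm dx * _]mulrC -mulrA.
Qed.

Variables (us : 'rV[R]_n) (ys : 'rV[R]_m).
Hypothesis sad : saddle_point (Ltilde f g rho) us ys.

(** A one-sided envelope argument. At yt = ys + t dy with minimizer x, maximality of [ys] and
    [Ltilde_le] give t <dy, g x> <= 0, and x tends to [us] as t tends to 0 because [xtilde] is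
    Lipschitz. *)
Lemma saddle_variational y : nonneg y -> dotv (y - ys) (g us) <= 0.
Proof.
move=> y0; have xs := saddle_fixed sad; have [ys0 H] := sad.
set dy := y - ys.
have al0 : 0 < mu + rho by rewrite addr_gt0.
pose C := enorm dy * (m%:R * s * ((s * enorm dy) / (mu + rho))).
have C0 : 0 <= C.
  by rewrite !mulr_ge0 ?enorm_ge0 ?invr_ge0 ?(ltW al0).
apply: (continuous_onesided C0) => e e0; rewrite add0r.
pose t := Num.min 1 e.
have t0 : 0 < t by rewrite lt_min ltr01.
have t1 : t <= 1 by rewrite ge_min lexx.
have te : t <= e by rewrite ge_min lexx orbT.
pose yt := ys + t *: dy.
have yt0 : nonneg yt.
  move=> j; rewrite !mxE (_ : _ + _ = (1 - t) * ys 0 j + t * y 0 j); last by ring.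
  by rewrite addr_ge0// mulr_ge0 ?subr_ge0 ?(ltW t0).
have [h1 _] := H us yt yt0.
pose x := xt us yt.
have h2 : dotv dy (g x) <= 0.
  rewrite -(pmulr_rle0 _ t0).
  have := Ltilde_le us x ys0.
  move: h1; rewrite (LtildeE us yt0) -/x /prox_lagrangian /yt dotvDl dotvZl; lra.
have h3 : dotv dy (g us - g x) <= C * t.
  apply: le_trans (dotv_le_enorm _ _) _.
  rewrite /C -!mulrA ler_wpM2l ?enorm_ge0//.
  apply: le_trans (g_lipschitz _ _) _.
  rewrite -mulrA ler_wpM2l// ler_wpM2l//.
  rewrite -[us in us - x]xs; apply: le_trans (xtilde_lipschitz _ _ yt0 ys0) _.
  rewrite subrr enorm0 mulr0 add0r.
  have -> : ys - yt = - t *: dy.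
    by rewrite /yt scaleNr opprD addrA subrr add0r.
  rewrite enormZ normrN gtr0_norm//.
  by rewrite [t * _]mulrC !mulrA [_ * t * _]mulrAC.
move: h3; rewrite dotvBr.
have : C * t <= C * e by rewrite ler_wpM2l.
lra.
Qed.

(** The gradient inequality of g_j at x' weighted by y'_j, plus the one at x weighted by y_j. *)
Lemma dotv_coord_mono y y' x x' : nonneg y -> nonneg y' ->
  dotv (y' - y) (g x' - g x) <=
  dotv (y' *m jac g x' - y *m jac g x) (x' - x).
Proof.
move=> y0 y'0; rewrite [leRHS]dotvBl !dotv_mul_jac -sumrB {1}/dotv.
apply: ler_sum => j _; rewrite !mxE.
have h1 := mconvex_fgrad x' (cg j) (grad_is_fgrad (dg j x)).
have h2 := mconvex_fgrad x (cg j) (grad_is_fgrad (dg j x')).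
rewrite !mul0r !addr0 in h1 h2.
rewrite -[x - x']opprB dotvNr in h2.
have := ler_wpM2l (y0 j) h1; have := ler_wpM2l (y'0 j) h2.
rewrite /coord_fun.
set a := dotv _ _; set b := dotv _ _; lra.
Qed.

(** With x = [xtilde u y], split u - us as (u - x) + (x - us): the first part gives a square, the
    second the monotonicity in x, which also pays for the g term. It covers every y >= 0, so it
    applies before the solution is known to stay in [D0]. *)
Lemma prox_monotone u y : nonneg y ->
  0 <= rho * dotv (u - xt u y) (u - us) - dotv (y - ys) (g (xt u y) - g us).
Proof.
move=> y0; have xs := saddle_fixed sad; have [ys0 _] := sad.
have E := xtildeP u y0; have := xtildeP us ys0; rewrite xs subrr scaler0 => Es.
set x := xt u y in E *.
have h1 := dotv_coord_mono us x ys0 y0.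
have h2 := mconvex_monotone cf (grad_is_fgrad (df us)) (grad_is_fgrad (df x)).
have h3 : rho * dotv (u - x) (x - us) =
    dotv (grad f x - grad f us) (x - us) + dotv (y *m jac g x - ys *m jac g us) (x - us).
  rewrite -dotvDl -dotvZl -E; congr dotv.
  by rewrite addrACA -opprD -/(lgrad ys us) Es subr0.
have -> : u - us = (u - x) + (x - us) by rewrite addrA subrK.
rewrite dotvDr mulrDr h3.
have := dotv_ge0 (u - x); have := dotv_ge0 (x - us) => p1 p2.
have := mulr_ge0 (ltW rho0) p2; have := mulr_ge0 (ltW mu0) p1; lra.
Qed.

End bounded_jacobian.

End prox.

(** * Strong monotonicity towards the saddle point *)

Section cocoercivity.
Context {R : realType} {n : nat}.
Implicit Types (h : 'rV[R]_n -> R) (x z v : 'rV[R]_n).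

(** The Baillon-Haddad inequality, with smoothness only near x0. At the gradient steps x - v and x0
    + v, v = (N x - N x0) / L, [descent] bounds h from above and convexity at the other point from
    below. The last hypothesis keeps both steps in the ball. *)
Lemma cocoercive_local h (N : 'rV[R]_n -> 'rV[R]_n) x0 x (r L : R) :
  0 < L -> (forall z, is_fgrad h z (N z)) -> mconvex 0 h ->
  (forall x z, `|x - x0| < r -> `|z - x0| < r ->
     dotv (N z - N x) (z - x) <= L * dotv (z - x) (z - x)) ->
  `|x - x0| + `|L^-1 *: (N x - N x0)| < r ->
  dotv (N x - N x0) (N x - N x0) <= L * dotv (N x - N x0) (x - x0).
Proof.
move=> L0 hN ch HL; set q := N x - N x0; set v := L^-1 *: q => xr.
have xr' : `|x - x0| < r by apply: le_lt_trans xr; rewrite lerDl.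
have r0 : `|x0 - x0| < r by rewrite subrr normr0; exact: le_lt_trans xr'.
have Lv : L *: v = q by rewrite /v scalerA divff ?scale1r// gt_eqF.
have step a w : `|a - x0| < r ->
    (forall s, 0 <= s -> s <= 1 -> `|a + s *: w - x0| < r) ->
    h (a + w) <= h a + dotv (N a) w + L * dotv w w / 2.
  move=> ar Hs; apply: (descent hN) => s s0 s1.
  have := HL a (a + s *: w) ar (Hs s s0 s1).
  have -> : a + s *: w - a = s *: w by rewrite addrAC subrr add0r.
  rewrite !dotvZr dotvZl.
  have [->|sn] := eqVneq s 0.
    by move=> _; rewrite scale0r addr0 subrr dotv0l mulr0.
  have sp : 0 < s by rewrite lt_neqAle eq_sym sn.
  move=> h0; rewrite -(ler_pM2l sp); apply: le_trans h0 _.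
  by rewrite le_eqVlt; apply/orP; left; apply/eqP; ring.
have sv s : 0 <= s -> s <= 1 -> `|s *: v| <= `|v|.
  by move=> s0 s1; rewrite normrZ ger0_norm// ler_piMl.
have h1 : h (x - v) <= h x + dotv (N x) (- v) + L * dotv (- v) (- v) / 2.
  apply: step => // s s0 s1; rewrite addrAC.
  apply: le_lt_trans (ler_normD _ _) _; apply: le_lt_trans xr.
  by rewrite lerD2l scalerN normrN; exact: sv.
have h2 : h (x0 + v) <= h x0 + dotv (N x0) v + L * dotv v v / 2.
  apply: step => // s s0 s1; rewrite addrAC subrr add0r.
  by apply: le_lt_trans (sv s s0 s1) _; apply: le_lt_trans xr; rewrite lerDr.
have h3 := mconvex_fgrad (x - v) ch (hN x0).
have h4 := mconvex_fgrad (x0 + v) ch (hN x).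
move: h1 h2 h3 h4; rewrite !mul0r !addr0.
rewrite (_ : x - v - x0 = (x - x0) - v); last by rewrite addrAC.
rewrite (_ : x0 + v - x = v - (x - x0)); last by rewrite opprB addrCA addrA.
have qE : N x - N x0 = q by [].
clearbody v; clearbody q; move: (x - x0) => dx.
rewrite !dotvBr !dotvNr dotvNl opprK.
have E1 : dotv q v = L * dotv v v by rewrite -dotvZl Lv.
have E2 : dotv q q = L * (L * dotv v v) by rewrite -[X in dotv q X]Lv dotvZr E1.
have E3 : dotv (N x) v - dotv (N x0) v = L * dotv v v by rewrite -dotvBl qE E1.
have E4 : dotv (N x) dx - dotv (N x0) dx = dotv q dx by rewrite -dotvBl qE.
move=> h1 h2 h3 h4.
rewrite E2 ler_pM2l// -E4; lra.
Qed.

(** Passage to the sup norm: [enorm] is at most n times it, and n + 1 is nonzero also for n = 0. *)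
Lemma grad_local_lipschitz h x0 : locally_lipschitz_grad h ->
  exists K r, [/\ 0 <= K, 0 < r & forall z z', `|z - x0| < r -> `|z' - x0| < r ->
    `|grad h z - grad h z'| <= K * `|z - z'|].
Proof.
move=> /(_ x0)[k [r [r0 H]]]; exists (`|k| * n%:R), (r / n.+1%:R).
split; [by rewrite mulr_ge0|by rewrite divr_gt0|].
have near z : `|z - x0| < r / n.+1%:R -> enorm (z - x0) < r.
  rewrite ltr_pdivlMr// => zr; apply: le_lt_trans (enorm_le_norm _) _.
  by apply: le_lt_trans zr; rewrite mulrC ler_wpM2l// ler_nat.
move=> z z' /near zr /near z'r.
apply: le_trans (norm_le_enorm _) _; apply: le_trans (H _ _ zr z'r) _.
rewrite -mulrA; apply: (@le_trans _ _ (`|k| * enorm (z - z'))).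
  by rewrite ler_wpM2r ?enorm_ge0// ler_norm.
by rewrite ler_wpM2l// enorm_le_norm.
Qed.

(* Q and dx are the increments of an alpha-strongly convex, Lambda-smooth
   gradient and of its argument.  With D = 1/alpha - 1/Lambda, the bound is
   |D z + Q / alpha - dx|^2 >= 0 plus the interpolation inequality. *)
Lemma interpolation_bound (alpha Lambda rho : R) (du dx z Q : 'rV[R]_n) :
  0 < alpha -> alpha < Lambda -> Q = rho *: du - z ->
  0 <= dotv (Q - alpha *: dx) (Lambda *: dx - Q) ->
  (rho - rho ^+ 2 / alpha) * dotv du du + dotv z z / Lambda <=
  rho * dotv (du - dx) du - dotv z dx.
Proof.
move=> a0 aL QE F1.
have L0 : 0 < Lambda by exact: lt_trans aL.
pose D := alpha^-1 - Lambda^-1.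
have D0 : 0 < D by rewrite subr_gt0 ltf_pV2.
have F2 := dotv_ge0 (D *: z + alpha^-1 *: Q - dx).
have EQ : rho *: du = Q + z by rewrite QE subrK.
have E1 : rho ^+ 2 * dotv du du = dotv Q Q + 2 * dotv z Q + dotv z z.
  have -> : rho ^+ 2 * dotv du du = dotv (rho *: du) (rho *: du).
    by rewrite dotvZl dotvZr expr2 mulrA.
  by rewrite EQ dotv_sqr_expand (dotvC z).
have E2 : rho * dotv dx du = dotv Q dx + dotv z dx.
  by rewrite -dotvZr EQ dotvDr !(dotvC dx).
have Eu : rho * dotv (du - dx) du = rho * dotv du du - rho * dotv dx du.
  by rewrite dotvBl mulrBr.
rewrite Eu E2 mulrBl (mulrAC (rho ^+ 2)) E1.
move: F1 F2; rewrite !dotvBl !dotvBr !dotvDl !dotvDr !dotvZl !dotvZr.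
rewrite (dotvC dx z) (dotvC dx Q) (dotvC Q z).
set zz := dotv z z; set zQ := dotv z Q; set zd := dotv z dx.
set QQ := dotv Q Q; set Qd := dotv Q dx; set dd := dotv dx dx; set uu := dotv du du.
move=> F1 F2; rewrite -subr_ge0 -(pmulr_rge0 _ D0).
set X := (X in 0 <= D * X).
set Y1 := (X in 0 <= X) in F1.
set Y2 := (X in 0 <= X) in F2.
have -> : D * X = Y2 + Y1 / (alpha * Lambda).
  by rewrite /X /Y1 /Y2 /D; field; rewrite !gt_eqF.
by rewrite addr_ge0// divr_ge0// mulr_ge0// ltW.
Qed.

End cocoercivity.

(** * Local smoothness of the Lagrangian *)

Section local_estimates.
Context {R : realType} {n m : nat}.
Variables (f : 'rV[R]_n -> R) (g : 'rV[R]_n -> 'rV[R]_m) (mu l : R).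
Hypothesis df : forall x, differentiable f x.
Hypothesis dg : forall j x, differentiable (coord_fun g j) x.
Hypothesis cf : mconvex mu f.
Hypothesis cg : forall j, mconvex 0 (coord_fun g j).
Hypothesis lf : lipschitz_grad l f.
Hypothesis lg : forall j, locally_lipschitz_grad (coord_fun g j).
Implicit Types (x z u v : 'rV[R]_n) (y : 'rV[R]_m).

Lemma jac_local_lipschitz x0 : exists (K : 'I_m -> R) r,
  [/\ forall j, 0 <= K j, 0 < r &
      forall x, `|x - x0| <= r -> forall j,
        `|grad (coord_fun g j) x - grad (coord_fun g j) x0| <= K j * `|x - x0|].
Proof.
have /choice[K HK] : forall j, exists K : R, 0 <= K /\ exists2 r : R, 0 < r &
    forall w, `|w| <= r ->
    `|grad (coord_fun g j) (x0 + w) - grad (coord_fun g j) x0| <= K * `|w|.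
  move=> j; have [K [r [K0 r0 H]]] := grad_local_lipschitz x0 (lg j).
  exists K; split => //; exists (r / 2); first by rewrite divr_gt0.
  move=> w wr; rewrite -[w in leRHS](addKr x0) [- _ + _]addrC; apply: H.
    rewrite addrAC subrr add0r; apply: le_lt_trans wr _.
    by rewrite ltr_pdivrMr// ltr_pMr// ltr1n.
  by rewrite subrr normr0.
have [r r0 Hr] := finite_radius (fun j => (HK j).2).
exists K, r; split => // [j|x xr j]; first exact: (HK j).1.
by have := Hr _ xr j; rewrite [x0 + _]addrC subrK.
Qed.

Lemma lgrad_local_lipschitz y x0 : exists K r, [/\ 0 <= K, 0 < r &
  forall x, `|x - x0| <= r -> `|lgrad f g y x - lgrad f g y x0| <= K * `|x - x0|].
Proof.
have [K [r [K0 r0 H]]] := jac_local_lipschitz x0.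
exists (`|l| * n%:R + \sum_j `|y 0 j| * K j), r; split => //.
  by rewrite addr_ge0 ?mulr_ge0// sumr_ge0// => j _; rewrite mulr_ge0.
move=> x xr; rewrite /lgrad opprD addrACA !mul_jac -sumrB mulrDl.
apply: le_trans (ler_normD _ _) _; apply: lerD.
  apply: le_trans (norm_le_enorm _) _; apply: le_trans (lf _ _) _.
  rewrite -mulrA; apply: (@le_trans _ _ (`|l| * enorm (x - x0))).
    by rewrite ler_wpM2r ?enorm_ge0// ler_norm.
  by rewrite ler_wpM2l// enorm_le_norm.
apply: le_trans (ler_norm_sum _ _ _) _; rewrite mulr_suml.
apply: ler_sum => j _; rewrite -scalerBr normrZ -mulrA ler_wpM2l//.
exact: H.
Qed.

(** By convexity g_j x - g_j x0 lies between the pairings of x - x0 with the gradients at x0 and at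
    x, which differ by O(|x - x0|^2). *)
Lemma linearization_error x0 : exists C r, [/\ 0 <= C, 0 < r & forall x dy,
  `|x - x0| <= r ->
  dotv dy (g x - g x0) - dotv (dy *m jac g x) (x - x0) <=
    C * `|dy| * `|x - x0| ^+ 2].
Proof.
have [K [r [K0 r0 H]]] := jac_local_lipschitz x0.
exists (n%:R * \sum_j K j), r; split => //.
  by rewrite mulr_ge0// sumr_ge0.
move=> x dy xr; rewrite dotv_mul_jac /dotv -sumrB.
rewrite mulrAC -mulrA mulr_sumr mulr_suml; apply: ler_sum => j _.
have h1 := mconvex_fgrad x (cg j) (grad_is_fgrad (dg j x0)).
have h2 := mconvex_fgrad x0 (cg j) (grad_is_fgrad (dg j x)).
rewrite !mul0r !addr0 in h1 h2.
rewrite -[x0 - x]opprB dotvNr in h2.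
set a := dotv _ _ in h1; set b := dotv _ _ in h2.
have h3 : `|a - b| <= n%:R * (K j * `|x - x0|) * `|x - x0|.
  rewrite /a /b -dotvBl; apply: le_trans (dotv_norm_le _ _) _.
  by rewrite ler_wpM2r// ler_wpM2l// distrC H.
rewrite -/(dotv _ _) !mxE -mulrBr.
apply: le_trans (ler_norm _) _; rewrite normrM.
apply: (@le_trans _ _ (`|dy 0 j| * (n%:R * (K j * `|x - x0|) * `|x - x0|))).
  apply: ler_wpM2l => //; apply: le_trans h3.
  rewrite -/b; move: h1 h2; rewrite /coord_fun => h1 h2.
  have ab : a - b <= 0 by lra.
  rewrite (ler0_norm ab) ler_norml; apply/andP; split; lra.
rewrite [leRHS](_ : _ = `|dy| * (n%:R * (K j * `|x - x0|) * `|x - x0|)); last by ring.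
by rewrite ler_wpM2r ?coord_le_norm// !mulr_ge0.
Qed.

(** Two distinct points are essential: in dimension 0, mu and l are unrelated. *)
Lemma strongly_convex_le_lipschitz x z : x != z -> mu <= l.
Proof.
move=> xz; have h1 := mconvex_monotone cf (grad_is_fgrad (df x)) (grad_is_fgrad (df z)).
have h2 := dotv_le_enorm (grad f z - grad f x) (z - x).
have h3 : 0 < dotv (z - x) (z - x).
  rewrite lt_neqAle dotv_ge0 andbT eq_sym; apply: contra xz => /eqP/dotv_eq0/eqP.
  by rewrite subr_eq0 eq_sym.
rewrite -(ler_pM2r h3); apply: le_trans h1 _; apply: le_trans h2 _.
by rewrite -enorm_sqr expr2 mulrA ler_wpM2r ?enorm_ge0//; exact: lf.
Qed.

(** Subtracting mu / 2 |z|^2 from the Lagrangian leaves a convex function; f contributes l - mu to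
    its smoothness and each g_j its multiplier times gamma. [eta] keeps the constant positive when
    mu = l and the multipliers vanish. *)
Lemma lgrad_cocoercive_local y x0 (gamma r eta : R) : nonneg y ->
  0 < r -> 0 < eta -> 0 <= gamma ->
  (forall j z, `|z - x0| < r -> hessian_defined (coord_fun g j) z ->
     loewner_le (hessian (coord_fun g j) z) gamma%:M) ->
  exists2 d, 0 < d & forall x, `|x - x0| < d ->
    let q := lgrad f g y x - lgrad f g y x0 - mu *: (x - x0) in
    dotv q q <= (l - mu + (\sum_j y 0 j) * gamma + eta) * dotv q (x - x0).
Proof.
move=> y0 r0 eta0 gamma0 hess.
set L := l - mu + _ + eta.
have onel x z : dotv (grad f z - grad f x) (z - x) <= l * dotv (z - x) (z - x).
  apply: le_trans (dotv_le_enorm _ _) _; rewrite -enorm_sqr expr2 mulrA.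
  by rewrite ler_wpM2r ?enorm_ge0//; exact: lf.
have /choice[rg Hrg] : forall j, exists rg : R, 0 < rg /\ forall x z,
    `|x - x0| < rg -> `|z - x0| < rg ->
    dotv (grad (coord_fun g j) z - grad (coord_fun g j) x) (z - x) <=
      gamma * dotv (z - x) (z - x).
  move=> j; have [K [r1 [K0 r10 H]]] := grad_local_lipschitz x0 (lg j).
  exists (Num.min r r1); split; first by rewrite lt_min r0.
  apply: (onesided_lipschitz K0) => [z z'|z].
    rewrite !lt_min => /andP[_ zr] /andP[_ z'r]; exact: H.
  rewrite lt_min => /andP[zr _] dz v.
  have /loewner_scalar_le := hess j z zr dz.
  move=> /(_ v); rewrite /hessian /jacobian mul_rV_lin1; exact.
have [r2 r20 Hr2] : exists2 r2, 0 < r2 & forall j x z,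
    `|x - x0| < r2 -> `|z - x0| < r2 ->
    dotv (grad (coord_fun g j) z - grad (coord_fun g j) x) (z - x) <=
      gamma * dotv (z - x) (z - x).
  exists (\big[Num.min/1]_j rg j); first by apply: lt_bigmin => // j _; case: (Hrg j).
  move=> j x z xr zr; apply: (Hrg j).2.
    by apply: lt_le_trans xr _; exact: bigmin_le.
  by apply: lt_le_trans zr _; exact: bigmin_le.
pose N z := lgrad f g y z + (- mu) *: (z - 0).
have NB a b : N a - N b = lgrad f g y a - lgrad f g y b - mu *: (a - b).
  rewrite /N !subr0; move: (lgrad f g y a) (lgrad f g y b) => A B.
  by apply/rowP => j; rewrite !mxE; ring.
pose h z := lagrangian f g y z + (- mu) / 2 * enorm (z - 0) ^+ 2.
have hN z : is_fgrad h z (N z).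
  by apply: is_fgradD; [exact: lagrangian_fgrad|exact: is_fgrad_quad].
have ch : mconvex 0 h.
  rewrite -(subrr mu); apply: mconvexD; last exact: mconvex_quad.
  exact: lagrangian_mconvex.
have NL x z : `|x - x0| < r2 -> `|z - x0| < r2 ->
    dotv (N z - N x) (z - x) <= L * dotv (z - x) (z - x).
  move=> xr zr; rewrite NB; have := onel x z.
  have {}Hr2 j := Hr2 j x z xr zr.
  move: (z - x) Hr2 => v Hv; rewrite !dotvBl dotvZl /lgrad !dotvDl !dotv_mul_jac.
  have : \sum_j y 0 j * dotv (grad (coord_fun g j) z) v -
      \sum_j y 0 j * dotv (grad (coord_fun g j) x) v <=
      (\sum_j y 0 j) * gamma * dotv v v.
    rewrite -sumrB -mulrA mulr_suml; apply: ler_sum => j _.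
    by rewrite -mulrBr -dotvBl ler_wpM2l.
  have : 0 <= eta * dotv v v by rewrite mulr_ge0 ?dotv_ge0// ltW.
  rewrite /L; lra.
(* L <= 0 forces l < mu, which leaves no point other than x0. *)
have [L0|L0] := ltP 0 L; last first.
  exists 1 => // x _ /=.
  have [->|xx0] := eqVneq x x0.
    by rewrite !subrr scaler0 subr0 !dotv0l mulr0.
  move: L0; rewrite leNgt => /negP[]; rewrite /L.
  have := strongly_convex_le_lipschitz xx0.
  have : 0 <= (\sum_j y 0 j) * gamma by rewrite mulr_ge0// sumr_ge0.
  lra.
have [K [r3 [K0 r30 HK]]] := lgrad_local_lipschitz y x0.
(* |x - x0| + |q / L| <= M |x - x0|, the quantity [cocoercive_local] wants below the radius. *)
pose M := 1 + `|L^-1| * (K + `|mu|).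
have M0 : 0 < M by rewrite ltr_wpDr// mulr_ge0// addr_ge0.
exists (Num.min r3 (r2 / M)); first by rewrite lt_min r30 divr_gt0.
move=> x; rewrite lt_min => /andP[xr3 xM].
move: xM; rewrite (ltr_pdivlMr _ _ M0) => xM; set q := _ - _ => /=.
have qb : `|q| <= (K + `|mu|) * `|x - x0|.
  apply: le_trans (ler_normB _ _) _; rewrite normrZ mulrDl lerD2r.
  by rewrite HK// ltW.
have := @cocoercive_local _ _ h N x0 x r2 L L0 hN ch NL; rewrite NB -/q; apply.
apply: le_lt_trans xM; rewrite normrZ /M mulrDr mulr1 lerD2l.
by rewrite mulrCA ler_wpM2l// mulrC.
Qed.

End local_estimates.

(** * Integration along the segment to the saddle point *)

Section strong_monotonicity.
Context {R : realType} {n m : nat}.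
Variables (f : 'rV[R]_n -> R) (g : 'rV[R]_n -> 'rV[R]_m).
Variables (mu l sigma kappa rho : R).
Hypotheses (mu0 : 0 < mu) (l0 : 0 < l) (sigma0 : 0 < sigma).
Hypotheses (kappa0 : 0 < kappa) (rho0 : 0 < rho).
Hypothesis df : forall x, differentiable f x.
Hypothesis dg : forall j x, differentiable (coord_fun g j) x.
Hypothesis cf : mconvex mu f.
Hypothesis cg : forall j, mconvex 0 (coord_fun g j).
Hypothesis lf : lipschitz_grad l f.
Hypothesis lg : forall j, locally_lipschitz_grad (coord_fun g j).
Hypothesis jsigma : forall x, loewner_le (jac g x *m (jac g x)^T) sigma%:M.
Hypothesis jkappa : forall x, loewner_le kappa%:M (jac g x *m (jac g x)^T).
Implicit Types (x z u v : 'rV[R]_n) (y : 'rV[R]_m).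
Local Notation xt := (xtilde f g rho).
Local Notation alpha := (mu + rho).

Let alpha0 : 0 < alpha. Proof. by rewrite addr_gt0. Qed.
Let sg := Num.sqrt sigma.

(** The left side is the rate in u as produced by [interpolation_bound]. *)
Lemma rate_uE : rho - rho ^+ 2 / alpha = mu * rho / alpha.
Proof. by field; rewrite gt_eqF. Qed.

(* All constants are taken at the base point (u, y); the price is the last term,
   of third order in the increment, which disappears along a segment. *)
Lemma prox_increment u y (gamma r eta : R) : nonneg y -> 0 < r -> 0 < eta ->
  0 <= gamma ->
  (forall j z, `|z - xt u y| < r -> hessian_defined (coord_fun g j) z ->
     loewner_le (hessian (coord_fun g j) z) gamma%:M) ->
  exists C d, [/\ 0 <= C, 0 < d & forall u' y', nonneg y' ->
    `|xt u' y' - xt u y| < d ->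
    mu * rho / alpha * dotv (u' - u) (u' - u) +
    kappa / (l + rho + (\sum_j y 0 j) * gamma + eta) * dotv (y' - y) (y' - y) <=
    rho * dotv ((u' - u) - (xt u' y' - xt u y)) (u' - u) -
    dotv (y' - y) (g (xt u' y') - g (xt u y)) +
    C * `|y' - y| * `|xt u' y' - xt u y| ^+ 2].
Proof.
move=> y0 r0 eta0 gamma0 hess; set x0 := xt u y.
have [d1 d10 H1] := lgrad_cocoercive_local df dg cf cg lf lg y0 r0 eta0 gamma0 hess.
have [C [d2 [C0 d20 H2]]] := linearization_error dg cg lg x0.
set Lam := l + rho + _ + eta.
have Lam0 : 0 < Lam.
  have S0 : 0 <= (\sum_j y 0 j) * gamma by rewrite mulr_ge0// sumr_ge0.
  by rewrite /Lam ltr_wpDl// !addr_ge0// ltW.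
exists C, (Num.min d1 d2); split => //; first by rewrite lt_min d10.
move=> u' y' y'0; rewrite lt_min => /andP[xd1 xd2].
set dx := xt u' y' - x0; set du := u' - u; set dy := y' - y.
have := H2 (xt u' y') dy (ltW xd2); rewrite -/dx => h2.
set z := dy *m jac g (xt u' y') in h2 *.
have := xtilde_diff mu0 rho0 df dg cf cg u u' y0 y'0; rewrite -/x0 -/dx -/du -/dy -/z.
set Q := _ + _ => QE.
have zge := jac_ge jkappa (xt u' y') dy; rewrite -/z in zge.
suff H : mu * rho / alpha * dotv du du + kappa / Lam * dotv dy dy <=
    rho * dotv (du - dx) du - dotv z dx by lra.
have zLam : kappa / Lam * dotv dy dy <= dotv z z / Lam.
  by rewrite mulrAC ler_wpM2r// invr_ge0 ltW.
(* For n = 0 the inequality mu <= l may fail; there z = 0, and [zLam] bounds the term in dy by 0. *)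
have [[v v0]|nv] := pselect (exists v : 'rV[R]_n, v != 0); last first.
  have all0 (v : 'rV[R]_n) : v = 0.
    by apply/eqP; apply: contraT => v0; case: nv; exists v.
  move: zLam; rewrite (all0 z) (all0 du) (all0 dx) !dotv0r; lra.
have mul : mu <= l := strongly_convex_le_lipschitz df cf lf v0.
have aLam : alpha < Lam.
  have S0 : 0 <= (\sum_j y 0 j) * gamma by rewrite mulr_ge0// sumr_ge0.
  by rewrite /Lam; move: (_ * gamma) S0 => S S0; lra.
rewrite -rate_uE; apply: le_trans (interpolation_bound alpha0 aLam QE _).
  by rewrite lerD2l.
have := H1 _ xd1; rewrite -/dx.
(* Cocoercivity of Q - alpha dx with constant Lam - alpha is exactly the sign condition of
   [interpolation_bound]. *)
have -> : lgrad f g y (xt u' y') - lgrad f g y x0 - mu *: dx = Q - alpha *: dx.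
  rewrite /Q; move: (_ - _) (dx) => A w.
  by rewrite scalerDl opprD addrACA subrr addr0.
have -> : Lam *: dx - Q = (Lam - alpha) *: dx - (Q - alpha *: dx).
  by move: Q {QE} => Q; apply/rowP => j; rewrite !mxE; ring.
move: (Q - _) => q /=; rewrite (dotvBr (_ *: dx)) dotvZr subr_ge0.
by rewrite (_ : l - mu + _ + eta = Lam - alpha)// /Lam; ring.
Qed.

Variables (us : 'rV[R]_n) (ys : 'rV[R]_m).
Hypothesis sad : saddle_point (Ltilde f g rho) us ys.
Variables (u0 : 'rV[R]_n) (y0 : 'rV[R]_m) (zeta gamma : R).
Hypothesis gamma0 : 0 <= gamma.
Hypothesis zetaP : forall u y, D0 us ys u0 y0 u y -> enorm y <= zeta.
Hypothesis gammaP : forall u y, D0 us ys u0 y0 u y ->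
  forall j, hessian_defined (coord_fun g j) (xt u y) ->
  loewner_le (hessian (coord_fun g j) (xt u y)) gamma%:M.

(* For fixed y, u |-> xt u y is onto: z is attained at u = z + grad / rho.  So
   the points xt u y with (u, y) in the interior of D0 are interior to xt D0. *)
Lemma hessian_bound_near u y : nonneg y ->
  enorm (u - us) ^+ 2 + enorm (y - ys) ^+ 2 <
    enorm (u0 - us) ^+ 2 + enorm (y0 - ys) ^+ 2 ->
  exists2 r, 0 < r & forall j z, `|z - xt u y| < r ->
    hessian_defined (coord_fun g j) z ->
    loewner_le (hessian (coord_fun g j) z) gamma%:M.
Proof.
move=> yge; set B := (X in _ < X) => uB.
set x0 := xt u y.
have [K [r1 [K0 r10 HK]]] := lgrad_local_lipschitz lf lg y x0.
pose U z := z + rho^-1 *: lgrad f g y z.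
have rn0 : rho != 0 by rewrite gt_eqF.
have Ux0 : U x0 = u.
  by rewrite /U (xtildeP mu0 rho0 df dg cf cg u yge) scalerA mulVf// scale1r addrC subrK.
have xtU z : xt (U z) y = z.
  apply: (xtilde_unique mu0 rho0 df dg cf cg) => //.
  by rewrite /U addrAC subrr add0r scalerA divff// scale1r.
pose M := 1 + rho^-1 * K.
have M0 : 0 < M by rewrite ltr_wpDr// mulr_ge0// invr_ge0 ltW.
have UL z : `|z - x0| <= r1 -> enorm (U z - u) <= n%:R * (M * `|z - x0|).
  move=> zr; apply: le_trans (enorm_le_norm _) _; rewrite ler_wpM2l//.
  rewrite -Ux0 /U opprD addrACA -scalerBr mulrDl mul1r.
  apply: le_trans (ler_normD _ _) _; rewrite lerD2l normrZ.
  rewrite ger0_norm ?invr_ge0 ?(ltW rho0)// -mulrA ler_wpM2l ?invr_ge0 ?(ltW rho0)//.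
  exact: HK.
pose e := enorm (u - us); have e0 : 0 <= e := enorm_ge0 _.
pose gap := B - (e ^+ 2 + enorm (y - ys) ^+ 2).
have gap0 : 0 < gap by rewrite subr_gt0.
(* For dl <= 1, (e + dl)^2 - e^2 <= dl (2 e + 1), which must not exceed the gap. *)
pose dl := Num.min 1 (gap / (2 * e + 1)).
have dl0 : 0 < dl by rewrite lt_min ltr01 divr_gt0// ltr_wpDl// mulr_ge0.
have dl1 : dl <= 1 by rewrite ge_min lexx.
have dlg : dl * (2 * e + 1) <= gap.
  rewrite -ler_pdivlMr ?ltr_wpDl ?mulr_ge0//; by rewrite ge_min lexx orbT.
have M1 : 0 < n%:R * M + 1 by rewrite ltr_wpDl// mulr_ge0// ltW.
exists (Num.min r1 (dl / (n%:R * M + 1))).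
  by rewrite lt_min r10 divr_gt0.
move=> j z; rewrite lt_min => /andP[zr1 zdl] hz.
rewrite -(xtU z); rewrite -(xtU z) in hz.
apply: gammaP => //; split => //; rewrite -/B.
have Uu : enorm (U z - u) <= dl.
  apply: le_trans (UL z (ltW zr1)) _; move: zdl; rewrite ltr_pdivlMr// => /ltW zdl.
  apply: le_trans zdl; rewrite mulrA mulrC ler_wpM2l// lerDl//.
have : enorm (U z - us) <= dl + e.
  rewrite -(subrK u (U z)) -addrA; apply: le_trans (enorm_triangle _ _) _.
  by rewrite lerD2r.
have h0 := enorm_ge0 (U z - us).
move=> h1; have h2 : enorm (U z - us) ^+ 2 <= (dl + e) ^+ 2.
  by rewrite ler_pXn2r ?nnegrE// addr_ge0// ltW.
have h3 : dl * dl <= dl * 1 by rewrite ler_wpM2l// ltW.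
rewrite /gap in dlg; move: h2; rewrite sqrrD -mulr_natr; move: dlg; rewrite !expr2.
lra.
Qed.

Lemma zeta_ge0 : 0 <= zeta.
Proof.
apply: le_trans (enorm_ge0 ys) _; apply: (zetaP (u := us)).
split; first by case: sad.
by rewrite !subrr !enorm0 !expr0n/= addr0 addr_ge0// sqr_ge0.
Qed.

(** Each multiplier is at most the norm of y: this is where the factor m of the rate arises. *)
Lemma sum_le_zeta u y : D0 us ys u0 y0 u y -> \sum_j y 0 j <= m%:R * zeta.
Proof.
move=> uy; rewrite -[m in leRHS]card_ord mulr_natl -sumr_const.
apply: ler_sum => j _; apply: le_trans (zetaP uy).
apply: le_trans (norm_le_enorm y); apply: le_trans (coord_le_norm _ j).
exact: ler_norm.
Qed.

Local Notation Lam := (l + rho + m%:R * zeta * gamma).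

Lemma Lam_gt0 : 0 < Lam.
Proof.
by rewrite ltr_wpDr ?addr_gt0// !mulr_ge0// zeta_ge0.
Qed.

(** [phi] is the pairing of the operator at the point s of the segment with the fixed direction (du,
    dy). [prox_increment] makes it grow at rate at least E at interior points, and this is
    integrated over [0, 1]. *)
Lemma prox_strong_monotone_eta u y (eta : R) : 0 < eta -> D0 us ys u0 y0 u y ->
  mu * rho / alpha * dotv (u - us) (u - us) +
    kappa / (Lam + eta) * dotv (y - ys) (y - ys) <=
  rho * dotv (u - xt u y) (u - us) - dotv (y - ys) (g (xt u y) - g us).
Proof.
move=> eta0 [yge uyB]; have xs := saddle_fixed mu0 rho0 df dg cf cg sad.
have ys0 : nonneg ys by case: sad.
set du := u - us; set dy := y - ys.
pose U s := us + s *: du; pose Y s := ys + s *: dy; pose X s := xt (U s) (Y s).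
have Y0 s : 0 <= s -> s <= 1 -> nonneg (Y s).
  move=> s0 s1 j; rewrite !mxE (_ : _ + _ = (1 - s) * ys 0 j + s * y 0 j); last by ring.
  by rewrite addr_ge0// mulr_ge0 ?subr_ge0.
have UB s t : U t - U s = (t - s) *: du.
  by rewrite /U opprD addrACA subrr add0r scalerBl.
have YB s t : Y t - Y s = (t - s) *: dy.
  by rewrite /Y opprD addrACA subrr add0r scalerBl.
have U0 : U 0 = us by rewrite /U scale0r addr0.
have U1 : U 1 = u by rewrite /U scale1r addrC subrK.
have Y00 : Y 0 = ys by rewrite /Y scale0r addr0.
have Y1 : Y 1 = y by rewrite /Y scale1r addrC subrK.
have X0 : X 0 = us by rewrite /X U0 Y00.
have X1 : X 1 = xt u y by rewrite /X U1 Y1.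
have {}uyB : enorm du ^+ 2 + enorm dy ^+ 2 <= _ := uyB.
clearbody du dy.
set a := mu * rho / alpha; set b := kappa / _.
pose E := a * dotv du du + b * dotv dy dy.
pose phi s := rho * dotv (U s - X s) du - dotv dy (g (X s)).
suff : phi 0 + E <= phi 1.
  rewrite /phi X0 U0 X1 U1 subrr dotv0l mulr0 (dotvBr (g _)) /E; lra.
(* Here the segment is a single point, possibly not interior to [D0], and the claim is trivial. *)
have [/eqP|uy0] := eqVneq (enorm du ^+ 2 + enorm dy ^+ 2) 0.
  rewrite paddr_eq0 ?sqr_ge0// !sqrf_eq0 => /andP[/eqP/enorm_eq0 dux /eqP/enorm_eq0 dyx].
  have ux : U 1 = U 0 by rewrite /U dux !scaler0.
  have yx : Y 1 = Y 0 by rewrite /Y dyx !scaler0.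
  have E0 : E = 0 by rewrite /E dux dyx !dotv0l !mulr0 addr0.
  by rewrite E0 addr0 /phi /X ux yx.
have uyp : 0 < enorm du ^+ 2 + enorm dy ^+ 2.
  by rewrite lt_neqAle eq_sym uy0 addr_ge0// sqr_ge0.
pose Cx := (rho * enorm du + sg * enorm dy) / alpha.
have Cx0 : 0 <= Cx.
  by rewrite divr_ge0 ?(ltW alpha0)// addr_ge0// mulr_ge0 ?enorm_ge0 ?sqrtr_ge0// ltW.
have XL t r : 0 <= t -> t <= 1 -> 0 <= r -> r <= 1 ->
    enorm (X r - X t) <= Cx * `|r - t|.
  move=> t0 t1 r0 r1.
  apply: le_trans (xtilde_lipschitz mu0 rho0 df dg cf cg sigma0 jsigma _ _ _ _) _.
  - exact: Y0.
  - exact: Y0.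
  rewrite UB YB !enormZ /Cx /sg le_eqVlt; apply/orP; left; apply/eqP.
  by field; rewrite gt_eqF.
have phiB t r : phi r - phi t = rho * dotv ((U r - U t) - (X r - X t)) du -
    dotv dy (g (X r) - g (X t)).
  rewrite /phi; move: (U r) (U t) (X r) (X t) => p q v w.
  by rewrite !dotvBl (dotvBr (g v)); ring.
have EE : E = a * dotv du du + b * dotv dy dy by [].
clearbody E phi.
pose psi r := r * E - phi r.
suff : psi 1 <= psi 0 by rewrite /psi mul1r mul0r sub0r; lra.
pose Lp := `|E| + rho * ((enorm du + Cx) * enorm du) + enorm dy * (m%:R * sg * Cx).
apply: (ac_ae_nonincreasing ler01).
  apply: (@lipschitz_ac _ _ _ Lp) => t r t0 tr r1.
  have t1 := le_trans tr r1; have r0 := le_trans t0 tr.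
  have rt : 0 <= r - t by rewrite subr_ge0.
  have -> : psi r - psi t = (r - t) * E - (phi r - phi t) by rewrite /psi; ring.
  have hX := XL t r t0 t1 r0 r1; rewrite (ger0_norm rt) in hX.
  have h1 : `|rho * dotv ((U r - U t) - (X r - X t)) du| <=
      rho * ((enorm du + Cx) * enorm du) * (r - t).
    rewrite normrM (gtr0_norm rho0) -!mulrA ler_wpM2l ?(ltW rho0)//.
    apply: le_trans (dotv_abs_le_enorm _ _) _.
    rewrite [leRHS]mulrCA [leLHS]mulrC ler_wpM2l ?enorm_ge0//.
    apply: le_trans (enorm_triangle _ _) _; rewrite enormN UB enormZ ger0_norm//.
    by rewrite [leRHS]mulrDl [_ * enorm du]mulrC lerD2l.
  have h2 : `|dotv dy (g (X r) - g (X t))| <= enorm dy * (m%:R * sg * Cx) * (r - t).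
    apply: le_trans (dotv_abs_le_enorm _ _) _.
    rewrite -mulrA ler_wpM2l ?enorm_ge0// -mulrA.
    apply: le_trans (g_lipschitz dg cg sigma0 jsigma _ _) _.
    rewrite -/sg [in leRHS]mulrA -[leRHS]mulrA; apply: ler_wpM2l => //.
    by rewrite mulr_ge0// sqrtr_ge0.
  apply: le_trans (ler_normB _ _) _; rewrite normrM (ger0_norm rt) phiB /Lp.
  rewrite [leRHS]mulrDl [X in _ <= X + _]mulrDl -[leRHS]addrA; apply: lerD; first by rewrite mulrC.
  by apply: le_trans (ler_normB _ _) _; apply: lerD.
(* Only 0 < t < 1 is treated: at t = 1 the point may lie on the boundary of [D0], out of reach of
   [hessian_bound_near]. *)
apply: aeW => t t0 t1 e e0.
have t0' := ltW t0; have t1' := ltW t1.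
have inD : enorm (U t - us) ^+ 2 + enorm (Y t - ys) ^+ 2 <
    enorm (u0 - us) ^+ 2 + enorm (y0 - ys) ^+ 2.
  apply: lt_le_trans uyB.
  rewrite -[X in U t - X]U0 -[X in Y t - X]Y00 UB YB subr0 !enormZ !exprMn -mulrDr.
  by rewrite gtr_pMl// real_normK ?num_real// expr_lt1// ltW.
have Dt : D0 us ys u0 y0 (U t) (Y t) by split; [exact: Y0|exact: ltW].
have [r r0 hess] := hessian_bound_near (Y0 t t0' t1') inD.
have [C [d [C0 d0 Hd]]] := prox_increment (Y0 t t0' t1') r0 eta0 gamma0 hess.
(* The multipliers at t sum to at most m zeta, so the local constant is at least the uniform b. *)
have b_le : b <= kappa / (l + rho + (\sum_j Y t 0 j) * gamma + eta).
  have S0 : 0 <= (\sum_j Y t 0 j) * gamma.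
    by rewrite mulr_ge0// sumr_ge0// => j _; exact: Y0.
  have SL : (\sum_j Y t 0 j) * gamma <= m%:R * zeta * gamma.
    by rewrite ler_wpM2r// (sum_le_zeta Dt).
  rewrite /b ler_wpM2l ?(ltW kappa0)// lef_pV2 ?posrE.
  - by rewrite lerD2r lerD2l.
  - exact: addr_gt0 Lam_gt0 eta0.
  - by rewrite ltr_wpDl// !addr_ge0// ltW.
(* For |q - t| < e / C' the cubic error is at most e (q - t)^2. *)
pose C' := C * enorm dy * Cx ^+ 2 + 1.
have C'0 : 0 < C' := ltr_wpDl (mulr_ge0 (mulr_ge0 C0 (enorm_ge0 _)) (sqr_ge0 _)) ltr01.
have Cx1 : 0 < Cx + 1 by rewrite ltr_wpDl.
pose d' := Num.min (d / (Cx + 1)) (e / C').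
have d'0 : 0 < d' by rewrite lt_min !divr_gt0.
(* The factor q - t is kept, so that one inequality covers both sides of t. *)
have main q : 0 <= q -> q <= 1 -> `|q - t| < d' ->
    (q - t) ^+ 2 * (E - e) <= (q - t) * (phi q - phi t).
  move=> q0 q1; rewrite lt_min ltr_pdivlMr// ltr_pdivlMr// => /andP[qd qe].
  have hX := XL t q t0' t1' q0 q1.
  have hXn := le_trans (norm_le_enorm _) hX.
  have Xd : `|X q - X t| < d.
    apply: le_lt_trans qd; apply: le_trans hXn _.
    by rewrite mulrC ler_wpM2l// lerDl.
  have := Hd (U q) (Y q) (Y0 q q0 q1) Xd.
  have he : C * `|(q - t) *: dy| * `|X q - X t| ^+ 2 <= (q - t) ^+ 2 * e.
    apply: (@le_trans _ _ (C * (`|q - t| * enorm dy) * (Cx * `|q - t|) ^+ 2)).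
      apply: ler_pM; rewrite ?mulr_ge0 ?sqr_ge0//.
        by rewrite ler_wpM2l// normrZ ler_wpM2l// norm_le_enorm.
      have c0 : 0 <= Cx * `|q - t| := mulr_ge0 Cx0 (normr_ge0 _).
      by apply: lerXn2r => //; rewrite nnegrE.
    rewrite -[X in X * e]real_normK ?num_real// exprMn.
    rewrite [leLHS](_ : _ = `|q - t| ^+ 2 * (`|q - t| * (C * enorm dy * Cx ^+ 2))); last by ring.
    rewrite ler_wpM2l ?sqr_ge0//; apply: le_trans (ltW qe).
    by rewrite ler_wpM2l// lerDl.
  have e1 : dotv (U q - U t) (U q - U t) = (q - t) ^+ 2 * dotv du du.
    by rewrite UB dotvZl dotvZr mulrA expr2.
  have e2 : dotv (Y q - Y t) (Y q - Y t) = (q - t) ^+ 2 * dotv dy dy.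
    by rewrite YB dotvZl dotvZr mulrA expr2.
  have e3 : rho * dotv (U q - U t - (X q - X t)) (U q - U t) -
      dotv (Y q - Y t) (g (X q) - g (X t)) = (q - t) * (phi q - phi t).
    rewrite phiB UB YB dotvZr dotvZl mulrBr; congr (_ - _); exact: mulrCA.
  rewrite -/(X q) -/(X t) -/a e3 e1 e2 YB.
  set KK := kappa / (l + _ + _ + _).
  have hb : b * ((q - t) ^+ 2 * dotv dy dy) <= KK * ((q - t) ^+ 2 * dotv dy dy).
    by rewrite ler_wpM2r// mulr_ge0 ?sqr_ge0 ?dotv_ge0.
  move: hb he; rewrite EE.
  clearbody KK; move: (C * _ * _) (dotv du du) (dotv dy dy) ((q - t) ^+ 2).
  by move: ((q - t) * _) => P N D1 D2 t2; lra.
exists (Num.min (d' / 2) (Num.min t (1 - t))).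
  by rewrite !lt_min divr_gt0//= t0 subr_gt0.
move=> p q tp pt tq qt.
have [m1 m2 m3] : [/\ Num.min (d' / 2) (Num.min t (1 - t)) <= d' / 2,
    Num.min (d' / 2) (Num.min t (1 - t)) <= t &
    Num.min (d' / 2) (Num.min t (1 - t)) <= 1 - t].
  by rewrite !ge_min !lexx !orbT.
have dd : d' / 2 < d' by rewrite ltr_pdivrMr// ltr_pMr// ltr1n.
have p0 : 0 <= p by apply: le_trans tp; rewrite subr_ge0.
have p1 : p <= 1 by exact: le_trans t1'.
have q1 : q <= 1 by apply: le_trans qt _; rewrite -lerBrDl.
have q0 : 0 <= q by exact: le_trans tq.
have pd : `|p - t| < d'.
  rewrite ler0_norm ?subr_le0// opprB; apply: le_lt_trans dd.
  by apply: le_trans m1; rewrite lerBlDr -lerBlDl.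
have qd : `|q - t| < d'.
  rewrite ger0_norm ?subr_ge0//; apply: le_lt_trans dd.
  by apply: le_trans m1; rewrite lerBlDl.
have hq : (q - t) * (E - e) <= phi q - phi t.
  have [<-|qt'] := eqVneq t q; first by rewrite !subrr mul0r.
  have qtp : 0 < q - t by rewrite subr_gt0 lt_neqAle qt'.
  by rewrite -(ler_pM2l qtp) mulrA -expr2 main.
have hp : (t - p) * (E - e) <= phi t - phi p.
  have [<-|pt'] := eqVneq t p; first by rewrite !subrr mul0r.
  have ptp : 0 < t - p by rewrite subr_gt0 lt_neqAle eq_sym pt'.
  rewrite -(ler_pM2l ptp) mulrA -expr2 -[t - p]opprB sqrrN mulNr -mulrN.
  by rewrite (opprB (phi t)) main.
move: hq hp; rewrite /psi; move: (phi q) (phi p) (phi t) => A B D; lra.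
Qed.

(** Let eta tend to 0: the rate in y loses at most kappa eta / Lam^2. *)
Lemma prox_strong_monotone u y : D0 us ys u0 y0 u y ->
  mu * rho / alpha * dotv (u - us) (u - us) +
    kappa / Lam * dotv (y - ys) (y - ys) <=
  rho * dotv (u - xt u y) (u - us) - dotv (y - ys) (g (xt u y) - g us).
Proof.
move=> uy; have LL := Lam_gt0.
have K0 : 0 <= kappa / Lam ^+ 2 * dotv (y - ys) (y - ys).
  by rewrite mulr_ge0 ?dotv_ge0// divr_ge0 ?sqr_ge0// ltW.
apply: (continuous_onesided K0) => e e0.
have := prox_strong_monotone_eta e0 uy.
have : kappa / Lam - kappa / (Lam + e) <= kappa / Lam ^+ 2 * e.
  have Le0 : 0 < Lam + e by rewrite addr_gt0.
  have -> : kappa / Lam - kappa / (Lam + e) = kappa * e / (Lam * (Lam + e)).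
    by field; rewrite !gt_eqF.
  rewrite [leRHS]mulrAC ler_wpM2l ?mulr_ge0 ?(ltW kappa0) ?(ltW e0)//.
  rewrite lef_pV2 ?posrE ?mulr_gt0 ?exprn_gt0//.
  by rewrite expr2 ler_wpM2l ?(ltW LL)// lerDl ltW.
move=> /(ler_wpM2r (dotv_ge0 (y - ys))).
move: (dotv (y - ys) (y - ys)) (dotv (y - ys) _) => P Q; lra.
Qed.

End strong_monotonicity.

(** * Derivatives along a solution *)

Section absolute_continuity.
Context {R : realType}.
Variables (a b : R).
Hypothesis ab : a <= b.
Implicit Types (h k : R -> R).

Lemma ac_real_bounded h : ac_real a b h ->
  exists2 M, 0 <= M & forall t, a <= t -> t <= b -> `|h t| <= M.
Proof.
move=> /(_ 1 ltr01)[d d0 Hd].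
have unif p q : a <= p -> p <= q -> q <= b -> q - p < d -> `|h q - h p| < 1.
  move=> ap pq qb pqd.
  have := Hd 1%N (fun=> p) (fun=> q); rewrite !big_ord1; apply => // i j.
  by rewrite !ord1 eqxx.
pose P t := exists2 M, 0 <= M & forall s, a <= s -> s <= t -> `|h s| <= M.
have : P b.
  apply: (real_induction ab).
    by exists `|h a| => // s as_ sa; rewrite (le_anti (introT andP (conj sa as_))).
  (* Two points within d / 3 of x are less than d apart. *)
  move=> x ax xb; exists (d / 3); first by rewrite divr_gt0.
  move=> s t as_ tb xs sx xt tx [M M0 HM].
  exists (M + 1); first by rewrite addr_ge0.
  move=> r ar rt; have [rs|sr] := leP r s.
    by rewrite (le_trans (HM r ar rs))// lerDl.
  have h1 := HM s as_ (lexx s).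
  have h2 : `|h r - h s| < 1.
    by apply: unif => //; [exact: ltW|exact: le_trans tb|lra].
  rewrite -[h r](subrK (h s)); apply: le_trans (ler_normD _ _) _.
  by rewrite addrC lerD// ltW.
by move=> [M M0 HM]; exists M.
Qed.

Lemma ac_realD h k : ac_real a b h -> ac_real a b k ->
  ac_real a b (fun t => h t + k t).
Proof.
move=> Hh Hk e e0; have e2 : 0 < e / 2 by rewrite divr_gt0.
have [d d0 Hd] := Hh _ e2; have [d' d'0 Hd'] := Hk _ e2.
exists (Num.min d d'); first by rewrite lt_min d0.
move=> N p q H1 H2; rewrite lt_min => /andP[s1 s2].
rewrite [e]splitr; apply: le_lt_trans (ltrD (Hd N p q H1 H2 s1) (Hd' N p q H1 H2 s2)).
rewrite -big_split/=; apply: ler_sum => i _.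
by rewrite opprD addrACA ler_normD.
Qed.

Lemma ac_realM h k : ac_real a b h -> ac_real a b k ->
  ac_real a b (fun t => h t * k t).
Proof.
move=> Hh Hk; have [M M0 HM] := ac_real_bounded Hh.
have [M' M'0 HM'] := ac_real_bounded Hk.
move=> e e0; have e2 : 0 < e / 2 by rewrite divr_gt0.
have M1 : 0 < M + 1 by rewrite ltr_wpDl.
have M'1 : 0 < M' + 1 by rewrite ltr_wpDl.
have [d d0 Hd] := Hh _ (divr_gt0 e2 M'1).
have [d' d'0 Hd'] := Hk _ (divr_gt0 e2 M1).
exists (Num.min d d'); first by rewrite lt_min d0.
move=> N p q H1 H2; rewrite lt_min => /andP[s1 s2].
have := Hd N p q H1 H2 s1; rewrite ltr_pdivlMr// => h1.
have := Hd' N p q H1 H2 s2; rewrite ltr_pdivlMr// => h2.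
rewrite [e]splitr; apply: le_lt_trans (ltrD h1 h2).
rewrite !mulr_suml -big_split/=; apply: ler_sum => i _.
have [ap [pq qb]] := H1 i.
have -> : h (q i) * k (q i) - h (p i) * k (p i) =
    (h (q i) - h (p i)) * k (q i) + (k (q i) - k (p i)) * h (p i) by ring.
apply: le_trans (ler_normD _ _) _; rewrite !normrM; apply: lerD.
  rewrite ler_wpM2l//; apply: (@le_trans _ _ M'); last by rewrite lerDl.
  by apply: HM' => //; exact: le_trans pq.
rewrite ler_wpM2l//; apply: (@le_trans _ _ M); last by rewrite lerDl.
by apply: HM => //; exact: le_trans qb.
Qed.

Lemma ac_real_sum n (h : 'I_n -> R -> R) : (forall i, ac_real a b (h i)) ->
  ac_real a b (fun t => \sum_i h i t).
Proof.
elim: n h => [|n IH] h H.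
  move=> e e0; exists 1 => // N p q _ _ _.
  by rewrite big1// => i _; rewrite !big_ord0 subrr normr0.
have -> : (fun t => \sum_i h i t) =
    (fun t => h ord0 t + (fun t => \sum_i h (lift ord0 i) t) t).
  by apply/funext => t; rewrite big_ord_recl.
apply: ac_realD => //; exact: IH.
Qed.

Lemma ac_real_cst c : ac_real a b (fun=> c).
Proof.
by apply: (@lipschitz_ac _ _ _ 0) => s t _ _ _; rewrite subrr normr0 mul0r.
Qed.

Lemma ac_coord n (h : R -> 'rV[R]_n) i : abs_continuous a b h ->
  ac_real a b (fun t => h t 0 i).
Proof.
move=> H e e0; have [d d0 Hd] := H e e0; exists d => // N p q H1 H2 s.
apply: le_lt_trans (Hd N p q H1 H2 s); apply: ler_sum => j _.
apply: le_trans (norm_le_enorm _); apply: le_trans (coord_le_norm _ i).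
by rewrite !mxE.
Qed.

Lemma ac_dotv_sqr n (h : R -> 'rV[R]_n) c : abs_continuous a b h ->
  ac_real a b (fun t => dotv (h t - c) (h t - c)).
Proof.
move=> H; rewrite /dotv.
apply: (ac_real_sum (h := fun i t => (h t - c) 0 i * (h t - c) 0 i)) => i.
have A : ac_real a b (fun t => (h t - c) 0 i).
  have -> : (fun t => (h t - c) 0 i) = (fun t => h t 0 i + - c 0 i).
    by apply/funext => t; rewrite !mxE.
  by apply: ac_realD; [exact: ac_coord|exact: ac_real_cst].
exact: ac_realM.
Qed.

End absolute_continuity.

(** * Derivatives of the energy along a solution *)

Section real_derivative.
Context {R : realType}.
Implicit Types (h k : R -> R) (t : R).

(** The form of derivative that [straddle_approx] consumes. *)
Definition rderiv h t (D : R) : Prop := forall e, 0 < e -> exists2 d, 0 < d &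
  forall s : R, `|s| <= d -> `|h (t + s) - h t - s * D| <= e * `|s|.

Lemma rderivD h k t D D' : rderiv h t D -> rderiv k t D' ->
  rderiv (fun s => h s + k s) t (D + D').
Proof.
move=> Hh Hk e e0; have e2 : 0 < e / 2 by rewrite divr_gt0.
have [d d0 Hd] := Hh _ e2; have [d' d'0 Hd'] := Hk _ e2.
exists (Num.min d d'); first by rewrite lt_min d0.
move=> s; rewrite le_min => /andP[s1 s2].
have -> : h (t + s) + k (t + s) - (h t + k t) - s * (D + D') =
  (h (t + s) - h t - s * D) + (k (t + s) - k t - s * D') by ring.
apply: le_trans (ler_normD _ _) _; rewrite [e in leRHS]splitr mulrDl.
by apply: lerD; [exact: Hd|exact: Hd'].
Qed.

Lemma rderiv_sum n (h : 'I_n -> R -> R) t (D : 'I_n -> R) :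
  (forall i, rderiv (h i) t (D i)) -> rderiv (fun s => \sum_i h i s) t (\sum_i D i).
Proof.
elim: n h D => [|n IH] h D H.
  move=> e e0; exists 1 => // s _.
  by rewrite !big_ord0 mulr0 !subr0 normr0 mulr_ge0// ltW.
have -> : (fun t => \sum_i h i t) =
    (fun t => h ord0 t + (fun t => \sum_i h (lift ord0 i) t) t).
  by apply/funext => s; rewrite big_ord_recl.
rewrite big_ord_recl; apply: rderivD => //; exact: IH.
Qed.

Lemma rderivM h k t D D' : rderiv h t D -> rderiv k t D' ->
  rderiv (fun s => h s * k s) t (D * k t + h t * D').
Proof.
move=> Hh Hk e e0.
have [d1 d10 H1] := Hk 1 ltr01.
pose B := `|D'| + 1; have B0 : 0 < B by rewrite ltr_wpDl.
have kB s : `|s| <= d1 -> `|k (t + s) - k t| <= B * `|s|.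
  move=> sd; rewrite -[X in `|X|](subrK (s * D')).
  apply: le_trans (ler_normD _ _) _; apply: le_trans (lerD (H1 s sd) (lexx _)) _.
  by rewrite normrM /B mulrDl addrC [_ * `|D'|]mulrC.
have e3 : 0 < e / 3 by rewrite divr_gt0.
pose K := `|k t| + 1; have K0 : 0 < K by rewrite ltr_wpDl.
pose A := `|h t| + 1; have A0 : 0 < A by rewrite ltr_wpDl.
pose C := `|D| * B + 1; have C0 : 0 < C by rewrite ltr_wpDl// mulr_ge0// ltW.
have [d2 d20 H2] := Hh _ (divr_gt0 e3 K0).
have [d3 d30 H3] := Hk _ (divr_gt0 e3 A0).
exists (Num.min (Num.min d1 d2) (Num.min d3 (Num.min (1 / B) (e / 3 / C)))).
  by rewrite !lt_min d10 d20 d30 !divr_gt0.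
move=> s; rewrite !le_min => /andP[/andP[s1 s2] /and3P[s3 s4 s5]].
have kK : `|k (t + s)| <= K.
  rewrite -[k (t + s)](subrK (k t)); apply: le_trans (ler_normD _ _) _.
  rewrite /K addrC lerD2l; apply: le_trans (kB s s1) _.
  by rewrite mulrC -ler_pdivlMr.
have -> : h (t + s) * k (t + s) - h t * k t - s * (D * k t + h t * D') =
  (h (t + s) - h t - s * D) * k (t + s) + (s * D) * (k (t + s) - k t) +
  h t * (k (t + s) - k t - s * D') by ring.
have b1 : `|(h (t + s) - h t - s * D) * k (t + s)| <= e / 3 * `|s|.
  rewrite normrM; apply: (@le_trans _ _ (e / 3 / K * `|s| * K)).
    by apply: ler_pM => //; exact: H2.
  by rewrite mulrAC divfK// gt_eqF.
have b2 : `|(s * D) * (k (t + s) - k t)| <= e / 3 * `|s|.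
  rewrite !normrM; apply: (@le_trans _ _ (`|s| * `|D| * (B * `|s|))).
    by rewrite ler_wpM2l ?mulr_ge0// kB.
  rewrite -[`|s| * `|D|]mulrC -!mulrA (mulrC `|s|) !mulrA ler_wpM2r//.
  move: s5; rewrite ler_pdivlMr// => s5; apply: le_trans s5.
  by rewrite mulrC ler_wpM2l// lerDl.
have b3 : `|h t * (k (t + s) - k t - s * D')| <= e / 3 * `|s|.
  rewrite normrM; apply: (@le_trans _ _ (A * (e / 3 / A * `|s|))).
    apply: ler_pM => //; first by rewrite lerDl.
    exact: H3.
  by rewrite mulrA [A * _]mulrC divfK// gt_eqF.
apply: le_trans (ler_normD _ _) _; apply: le_trans (lerD (ler_normD _ _) (lexx _)) _.
lra.
Qed.

Lemma rderiv_cst c t : rderiv (fun=> c) t 0.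
Proof. by move=> e e0; exists 1 => // s _; rewrite subrr mulr0 subrr normr0 mulr_ge0// ltW. Qed.

Lemma rderiv_coord n (h : R -> 'rV[R]_n) t D i : is_derive t 1 h D ->
  rderiv (fun s => h s 0 i) t (D 0 i).
Proof.
move=> [dh <-] e e0; have [d d0 Hd] := derivable_approx dh e0.
exists d => // s sd; have := Hd s sd; rewrite /GRing.scale/= mulr1.
move=> h1; apply: le_trans h1; apply: le_trans (coord_le_norm _ i).
by rewrite !mxE.
Qed.

Lemma rderiv_dotv_sqr n (h : R -> 'rV[R]_n) t D c : is_derive t 1 h D ->
  rderiv (fun s => dotv (h s - c) (h s - c)) t (2 * dotv (h t - c) D).
Proof.
move=> Hh; rewrite /dotv mulr_sumr.
apply: (rderiv_sum (h := fun i s => (h s - c) 0 i * (h s - c) 0 i)) => i.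
have A : rderiv (fun s => (h s - c) 0 i) t (D 0 i).
  have -> : (fun s => (h s - c) 0 i) = (fun s => h s 0 i + - c 0 i).
    by apply/funext => s; rewrite !mxE.
  by rewrite -[D 0 i]addr0; apply: rderivD; [exact: rderiv_coord|exact: rderiv_cst].
have := rderivM A A; congr rderiv; ring.
Qed.

Lemma rderiv_expR c t : rderiv (fun s => expR (c * s)) t (c * expR (c * t)).
Proof.
move=> e e0; have dexp : derivable (@expR R) 0 1 by exact: derivable_expR.
have c1 : 0 < `|c| + 1 by rewrite ltr_wpDl.
pose E := expR (c * t); have E0 : 0 < E by exact: expR_gt0.
have [d d0 Hd] := derivable_approx dexp (divr_gt0 e0 (mulr_gt0 E0 c1)).
exists (d / (`|c| + 1)); first by rewrite divr_gt0.
move=> s; rewrite ler_pdivlMr// => sd.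
have csd : `|c * s| <= d.
  by rewrite normrM mulrC; apply: le_trans sd; rewrite ler_wpM2l// lerDl.
have := Hd _ csd; rewrite /GRing.scale/= mulr1 add0r expR0.
have -> : 'D_1 (@expR R) 0 = 1.
  by case: (is_derive_expR (0 : R)) => _ ->; rewrite expR0.
move=> h1; rewrite mulrDr expRD -/E.
have -> : E * expR (c * s) - E - s * (c * E) = E * (expR (c * s) - 1 - c * s * 1) by ring.
rewrite normrM gtr0_norm//; apply: le_trans (ler_wpM2l (ltW E0) h1) _.
rewrite normrM invfM !mulrA.
have -> : E * e / E / (`|c| + 1) * `|c| * `|s| = e * (`|c| / (`|c| + 1)) * `|s|.
  by field; rewrite !gt_eqF.
rewrite ler_wpM2r// ler_piMr ?(ltW e0)// ler_pdivrMr// mul1r lerDl//.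
Qed.

(** The inequality 1 - exp (-x) <= x gives the Lipschitz constant c exp (c T). *)
Lemma ac_expR (c T : R) : 0 <= c -> ac_real 0 T (fun s => expR (c * s)).
Proof.
move=> c0; apply: (@lipschitz_ac _ _ _ (expR (c * T) * c)) => s t s0 st tT.
have cst : c * s <= c * t by rewrite ler_wpM2l.
rewrite ger0_norm ?subr_ge0 ?ler_expR//.
apply: (@le_trans _ _ (expR (c * t) * (c * (t - s)))).
  have -> : expR (c * s) = expR (c * t) * expR (- (c * (t - s))).
    by rewrite -expRD; congr expR; ring.
  rewrite -{1}[expR (c * t)]mulr1 -mulrBr ler_wpM2l ?expR_ge0//.
  by have := expR_ge1Dx (- (c * (t - s))); lra.
rewrite -mulrA ler_wpM2r ?mulr_ge0 ?subr_ge0// ler_expR ler_wpM2l//.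
Qed.

End real_derivative.

(** Where y_j > 0 the projection changes nothing; where y_j = 0 it can only raise s_j, whose weight
    - z_j is nonpositive. *)
Lemma pos_proj_le (R : realType) m (y s z : 'rV[R]_m) : nonneg y -> nonneg z ->
  dotv (y - z) (pos_proj y s) <= dotv (y - z) s.
Proof.
move=> y0 z0; apply: ler_sum => j _; rewrite !mxE.
case: ifP => // /negbT; rewrite -leNgt => yj.
have -> : y 0 j = 0 by apply/le_anti; rewrite yj y0.
by rewrite sub0r !mulNr lerN2 ler_wpM2l ?z0// le_max lexx.
Qed.

(** * Exponential decay along solutions *)

Theorem mainTheorem17 (R : realType) (n m : nat)
    (f : 'rV[R]_n -> R) (g : 'rV[R]_n -> 'rV[R]_m)
    (mu l sigma kappa rho : R) (us : 'rV[R]_n) (ys : 'rV[R]_m) :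
  0 < mu -> 0 < l -> 0 < sigma -> 0 < kappa -> 0 < rho ->
  (forall x : 'rV[R]_n, differentiable f x) ->
  continuous (grad f) ->
  convex_on_space f ->
  (forall j, convex_on_space (coord_fun g j)) ->
  (forall j (x : 'rV[R]_n), differentiable (coord_fun g j) x) ->
  (forall j, locally_lipschitz_grad (coord_fun g j)) ->
  strongly_convex mu f ->
  lipschitz_grad l f ->
  (forall x, hessian_defined f x ->
     loewner_le (hessian f x) l%:M /\ loewner_le mu%:M (hessian f x)) ->
  (forall x, row_free (jac g x)) ->
  (forall x, loewner_le (jac g x *m (jac g x)^T) sigma%:M /\
             loewner_le kappa%:M (jac g x *m (jac g x)^T)) ->
  saddle_point (Ltilde f g rho) us ys ->
  forall (u0 : 'rV[R]_n) (y0 : 'rV[R]_m), nonneg y0 ->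
  forall zeta gamma : R,
  0 <= gamma ->
  (forall u y, D0 us ys u0 y0 u y -> enorm y <= zeta) ->
  (forall u y, D0 us ys u0 y0 u y ->
     forall j, hessian_defined (coord_fun g j) (xtilde f g rho u y) ->
       loewner_le (hessian (coord_fun g j) (xtilde f g rho u y)) gamma%:M) ->
  let c := Num.min (mu * rho / (mu + rho))
                   (kappa / (l + rho + m%:R * zeta * gamma)) in
  0 < c /\
  forall (u : R -> 'rV[R]_n) (y : R -> 'rV[R]_m),
    ppd_solution f g rho u y -> u 0 = u0 -> y 0 = y0 ->
    forall t : R, 0 <= t ->
      enorm2 (u t - us) (y t - ys) <=
        enorm2 (u0 - us) (y0 - ys) * expR (- (c * t)).
Proof.
move=> mu0 l0 sigma0 kappa0 rho0 df _ _ cvg dg lg scf lf _ _ jac2 sad.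
have cf := strongly_convex_mconvex scf.
have cg j := convex_on_space_mconvex (cvg j).
have js x := (jac2 x).1; have jk x := (jac2 x).2.
move=> u0 y0 y00 zeta gamma gamma0 Hz Hg.
have Lam0 := Lam_gt0 l0 rho0 sad gamma0 Hz.
set a := mu * rho / (mu + rho); set b := kappa / _; move=> c.
have a0 : 0 < a by rewrite divr_gt0 ?mulr_gt0 ?addr_gt0.
have b0 : 0 < b by rewrite divr_gt0.
have c0 : 0 < c by rewrite lt_min a0.
split=> // u y [ynn uac yac ode] u0E y0E t t0.
(* Absolute continuity is given on [0, T] with T > 0. *)
have [->|tn] := eqVneq t 0; first by rewrite u0E y0E mulr0 oppr0 expR0 mulr1.
have {tn}t0 : 0 < t by rewrite lt_neqAle eq_sym tn.
have [ys0 _] := sad.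
pose V s := dotv (u s - us) (u s - us) + dotv (y s - ys) (y s - ys).
have VE s : V s = enorm (u s - us) ^+ 2 + enorm (y s - ys) ^+ 2.
  by rewrite !enorm_sqr.
pose x s := xtilde f g rho (u s) (y s).
(* The monotonicity pairing with the saddle point, where the first component of the operator
   vanishes since [xtilde us ys] is [us]. *)
pose M s := rho * dotv (u s - x s) (u s - us) - dotv (y s - ys) (g (x s) - g us).
have M0 s : 0 <= s -> 0 <= M s.
  by move=> s0; exact: (prox_monotone mu0 rho0 df dg cf cg sad (u s) (ynn s s0)).
have Vac T : 0 < T -> ac_real 0 T V.
  move=> T0; apply: ac_realD; apply: ac_dotv_sqr; rewrite ?ltW//; [exact: uac|exact: yac].
have Vder : {ae @lebesgue_measure R, forall s, 0 < s ->
    exists2 D, rderiv V s D & D <= - 2 * M s}.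
  move: ode; apply: filterS; first exact: (ae_filter_ringOfSetsType (@lebesgue_measure R)).
  move=> s Hs s0; have [du dy] := Hs s0.
  eexists; first by apply: rderivD; [exact: rderiv_dotv_sqr du|exact: rderiv_dotv_sqr dy].
  rewrite -/(x s).
  (* [h1] removes the projection; [h2] allows g us to be subtracted from g (x s), which produces
     [M s]. *)
  have h1 := pos_proj_le (g (x s)) (ynn s (ltW s0)) ys0.
  have h2 := saddle_variational mu0 rho0 df dg cf cg sigma0 js sad (ynn s (ltW s0)).
  rewrite -scalerBr dotvNr dotvZr (dotvC (u s - us)) /M (dotvBr (g (x s))).
  lra.
have Vle s : 0 <= s -> V s <= V 0.
  rewrite le_eqVlt => /predU1P[<-//|s0].
  apply: (ac_ae_nonincreasing (ltW s0) (Vac s s0)).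
  move: Vder; apply: filterS; first exact: (ae_filter_ringOfSetsType (@lebesgue_measure R)).
  move=> r Hr r0 rs; have [D HD Dle] := Hr r0.
  apply: (straddle_approx _ HD); apply: le_trans Dle _.
  by have := M0 r (ltW r0); lra.
have inD s : 0 <= s -> D0 us ys u0 y0 (u s) (y s).
  by move=> s0; split; [exact: ynn|rewrite -VE -u0E -y0E -VE Vle].
pose W s := expR (2 * c * s) * V s.
have Wt : W t <= W 0.
  apply: (ac_ae_nonincreasing (ltW t0)).
    apply: ac_realM; [exact: ltW| |exact: Vac].
    by apply: ac_expR; rewrite mulr_ge0// ltW.
  move: Vder; apply: filterS; first exact: (ae_filter_ringOfSetsType (@lebesgue_measure R)).
  move=> s Hs s0 st; have [D HD Dle] := Hs s0.
  apply: (straddle_approx _ (rderivM (rderiv_expR (2 * c) s) HD)).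
  have MS := prox_strong_monotone mu0 l0 sigma0 kappa0 rho0 df dg cf cg lf lg js jk
    sad gamma0 Hz Hg (inD s (ltW s0)).
  rewrite -/a -/b -/(x s) -/(M s) in MS.
  have -> : 2 * c * expR (2 * c * s) * V s + expR (2 * c * s) * D =
    expR (2 * c * s) * (2 * c * V s + D) by ring.
  rewrite pmulr_rle0 ?expR_gt0// /V.
  have ca : c * dotv (u s - us) (u s - us) <= a * dotv (u s - us) (u s - us).
    by rewrite ler_wpM2r ?dotv_ge0// ge_min lexx.
  have cb : c * dotv (y s - ys) (y s - ys) <= b * dotv (y s - ys) (y s - ys).
    by rewrite ler_wpM2r ?dotv_ge0// ge_min lexx orbT.
  move: MS ca cb Dle.
  move: (dotv (u s - us) (u s - us)) (dotv (y s - ys) (y s - ys)) (M s) => P Q N.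
  clearbody a b c; lra.
have V0 : 0 <= V t by rewrite addr_ge0 ?dotv_ge0.
have VtE : V t <= V 0 * expR (- (c * t)) ^+ 2.
  move: Wt; rewrite /W mulr0 expR0 mul1r => Wt.
  have -> : expR (- (c * t)) ^+ 2 = (expR (2 * c * t))^-1.
    by rewrite -expRN expr2 -expRD; congr expR; ring.
  by rewrite ler_pdivlMr ?expR_gt0// mulrC.
rewrite /enorm2 -VE -u0E -y0E -VE.
rewrite -[X in _ * X](ger0_norm (expR_ge0 _)) -sqrtr_sqr -sqrtrM; last first.
  by rewrite addr_ge0 ?dotv_ge0.
exact: ler_wsqrtr.
Qed.
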